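(* Let $m\ge1$ and $0\le s\le m$ be integers, and let $\mu_D:=(2^{(s)},1^{(2m+2-2s)},0^{(s)})$, a cocharacter of the root datum of split $GO_{2m+2}$. Then an element $w\in\widetilde W_{D_{m+1}}$ of the extended affine Weyl group is $\mu_D$-admissible if and only if $w$ is $\mu_D$-spin-permissible.
   Context: Notation. For $v\in\mathbb R^n$, $v(j)$ is the $j$th entry, $v^*$ is the reversed vector $v^*(j)=v(n+1-j)$, $\mathbf d=(d,\dots,d)$, $v\ge w$ means entrywise, and $(d^{(i)},e^{(j)},\dots)$ denotes $d$ repeated $i$ times, then $e$ repeated $j$ times, etc. Put $N:=m+1\ge2$ and $i^*:=2N+1-i$ for $i\in\{1,\dots,2N\}$. Root datum. $X_*:=\{x\in\mathbb Z^{2N}: x_1+x_{2N}=x_2+x_{2N-1}=\dots=x_N+x_{N+1}\}$; $Q^\vee:=\{x\in X_*: x_i+x_{i^*}=0\ \forall i,\ x_1+\dots+x_N\text{ even}\}$ (coroot lattice); $S_{2N}^\circ$ is the group of permutations $\sigma\in S_{2N}$ that are even and satisfy $\sigma(i^* )=\sigma(i)^*$ for all $i$ (Weyl group). $\widetilde W_{D_N}:=X_*\rtimes S_{2N}^\circ$ acts on $\mathbb R^{2N}$ by affine transformations, $X_*$ by translations (denoted $t_\lambda$) and $S_{2N}^\circ$ by permuting coordinates. $W_{\mathrm{aff}}:=Q^\vee\rtimes S_{2N}^\circ$. Put $\mathcal A:=X_*\otimes\mathbb R\subset\mathbb R^{2N}$, with affine root hyperplanes $\{x_i-x_j=d\}$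 for $j\neq i,i^*$, $d\in\mathbb Z$, and base alcove $A:=\{x\in\mathcal A: x_1,\,x_{2N}-1<x_2<x_3<\dots<x_{N-1}<x_N,\,x_{N+1}\}$ (for $N=2$: $x_1,x_4-1<x_2,x_3$). Bruhat order. $W_{\mathrm{aff}}$ is a Coxeter group generated by the reflections across the walls of $A$; with $\Omega$ the stabilizer of $A$ in $\widetilde W_{D_N}$ one has $\widetilde W_{D_N}=W_{\mathrm{aff}}\rtimes\Omega$, and $x\tau\le x'\tau'$ iff $\tau=\tau'$ and $x\le x'$ in the Bruhat order of $W_{\mathrm{aff}}$ ($x,x'\in W_{\mathrm{aff}}$, $\tau,\tau'\in\Omega$). $w$ is $\mu_D$-admissible if $w\le t_\lambda$ for some $\lambda\in S_{2N}^\circ\cdot\mu_D$. Spin-permissibility. For $k=2Nb+c$ with $0\le c<2N$ let $\omega_k:=((-1)^{(c)},0^{(2N-c)})-\mathbf b\in\mathbb Z^{2N}$ and $\mu_k^w:=w\omega_k-\omega_k$. $\mu_k^w$ is self-dual if $\mu_k^w=\mu_{-k}^w$. For $0\le k\le N$ let $A_k:=\{1,\dots,k\}\cup\{2N+1-k,\dots,2N\}$ and $B_k:=\{k+1,\dots,2N-k\}$. $w$ is $\mu_D$-spin-permissible if for all $0\le k\le N$: (SP1) $\mu_k^w+(\mu_{-k}^w)^*=\mathbf2$ and $\mathbf0\le\mu_k^w\le\mathbf2$; (SP2) $\#\{j:\mu_k^w(j)=2\}\le s$; (SP3) if $\mu_k^w$ is self-dual and $\mu_k^w\not\equiv\mu_D\bmod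 Q^\vee$, then there exist $j_1\in A_k$ and $j_2\in B_k$ with $\mu_k^w(j_1)=\mu_k^w(j_2)=1$. *)

(* Defs.v *)
From HB Require Import structures.
From mathcomp Require Import all_boot all_order all_algebra all_fingroup.
From mathcomp Require Import classical_sets reals topology normedtype.
From Stdlib Require Import Relation_Operators.

Set Implicit Arguments.
Unset Strict Implicit.
Unset Printing Implicit Defensive.

Import Order.TTheory GRing.Theory Num.Theory.
Import numFieldNormedType.Exports.

Local Open Scope classical_set_scope.
Local Open Scope ring_scope.

(* Coordinates are indexed by 'I_(2 * N), i.e. from 0: the coordinate x_i of
   the mathematical text is x 0 (i - 1), and the involution i |-> i^* is
   rev_ord. *)

(* sigma sends the i-th basis vector to the (sigma i)-th one. *)
Definition permv (T : Type) (n : nat) (sigma : 'S_n) (x : 'rV[T]_n) : 'rV[T]_n :=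
  col_perm sigma^-1%g x.

(* AffPerm lambda sigma is the transformation t_lambda o sigma. *)
Record affperm (n : nat) := AffPerm { transl : 'rV[int]_n; linpart : 'S_n }.

Section AffPermGroup.
Variable n : nat.

Definition affperm_to_pair (w : affperm n) := (transl w, linpart w).
Definition affperm_of_pair (p : 'rV[int]_n * 'S_n) := AffPerm p.1 p.2.

Lemma affperm_to_pairK : cancel affperm_to_pair affperm_of_pair.
Proof. by case. Qed.

HB.instance Definition _ := Choice.copy (affperm n) (can_type affperm_to_pairK).

(* Composition of transformations; (s * t)%g in 'S_n applies s first. *)
Definition affperm_mul (w w' : affperm n) : affperm n :=
  AffPerm (transl w + permv (linpart w) (transl w'))
          (linpart w' * linpart w)%g.

Definition affperm_one : affperm n := AffPerm 0 1%g.

Definition affperm_inv (w : affperm n) : affperm n :=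
  AffPerm (- permv (linpart w)^-1%g (transl w)) (linpart w)^-1%g.

Lemma affperm_mulA : associative affperm_mul.
Proof.
move=> [a s] [b t] [c u]; rewrite /affperm_mul /=; congr AffPerm; last first.
  by rewrite mulgA.
by apply/rowP=> i; rewrite !mxE addrA invMg permM.
Qed.

Lemma affperm_mul1 : left_id affperm_one affperm_mul.
Proof.
move=> [a s]; rewrite /affperm_mul /=; congr AffPerm; last by rewrite mulg1.
by apply/rowP=> i; rewrite !mxE add0r invg1 perm1.
Qed.

Lemma affperm_mulV : left_inverse affperm_one affperm_inv affperm_mul.
Proof.
move=> [a s]; rewrite /affperm_mul /=; congr AffPerm; last by rewrite mulgV.
by apply/rowP=> i; rewrite !mxE addNr.
Qed.

Lemma affperm_mulg1 : right_id affperm_one affperm_mul.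
Proof.
move=> [a s]; rewrite /affperm_mul /=; congr AffPerm; last by rewrite mul1g.
by apply/rowP=> i; rewrite !mxE addr0.
Qed.

Lemma affperm_mulgV : right_inverse affperm_one affperm_inv affperm_mul.
Proof.
move=> [a s]; rewrite /affperm_mul /=; congr AffPerm; last by rewrite mulVg.
by apply/rowP=> i; rewrite !mxE invgK permKV subrr.
Qed.

HB.instance Definition _ := isGroup.Build (affperm n)
  affperm_mulA affperm_mul1 affperm_mulg1 affperm_mulV affperm_mulgV.

End AffPermGroup.

(* Action on T^n; used with T the real field, and with T = int on Z^n. *)
Definition act (T : nzRingType) (n : nat) (w : affperm n) (x : 'rV[T]_n) :
  'rV[T]_n := map_mx intr (transl w) + permv (linpart w) x.

Lemma actM (T : nzRingType) (n : nat) (w w' : affperm n) (x : 'rV[T]_n) :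
  act (w * w')%g x = act w (act w' x).
Proof.
by apply/rowP=> i; rewrite !mxE rmorphD /= addrA invMg permM.
Qed.

(* The reflections are the conjugates of S by elements of the subgroup it
   generates; since every u in S used below is an involution, words need no
   inverse letters. *)
Section Bruhat.
Variables (G : groupType) (S : set G).

Definition has_word (x : G) (k : nat) : Prop :=
  exists l : seq G, [/\ size l = k, (forall u, u \in l -> S u)
                      & x = (\prod_(u <- l) u)%g].

Definition has_length (x : G) (k : nat) : Prop :=
  has_word x k /\ forall k', has_word x k' -> (k <= k')%N.

Definition cox_reflection (t : G) : Prop :=
  exists u s, [/\ exists k, has_word u k, S s & t = (u * s * u^-1)%g].

Definition bruhat_step (x y : G) : Prop :=
  exists2 t, cox_reflection t & y = (x * t)%g /\
    exists k l, [/\ has_length x k, has_length y l & (k < l)%N].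

Definition bruhat_le : G -> G -> Prop := clos_refl_trans G bruhat_step.

End Bruhat.

(* The root datum is that of split GO_{2N}. For T = int this is X_*; for T = R
   the same linear system cuts out X_* \otimes R. *)
Definition in_Xstar (T : nzRingType) (N : nat) (x : 'rV[T]_(2 * N)) : bool :=
  [forall i, forall j,
     x 0 i + x 0 (rev_ord i) == x 0 j + x 0 (rev_ord j)].

Definition in_coroot (N : nat) (x : 'rV[int]_(2 * N)) : bool :=
  [&& in_Xstar x, [forall i, x 0 i + x 0 (rev_ord i) == 0]
    & (2 %| (\sum_(i < 2 * N | (i < N)%N) x 0 i))%Z].

Definition in_W0 (N : nat) (sigma : 'S_(2 * N)) : bool :=
  ~~ odd_perm sigma && [forall i, sigma (rev_ord i) == rev_ord (sigma i)].

Definition in_Wext (N : nat) (w : affperm (2 * N)) : bool :=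
  in_Xstar (transl w) && in_W0 (linpart w).

Definition in_Waff (N : nat) (w : affperm (2 * N)) : bool :=
  in_coroot (transl w) && in_W0 (linpart w).

Definition apartment (R : realType) (N : nat) : set 'rV[R]_(2 * N) :=
  [set x | in_Xstar x].
Arguments apartment : clear implicits.

(* The index pairs (i, j) of the roots x_i - x_j. *)
Definition is_root (N : nat) (i j : 'I_(2 * N)) : bool :=
  (j != i) && (j != rev_ord i).

Definition root_hyperplane (R : realType) (N : nat) (i j : 'I_(2 * N))
    (d : int) : set 'rV[R]_(2 * N) :=
  [set x | apartment R N x /\ x 0 i - x 0 j = d%:~R].
Arguments root_hyperplane R {N} i j d _.

(* On the apartment, the reflection across x_i - x_j = d sends x_i to x_j + d,
   x_j to x_i - d, x_{i^*} to x_{j^*} - d and x_{j^*} to x_{i^*} + d. *)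
Definition root_reflection (N : nat) (i j : 'I_(2 * N)) (d : int) :
    affperm (2 * N) :=
  AffPerm (d *: (delta_mx 0 i - delta_mx 0 j
                 - delta_mx 0 (rev_ord i) + delta_mx 0 (rev_ord j)))
          (tperm i j * tperm (rev_ord i) (rev_ord j))%g.

(* In 1-based indices, the chain of inequalities defining the alcove says that
   x_i < x_j for 1 <= i < j <= N+1 with (i, j) <> (N, N+1), and that
   x_{2N} - 1 < x_j for 2 <= j <= N+1; in this form it also covers N = 2. *)
Definition alcove (R : realType) (N : nat) : set 'rV[R]_(2 * N) :=
  [set x | [/\ apartment R N x,
     forall i j : 'I_(2 * N), (i < j <= N)%N -> i != N.-1 :> nat ->
       x 0 i < x 0 j
   & forall i j : 'I_(2 * N), i = (2 * N).-1 :> nat -> (0 < j <= N)%N ->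
       x 0 i - 1 < x 0 j]].
Arguments alcove : clear implicits.

(* H is a wall of the alcove if it carries one of its faces: some point of the
   closure of the alcove lies on H and on no other affine root hyperplane. *)
Definition is_wall (R : realType) (N : nat) (H : set 'rV[R]_(2 * N)) : Prop :=
  exists a, [/\ H a, closure (alcove R N) a
    & forall (i j : 'I_(2 * N)) (d : int), is_root i j ->
        root_hyperplane R i j d a -> root_hyperplane R i j d = H].

Definition simple_reflection (R : realType) (N : nat) : set (affperm (2 * N)) :=
  [set s | exists i j d, [/\ is_root i j, is_wall (root_hyperplane R i j d)
                           & s = root_reflection i j d]].
Arguments simple_reflection : clear implicits.

Definition in_Omega (R : realType) (N : nat) (w : affperm (2 * N)) : Prop :=
  in_Wext w /\ act w @` alcove R N = alcove R N.

Definition ext_bruhat_le (R : realType) (N : nat) (w w' : affperm (2 * N)) :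
    Prop :=
  exists x x' tau, [/\ in_Waff x, in_Waff x', in_Omega R tau,
    w = (x * tau)%g /\ w' = (x' * tau)%g
    & bruhat_le (simple_reflection R N) x x'].

Definition mu_D (N s : nat) : 'rV[int]_(2 * N) :=
  \row_j (if (j < s)%N then 2 else if (j < 2 * N - s)%N then 1 else 0).

Definition admissible (R : realType) (N : nat) (mu : 'rV[int]_(2 * N))
    (w : affperm (2 * N)) : Prop :=
  exists2 sigma, in_W0 sigma &
    ext_bruhat_le R w (AffPerm (permv sigma mu) 1%g).

Definition omega (N : nat) (k : int) : 'rV[int]_(2 * N) :=
  \row_j ((if (j%:Z < (k %% (2 * N)%N)%Z) then -1 else 0)
          - (k %/ (2 * N)%N)%Z).

Definition mu_k (N : nat) (w : affperm (2 * N)) (k : int) : 'rV[int]_(2 * N) :=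
  act w (omega N k) - omega N k.

Definition rev_vec (n : nat) (v : 'rV[int]_n) : 'rV[int]_n :=
  \row_j v 0 (rev_ord j).

Definition A_ (N k : nat) : {set 'I_(2 * N)} :=
  [set j : 'I_(2 * N) | (j < k)%N || (2 * N - k <= j)%N]%SET.

Definition B_ (N k : nat) : {set 'I_(2 * N)} :=
  [set j : 'I_(2 * N) | (k <= j < 2 * N - k)%N]%SET.

Definition self_dual (N : nat) (w : affperm (2 * N)) (k : int) : Prop :=
  mu_k w k = mu_k w (- k).

Definition SP1 (N : nat) (w : affperm (2 * N)) (k : nat) : Prop :=
  mu_k w k%:Z + rev_vec (mu_k w (- k%:Z)) = const_mx 2 /\
  forall j, 0 <= mu_k w k%:Z 0 j <= 2.

Definition SP2 (N s : nat) (w : affperm (2 * N)) (k : nat) : Prop :=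
  (#|[pred j | (mu_k w k%:Z 0 j == 2)%R]| <= s)%N.

Definition SP3 (N s : nat) (w : affperm (2 * N)) (k : nat) : Prop :=
  self_dual w k%:Z -> ~~ in_coroot (mu_k w k%:Z - mu_D N s) ->
  exists j1 j2, [/\ j1 \in A_ N k, j2 \in B_ N k,
                    mu_k w k%:Z 0 j1 = 1 & mu_k w k%:Z 0 j2 = 1].

Definition spin_permissible (N s : nat) (w : affperm (2 * N)) : Prop :=
  forall k, (k <= N)%N -> [/\ SP1 w k, SP2 s w k & SP3 s w k].

(* Main.v *)
(* Write mu_k^w = X_k + 1, so that X_k has its entries in {-1, 0, 1} when w is
   spin-permissible. The Bruhat order enters only through the criterion that, for
   an affine reflection r, one has w < r w if and only if the alcoves of 1 and of
   w lie on the same side of the hyperplane of r.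

   Admissible implies spin-permissible: the conditions hold, with exactly s twos
   in each mu_k, for the translations by the conjugates of mu_D, and they pass
   from w to r w when the hyperplane of r separates the alcoves of 1 and w,
   because then r moves each w omega_k towards omega_k.

   Conversely, it suffices to show that a spin-permissible w that is not one of
   these translations has a reflection r with w < r w and r w spin-permissible:
   the squared distance from the base point to the alcove of w increases along
   such steps and is bounded. Regard k as a cyclic time. The number n_k of entries
   equal to 1 in X_k is congruent to s mod 2 at k = 0 and k = N. If n_k is
   constant, one may exchange the values -1 and 0 of two entries over a time
   interval or, when w is a translation, turn two zeros into 1 and -1. Otherwise
   take a time b at which n_k drops to its minimum; the entries b and w(b) become zero there,
   and w can be modified on the interval reaching to the next change. Only the
   condition on self-dual vertices can obstruct this filling, and then an
   exchange starting at the end of the interval works instead. *)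

Require Import Defs.
From mathcomp Require Import boolp classical_sets reals topology normedtype.
From mathcomp Require Import all_boot all_order all_algebra all_fingroup.
From mathcomp Require Import zify ring lra.
From Stdlib Require Import Classical Relation_Operators.

Set Implicit Arguments.
Unset Strict Implicit.
Unset Printing Implicit Defensive.

Import Order.TTheory GRing.Theory Num.Theory.
Import numFieldNormedType.Exports.

Local Open Scope ring_scope.

(** * Extended affine Weyl group elements in coordinates *)

(** Between the times t and t + 1 the entry t of X rises by 1 and the entry w(t) falls by 1.
    Multiplying w on the right by the reflection in x_b - x_e = [e < b] shifts the entries w(b) and
    w(e) by +1 and -1 exactly over the cyclic interval (b, e], so the search for a reflection
    becomes a search for an interval of times.

    The obstacle is duality: the same reflection shifts the entries w(b)^* and w(e)^* over the
    mirror image of the interval under k |-> 2N - k. Let b be a drop to the minimum m of n_k, and e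
    the next time that is not a fixed point with nonzero entry. If e is not b^*, the interval misses
    its mirror image and filling raises n_k by 1. If e = b^*, then (b, e) is not a root; but the
    interval is its own mirror image and contains 0 or N, so m has the parity of s and m + 2 <= s.
    The filling then continues to the next such time d and gives n_k = m + 2 throughout, so that the
    self-dual condition is void. If n_k drops again at d, the argument restarts there; s < N
    guarantees a zero entry outside two given dual pairs, which excludes that d is symmetric as
    well. *)

Lemma oppr_side (x : int) : x != 0 -> (0 < x) != (0 < - x).
Proof. lia. Qed.

Section Coord.
Variable N : nat.
Implicit Types (w u : affperm (2 * N)) (i j l q : 'I_(2 * N)).

(* w sends a vector x to the vector with entries x (src w i) + tr w i. *)
Definition tr w i : int := transl w 0 i.
Definition src w i : 'I_(2 * N) := (linpart w)^-1%g i.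

(* The point base / (4 N) lies in the base alcove, and pt w / (4 N) is its image
   under w; the factor 4 N keeps everything in the integers. The sign of
   sd w i j d tells on which side of {x_i - x_j = d} the alcove of w lies. *)
Definition base i : int := (2 * i)%N%:Z - (2 * N)%N%:Z + 1.
Definition pt w i : int := (4 * N)%N%:Z * tr w i + base (src w i).
Definition sd w i j (d : int) : int := pt w i - pt w j - (4 * N)%N%:Z * d.

Lemma affperm_eqP w u : tr w =1 tr u -> src w =1 src u -> w = u.
Proof.
case: w u => [a s] [b t] /= Ha Hs; congr AffPerm.
  by apply/rowP => i; exact: Ha.
apply: invg_inj; apply/permP => i; exact: Hs.
Qed.

Lemma trM w u i : tr (w * u)%g i = tr w i + tr u (src w i).
Proof. by rewrite /tr /src !mxE. Qed.

Lemma srcM w u i : src (w * u)%g i = src u (src w i).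
Proof. by rewrite /src /= invMg permM. Qed.

Lemma tr1 i : tr 1%g i = 0.
Proof. by rewrite /tr mxE. Qed.

Lemma src1 i : src 1%g i = i.
Proof. by rewrite /src /= invg1 perm1. Qed.

Lemma srcK w : cancel (src w) (linpart w).
Proof. by move=> i; rewrite /src permKV. Qed.
Lemma linpartK w : cancel (linpart w) (src w).
Proof. by move=> i; rewrite /src permK. Qed.
Lemma src_inj w : injective (src w).
Proof. exact: can_inj (srcK w). Qed.

Lemma pt1 i : pt 1%g i = base i.
Proof. by rewrite /pt tr1 src1 mulr0 add0r. Qed.

Lemma ptM w u i : pt (w * u)%g i = (4 * N)%N%:Z * tr w i + pt u (src w i).
Proof. by rewrite /pt trM srcM mulrDr -addrA. Qed.

Lemma rev_ord_neq i : rev_ord i != i.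
Proof. by rewrite -val_eqE /=; have := ltn_ord i; lia. Qed.

Lemma base_rev i : base (rev_ord i) = - base i.
Proof. by rewrite /base /=; have := ltn_ord i; lia. Qed.

Lemma base_lt i j : (base i < base j) = (i < j)%N.
Proof. rewrite /base; lia. Qed.

Lemma base_diff i j : base i - base j = 2 * (i%:Z - j%:Z).
Proof. rewrite /base; lia. Qed.

Definition dualsum w (c : int) := forall i, tr w i + tr w (rev_ord i) = c.

Definition Wext w := [/\ exists c, dualsum w c, ~~ odd_perm (linpart w)
  & forall i, linpart w (rev_ord i) = rev_ord (linpart w i)].

Lemma src_rev w : Wext w -> forall i, src w (rev_ord i) = rev_ord (src w i).
Proof.
by case=> _ _ H i; apply: (can_inj (linpartK w)); rewrite srcK H srcK.
Qed.

Lemma in_WextP w : reflect (Wext w) (in_Wext w).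
Proof.
apply: (iffP andP) => [[/forallP H1 /andP[H2 /forallP H3]]|[[c H1] H2 H3]].
  split=> //; last by move=> i; apply/eqP.
  case: (posnP (2 * N)%N) => [n0|n0].
    exists 0 => i; exfalso; have := ltn_ord i; lia.
  exists (tr w (Ordinal n0) + tr w (rev_ord (Ordinal n0))) => i.
  by apply/eqP; move: (H1 i) => /forallP; apply.
split; first by apply/forallP => i; apply/forallP => j; rewrite !H1.
by rewrite /in_W0 H2; apply/forallP => i; rewrite H3.
Qed.

Lemma Wext1 : Wext 1%g.
Proof.
split=> [|| i]; first by exists 0 => i; rewrite !tr1.
  by rewrite odd_perm1.
by rewrite !perm1.
Qed.

Lemma dualsumM w u c c' : Wext w -> dualsum w c -> dualsum u c' ->
  dualsum (w * u)%g (c + c').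
Proof. by move=> Hw H1 H2 i; rewrite !trM (src_rev Hw) -(H1 i) -(H2 (src w i)); ring. Qed.

Lemma WextM w u : Wext w -> Wext u -> Wext (w * u)%g.
Proof.
move=> Hw Hu; have [[c H1] H2 H3] := Hw; have [[c' H4] H5 H6] := Hu.
split; first by exists (c + c'); apply: dualsumM.
  by rewrite /= odd_permM (negbTE H2) (negbTE H5).
by move=> i; rewrite /= !permM H6 H3.
Qed.

Lemma trV w i : tr w^-1%g i = - tr w (linpart w i).
Proof. by rewrite /tr /= !mxE invgK. Qed.

Lemma srcV w i : src w^-1%g i = linpart w i.
Proof. by rewrite /src /= invgK. Qed.

Lemma linpartV w i : linpart w^-1%g i = src w i.
Proof. by []. Qed.

Lemma WextV w : Wext w -> Wext w^-1%g.
Proof.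
move=> Hw; have [[c H1] H2 H3] := Hw; split=> [||i].
- by exists (- c) => i; rewrite !trV H3 -(H1 (linpart w i)); ring.
- by rewrite /= odd_permV.
by rewrite !linpartV src_rev.
Qed.

Lemma in_WaffP w : reflect
  [/\ Wext w, dualsum w 0 & (2 %| \sum_(i < 2 * N | (i < N)%N) tr w i)%Z] (in_Waff w).
Proof.
apply: (iffP idP).
  case/andP=> /and3P[H1 /forallP H2 H3] H4; split=> //; last by move=> i; apply/eqP/H2.
  by apply/in_WextP; rewrite /in_Wext H1.
case=> /in_WextP/andP[H1 H2] H3 H4; rewrite /in_Waff H2 andbT /in_coroot H1 H4 andbT /=.
by apply/forallP=> i; apply/eqP; apply: H3.
Qed.

(** * Affine reflections in coordinates *)

Section Reflection.
Variables (i j : 'I_(2 * N)) (d : int).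
Hypothesis Hr : is_root i j.

Definition root_eqF : ((i == j = false) * (j == i = false) *
  (i == rev_ord i = false) * (rev_ord i == i = false) *
  (i == rev_ord j = false) * (rev_ord j == i = false) *
  (j == rev_ord i = false) * (rev_ord i == j = false) *
  (j == rev_ord j = false) * (rev_ord j == j = false) *
  (rev_ord i == rev_ord j = false) * (rev_ord j == rev_ord i = false))%type.
Proof.
have [n1 n2] := andP Hr.
have n3 : rev_ord j != i by rewrite -(inj_eq rev_ord_inj) rev_ordK.
have n4 : rev_ord j != rev_ord i by rewrite (inj_eq rev_ord_inj).
do !split; apply/negbTE; rewrite ?rev_ord_neq // eq_sym ?rev_ord_neq //.
Qed.

Lemma src_refl l : src (root_reflection i j d) l =
  if l == i then j else if l == j then i else
  if l == rev_ord i then rev_ord j else if l == rev_ord j then rev_ord i else l.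
Proof.
have E := root_eqF.
rewrite /src /= invMg !tpermV permM.
case: (tpermP (rev_ord i) (rev_ord j) l) => [->|->|/eqP l1 /eqP l2].
- by rewrite tpermD ?E ?eqxx.
- by rewrite tpermD ?E ?eqxx.
rewrite (negbTE l1) (negbTE l2).
by case: tpermP => [->|->|/eqP l3 /eqP l4]; rewrite ?E ?eqxx ?(negbTE l3) ?(negbTE l4).
Qed.

Lemma tr_refl l : tr (root_reflection i j d) l =
  if l == i then d else if l == j then - d else
  if l == rev_ord i then - d else if l == rev_ord j then d else 0.
Proof.
have E := root_eqF.
rewrite /tr /= !mxE eqxx /=.
case: (l =P i) => [->|_]; first by rewrite !E /=; ring.
case: (l =P j) => [->|_]; first by rewrite !E /=; ring.
case: (l =P rev_ord i) => [->|_]; first by rewrite !E /=; ring.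
case: (l =P _) => _ /=; ring.
Qed.

Lemma linpart_refl : linpart (root_reflection i j d) =1 src (root_reflection i j d).
Proof.
have E := root_eqF.
move=> l; apply: (@src_inj (root_reflection i j d)).
rewrite linpartK 2!src_refl.
case: (l =P i) => [->|/eqP l1]; first by rewrite !E ?eqxx.
case: (l =P j) => [->|/eqP l2]; first by rewrite ?E ?eqxx.
case: (l =P rev_ord i) => [->|/eqP l3]; first by rewrite ?E ?eqxx.
case: (l =P rev_ord j) => [->|/eqP l4]; first by rewrite ?E ?eqxx.
by rewrite (negbTE l1) (negbTE l2) (negbTE l3) (negbTE l4).
Qed.

Lemma src_refl_rev l : src (root_reflection i j d) (rev_ord l) =
  rev_ord (src (root_reflection i j d) l).
Proof.
have E := root_eqF.
rewrite !src_refl.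
case: (l =P i) => [->|/eqP l1]; first by rewrite ?E ?eqxx.
case: (l =P j) => [->|/eqP l2]; first by rewrite ?E ?eqxx.
case: (l =P rev_ord i) => [->|/eqP l3]; first by rewrite ?rev_ordK ?E ?eqxx.
case: (l =P rev_ord j) => [->|/eqP l4]; first by rewrite ?rev_ordK ?E ?eqxx.
by rewrite -!(can_eq rev_ordK (rev_ord l)) ?rev_ordK (negbTE l1) (negbTE l2) (negbTE l3) (negbTE l4).
Qed.

Lemma dualsum_refl : dualsum (root_reflection i j d) 0.
Proof.
have E := root_eqF.
move=> l; rewrite !tr_refl.
case: (l =P i) => [->|/eqP l1]; first by rewrite ?E ?eqxx subrr.
case: (l =P j) => [->|/eqP l2]; first by rewrite ?E ?eqxx addNr.
case: (l =P rev_ord i) => [->|/eqP l3]; first by rewrite ?rev_ordK ?E ?eqxx addNr.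
case: (l =P rev_ord j) => [->|/eqP l4]; first by rewrite ?rev_ordK ?E ?eqxx subrr.
by rewrite -!(can_eq rev_ordK (rev_ord l)) ?rev_ordK (negbTE l1) (negbTE l2) (negbTE l3) (negbTE l4).
Qed.

Lemma WextR : Wext (root_reflection i j d).
Proof.
split; first by exists 0; exact: dualsum_refl.
  by rewrite /= odd_permM !odd_tperm (inj_eq rev_ord_inj); case: (i == j).
by move=> l; rewrite !linpart_refl src_refl_rev.
Qed.

Lemma WaffR : in_Waff (root_reflection i j d).
Proof.
have E := root_eqF.
apply/in_WaffP; split; [exact: WextR|exact: dualsum_refl|].
have S k : \sum_(l < 2 * N | (l < N)%N) ((l == k)%:R : int) = ((k < N)%N)%:R.
  case: (ltnP k N) => Hk.
    by rewrite (bigD1 k) //= eqxx big1 ?addr0 // => l /andP[_ /negbTE ->].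
  by rewrite big1 // => l Hl; case: eqP => // H; move: Hk; rewrite -H leqNgt Hl.
rewrite (eq_bigr (fun l : 'I_(2 * N) => d * ((l == i)%:R - (l == j)%:R
   - (l == rev_ord i)%:R + (l == rev_ord j)%:R))); last first.
  by move=> l _; rewrite /tr /= !mxE eqxx.
rewrite -big_distrr big_split !sumrB !S.
have R (k : 'I_(2 * N)) : ((rev_ord k < N)%N%:R : int) = 1 - (k < N)%N%:R.
  by have := ltn_ord k; rewrite !natz /=; lia.
apply/dvdzP; exists (d * ((i < N)%N%:R - (j < N)%N%:R)).
by rewrite /= -[(2 * N - i.+1)%N]/(nat_of_ord (rev_ord i)) -[(2 * N - j.+1)%N]/(nat_of_ord (rev_ord j)) !R; ring.
Qed.

Lemma reflK : (root_reflection i j d * root_reflection i j d = 1)%g.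
Proof.
have E := root_eqF.
apply: affperm_eqP => l; last first.
  by rewrite srcM src1 -[src _ (src _ l)]linpart_refl srcK.
rewrite trM tr1 [tr _ l]tr_refl src_refl.
case: (l =P i) => [_|/eqP l1]; first by rewrite tr_refl ?E ?eqxx subrr.
case: (l =P j) => [_|/eqP l2]; first by rewrite tr_refl ?E ?eqxx addNr.
case: (l =P rev_ord i) => [_|/eqP l3]; first by rewrite tr_refl ?E ?eqxx addNr.
case: (l =P rev_ord j) => [_|/eqP l4]; first by rewrite tr_refl ?E ?eqxx subrr.
by rewrite tr_refl (negbTE l1) (negbTE l2) (negbTE l3) (negbTE l4).
Qed.

Lemma reflV : (root_reflection i j d)^-1%g = root_reflection i j d.
Proof. by apply: (mulIg (root_reflection i j d)); rewrite mulVg reflK. Qed.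

End Reflection.

Lemma pt_refl w i j d l : is_root i j ->
  pt (root_reflection i j d * w)%g l =
  if l == i then pt w j + (4 * N)%N%:Z * d
  else if l == j then pt w i - (4 * N)%N%:Z * d
  else if l == rev_ord i then pt w (rev_ord j) - (4 * N)%N%:Z * d
  else if l == rev_ord j then pt w (rev_ord i) + (4 * N)%N%:Z * d else pt w l.
Proof.
move=> Hr; rewrite ptM tr_refl // src_refl //.
by do ![case: (_ =P _) => _]; ring.
Qed.

Lemma refl_conj w i j d : Wext w -> is_root i j ->
  (w * root_reflection i j d * w^-1)%g =
  root_reflection (linpart w i) (linpart w j)
    (d + tr w (linpart w i) - tr w (linpart w j)).
Proof.
move=> Hw Hr; have [[c Hc] _ Hl] := Hw.
have Hr' : is_root (linpart w i) (linpart w j).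
  by rewrite /is_root -Hl !(inj_eq perm_inj).
have E := root_eqF Hr.
have T (l : 'I_(2 * N)) : (l == linpart w i = (src w l == i)) *
   (l == linpart w j = (src w l == j)) * (l == linpart w (rev_ord i) = (src w l == rev_ord i))
   * (l == linpart w (rev_ord j) = (src w l == rev_ord j)).
  by rewrite -!(can2_eq (srcK w) (linpartK w)).
have D k : tr w (linpart w (rev_ord k)) = c - tr w (linpart w k).
  by rewrite -(Hc (linpart w k)) Hl; ring.
apply: affperm_eqP => l.
  rewrite !trM trV srcM !tr_refl // src_refl // -!Hl !T.
  case: (src w l =P i) => [H|_]; first by rewrite -H srcK; ring.
  case: (src w l =P j) => [H|_]; first by rewrite -H srcK; ring.
  case: (src w l =P rev_ord i) => [H|_].
    by rewrite D -{1}[l](srcK w) H D; ring.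
  case: (src w l =P rev_ord j) => [H|_].
    by rewrite D -{1}[l](srcK w) H D; ring.
  by rewrite srcK; ring.
rewrite !srcM srcV !src_refl // -!Hl !T.
by do ![case: (_ =P _) => _ //]; rewrite srcK.
Qed.

Lemma sdM w v i j d :
  sd (w * v)%g i j d = sd v (src w i) (src w j) (d - tr w i + tr w j).
Proof. by rewrite /sd !ptM; ring. Qed.

Lemma sd_refl w i j d : is_root i j ->
  sd (root_reflection i j d * w)%g i j d = - sd w i j d.
Proof.
move=> Hr; rewrite /sd !pt_refl // !eqxx (root_eqF Hr); ring.
Qed.

Lemma modM_gt0 (k r : int) : `|r| < (4 * N)%N%:Z -> 0 < (4 * N)%N%:Z * k + r ->
  0 <= k /\ (k = 0 -> 0 < r).
Proof.
move=> Hr H; split=> [|k0]; last by move: H; rewrite k0 mulr0 add0r.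
rewrite leNgt; apply/negP => k0; suff : (4 * N)%N%:Z * k <= - (4 * N)%N%:Z by lia.
nia.
Qed.

Lemma modM_lt0 (k r : int) : `|r| < (4 * N)%N%:Z -> (4 * N)%N%:Z * k + r < 0 ->
  k <= 0 /\ (k = 0 -> r < 0).
Proof.
move=> Hr H; split=> [|k0]; last by move: H; rewrite k0 mulr0 add0r.
rewrite leNgt; apply/negP => k0; suff : (4 * N)%N%:Z * k >= (4 * N)%N%:Z by lia.
nia.
Qed.

Lemma sdE w i j d : sd w i j d = (4 * N)%N%:Z * (tr w i - tr w j - d)
  + (base (src w i) - base (src w j)).
Proof. rewrite /sd /pt; ring. Qed.

Lemma base_diff_lt i j : `|base i - base j| < (4 * N)%N%:Z.
Proof. by rewrite /base; have := ltn_ord i; have := ltn_ord j; lia. Qed.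

Lemma sd_neq0 w i j d : i != j -> sd w i j d != 0.
Proof.
move=> Hij; apply/eqP; rewrite sdE => H.
have Hs : src w i != src w j by rewrite (inj_eq (@src_inj w)).
have := base_diff_lt (src w i) (src w j); move: H Hs.
rewrite -(inj_eq val_inj) /= base_diff.
move: (tr w i - tr w j - d) (src w i) (src w j) => k p q H Hpq Hb.
have [k0|[k0|k0]] : k = 0 \/ (k <= -1 \/ 1 <= k) by lia.
- by move: H; rewrite k0; lia.
- suff : (4 * N)%N%:Z * k <= - (4 * N)%N%:Z by lia.
  nia.
- suff : (4 * N)%N%:Z * k >= (4 * N)%N%:Z by lia.
  nia.
Qed.

Definition dist w : int := \sum_l (pt w l - base l) ^+ 2.

Lemma dist_ge0 w : 0 <= dist w.
Proof. by apply: sumr_ge0 => l _; exact: sqr_ge0. Qed.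

Lemma sum_update4 (F G : 'I_(2 * N) -> int) i j : is_root i j ->
  (forall l, l != i -> l != j -> l != rev_ord i -> l != rev_ord j -> F l = G l) ->
  \sum_l F l = \sum_l G l + (F i - G i) + (F j - G j)
     + (F (rev_ord i) - G (rev_ord i)) + (F (rev_ord j) - G (rev_ord j)).
Proof.
move=> Hr H; have E := root_eqF Hr.
have S (K : 'I_(2 * N) -> int) : \sum_l K l = K i + K j + K (rev_ord i) + K (rev_ord j) +
   \sum_(l | [&& l != i, l != j, l != rev_ord i & l != rev_ord j]) K l.
  rewrite (bigD1 i) //= (bigD1 j) /= ?E // (bigD1 (rev_ord i)) /= ?E //.
  rewrite (bigD1 (rev_ord j)) /= ?E // !addrA; congr (_ + _).
  by apply: eq_bigl => l; rewrite -!andbA.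
rewrite (S F) (S G) (eq_bigr G) => [|l /and4P[*]]; last exact: H.
by ring.
Qed.

(** The sign of the product decides: the distance grows under the reflection exactly when the
    alcoves of 1 and w are on the same side. This drives both the descent to the base alcove and the
    termination of the climb. *)
Lemma dist_refl w i j d c : dualsum w c -> (forall l, src w (rev_ord l) = rev_ord (src w l)) -> is_root i j ->
  dist (root_reflection i j d * w)%g = dist w + 4 * (sd w i j d * sd 1%g i j d).
Proof.
move=> Hc Hs Hr; have E := root_eqF Hr.
rewrite /dist (sum_update4 (G := fun l => (pt w l - base l) ^+ 2) Hr); last first.
  by move=> l l1 l2 l3 l4; rewrite pt_refl // (negbTE l1) (negbTE l2) (negbTE l3) (negbTE l4).
rewrite !pt_refl // ?eqxx ?E.
have D l : pt w (rev_ord l) = (4 * N)%N%:Z * c - pt w l.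
  by rewrite /pt Hs base_rev -(Hc l); ring.
rewrite !D !base_rev /sd !pt1; ring.
Qed.

Lemma sum_half (f : 'I_(2 * N) -> int) : (forall l, f (rev_ord l) = f l) ->
  \sum_l f l = 2 * \sum_(l < 2 * N | (l < N)%N) f l.
Proof.
move=> Hf; rewrite (bigID (fun l : 'I_(2 * N) => (l < N)%N)) /=.
rewrite [X in _ + X](reindex_inj rev_ord_inj) /=.
have Hp (l : 'I_(2 * N)) : ~~ (rev_ord l < N)%N = (l < N)%N.
  by rewrite /=; have := ltn_ord l; lia.
rewrite [X in _ + X](eq_bigl (fun l : 'I_(2 * N) => (l < N)%N)) => [|l]; last exact: Hp.
by rewrite [X in _ + X](eq_bigr f) => [|l _]; [ring|rewrite Hf].
Qed.

(** Absolute values make the coroot parity insensitive to replacing an entry by its dual, which has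
    the opposite sign. *)
Lemma modZ2_abs (I : finType) (P : pred I) (f : I -> int) :
  (2 %| \sum_(l | P l) f l)%Z = (2 %| \sum_(l | P l) `|f l|)%Z.
Proof.
have : (2 %| \sum_(l | P l) (f l - `|f l|))%Z.
  apply: (big_ind (fun x : int => (2 %| x)%Z)) => [|x y Hx Hy|l _]; first exact: dvdz0.
    exact: rpredD.
  have [H|H] : f l - `|f l| = 0 \/ f l - `|f l| = f l * 2 by lia.
    by rewrite H dvdz0.
  by rewrite H; apply/dvdzP; exists (f l).
rewrite sumrB => H.
by rewrite -[in LHS](subrK (\sum_(l | P l) `|f l|) (\sum_(l | P l) f l)) rpredDl.
Qed.

(** The delicate point is parity, since [src w] may exchange an index below N with one above. The
    half-sum of the absolute values is half of the full sum, which every permutation preserves. *)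
Lemma WaffM w u : in_Waff w -> in_Waff u -> in_Waff (w * u)%g.
Proof.
move=> /in_WaffP[Hw Hw0 Hw2] /in_WaffP[Hu Hu0 Hu2]; apply/in_WaffP; split.
- exact: WextM.
- by have := dualsumM Hw Hw0 Hu0; rewrite addr0.
rewrite (eq_bigr (fun l => tr w l + tr u (src w l))) => [|l _]; last exact: trM.
rewrite big_split /= rpredDl // modZ2_abs.
have Hr l : `|tr u (rev_ord l)| = `|tr u l| by have := Hu0 l; lia.
suff -> : \sum_(l < 2 * N | (l < N)%N) `|tr u (src w l)| =
  \sum_(l < 2 * N | (l < N)%N) `|tr u l| by rewrite -modZ2_abs.
have E1 := sum_half Hr.
have E2 : \sum_l `|tr u (src w l)| = 2 * \sum_(l < 2 * N | (l < N)%N) `|tr u (src w l)|.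
  by apply: sum_half => l; rewrite src_rev // Hr.
have E3 : \sum_l `|tr u (src w l)| = \sum_l `|tr u l|.
  by rewrite [RHS](reindex_inj (@src_inj w)).
have n2 : (2 : int) != 0 by [].
by apply/esym/(mulfI n2); rewrite -E1 -E2.
Qed.

Lemma Waff_Wext w : in_Waff w -> Wext w.
Proof. by case/in_WaffP. Qed.

(* pt w / (4 N) lies in the base alcove. *)
Definition in_alc w := forall i j, (i < j)%N -> j != rev_ord i ->
  0 < pt w j - pt w i < (4 * N)%N%:Z.

Lemma incr_ord_id (n : nat) (s : 'S_n) :
  (forall i j : 'I_n, (i < j)%N -> (s i < s j)%N) -> s = 1%g.
Proof.
move=> Hs.
have L (t : 'S_n) : (forall i j : 'I_n, (i < j)%N -> (t i < t j)%N) ->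
   forall i : 'I_n, (i <= t i)%N.
  move=> Ht [i Hi] /=; elim: i Hi => [//|i IH] Hi.
  by apply: leq_ltn_trans (IH (ltnW Hi)) _; apply: Ht => /=.
have Hs' (i j : 'I_n) : (i < j)%N -> (s^-1%g i < s^-1%g j)%N.
  move=> Hij; rewrite ltnNge leq_eqVlt; apply/negP => /orP[/eqP/val_inj/perm_inj H|/Hs].
    by move: Hij; rewrite H ltnn.
  by rewrite !permKV ltnNge ltnW.
apply/permP => i; rewrite perm1; apply/val_inj/eqP; rewrite eqn_leq L // andbT.
by have := L _ Hs' (s i); rewrite permK.
Qed.

(** The inequalities kill all translation entries except possibly the first, coroot parity kills
    that one, and evenness of the permutation excludes an exchange of the two middle indices, which
    form a dual pair and hence no root. *)
Lemma Waff_alc1 w : (1 < N)%N -> in_Waff w -> in_alc w -> w = 1%g.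
Proof.
move=> N1 /in_WaffP[Hw Hw0 Hw2] Ha.
have D i : pt w (rev_ord i) = - pt w i.
  rewrite /pt src_rev // base_rev -[tr w (rev_ord i)](addKr (tr w i)) Hw0; ring.
have n0 : (0 < 2 * N)%N by lia.
pose o0 := Ordinal n0.
have A1 (l : 'I_(2 * N)) : (0 < l)%N -> (l < N)%N -> [/\ pt w o0 < pt w l,
   pt w o0 < - pt w l, pt w o0 + pt w l > - (4 * N)%N%:Z &
   pt w o0 - pt w l > - (4 * N)%N%:Z].
  move=> l0 lN.
  have [||] := andP (Ha o0 l _ _); rewrite -?val_eqE /=; try lia.
  have [||] := andP (Ha o0 (rev_ord l) _ _); rewrite -?val_eqE /=; try lia.
  have [||] := andP (Ha l (rev_ord o0) _ _); rewrite -?val_eqE /=; try lia.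
  by rewrite !D => *; split; lia.
have T1 (l : 'I_(2 * N)) : (0 < l)%N -> (l < N)%N -> tr w l = 0.
  move=> l0 lN; have [H1 H2 H3 H4] := A1 l l0 lN.
  move: (ltn_ord (src w l)) H1 H2 H3 H4; rewrite /pt /base => Hs H1 H2 H3 H4.
  have [//|[k0|k0]] : tr w l = 0 \/ (tr w l <= -1 \/ 1 <= tr w l) by lia.
  - suff : (4 * N)%N%:Z * tr w l <= - (4 * N)%N%:Z by lia.
    by nia.
  - suff : (4 * N)%N%:Z * tr w l >= (4 * N)%N%:Z by lia.
    by nia.
(* Here the bound on [pt] only leaves -1, 0 and 1; parity decides. *)
have T0 : tr w o0 = 0.
  have : (2 %| tr w o0)%Z.
    move: Hw2; rewrite (bigD1 o0) /=; last by lia.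
    rewrite big1 ?addr0 // => l /andP[H1]; rewrite -val_eqE /= => H2; apply: T1 => //.
    by rewrite lt0n.
  case/dvdzP => k Hk.
  have o1 : (1 < 2 * N)%N by lia.
  have [H1 H2 H3 H4] := A1 (Ordinal o1) isT N1.
  have : `|pt w o0| < (4 * N)%N%:Z by lia.
  move: (ltn_ord (src w o0)); rewrite /pt Hk /base => Hs {H1 H2 H3 H4} H1.
  have [->//|[k0|k0]] : k = 0 \/ (k <= -1 \/ 1 <= k) by lia.
  - suff : (4 * N)%N%:Z * (k * 2) <= - 2 * (4 * N)%N%:Z by lia.
    by nia.
  - suff : (4 * N)%N%:Z * (k * 2) >= 2 * (4 * N)%N%:Z by lia.
    by nia.
have T l : tr w l = 0.
  have T' (k : 'I_(2 * N)) : (k < N)%N -> tr w k = 0.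
    move=> kN; have [k0|k0] := posnP k; last exact: T1.
    by rewrite -T0; congr tr; apply: val_inj.
  case: (ltnP l N) => [|lN]; first exact: T'.
  have := Hw0 l; rewrite (T' (rev_ord l)) ?addr0 //=.
  by have := ltn_ord l; lia.
have M (i j : 'I_(2 * N)) : (i < j)%N -> j != rev_ord i -> (src w i < src w j)%N.
  by move=> Hij Hr; have := Ha i j Hij Hr; rewrite /pt !T !mulr0 !add0r -base_lt => /andP[]; lia.
have nN1 : (N.-1 < 2 * N)%N by lia.
have nN : (N < 2 * N)%N by lia.
pose p := Ordinal nN1; pose q := Ordinal nN.
(* A dual pair other than (p, q) is compared by passing through p. *)
have M' (i j : 'I_(2 * N)) : (i < j)%N -> ((i : nat) != p) || ((j : nat) != q) -> (src w i < src w j)%N.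
  move=> Hij Hn; case: (boolP (j == rev_ord i)) => [/eqP Hj|Hj]; last exact: M.
  have iN : (i < p)%N by move: Hij Hn (ltn_ord i) (congr1 val Hj) => /=; lia.
  have jN : (q < j)%N by move: Hij Hn (ltn_ord i) iN (congr1 val Hj) => /=; lia.
  have i1 : (src w i < src w p)%N by apply: M => //; rewrite -val_eqE /=; move: iN => /=; lia.
  apply: ltn_trans i1 _; apply: M; first by apply: ltn_trans jN => /=; lia.
  by rewrite -val_eqE /=; move: jN => /=; lia.
case: (ltnP (src w p) (src w q)) => Hpq.
  suff S1 : (linpart w)^-1%g = 1%g.
    by apply: affperm_eqP => l; rewrite ?T ?tr1 // src1 /src S1 perm1.
  apply: incr_ord_id => i j Hij.
  case: (boolP (((i : nat) != p) || ((j : nat) != q))) => H; first exact: M'.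
  move: H; rewrite negb_or !negbK => /andP[/eqP/val_inj -> /eqP/val_inj ->]; exact: Hpq.
exfalso; have [_ Hodd _] := Hw.
have pq : p != q by rewrite -val_eqE /=; lia.
suff S1 : (tperm p q * (linpart w)^-1)%g = 1%g.
  by move: Hodd; rewrite -odd_permV -[X in odd_perm X](mulKg (tperm p q)) S1 mulg1 odd_permV odd_tperm pq.
apply: incr_ord_id => i j Hij; rewrite !permM -!/(src w _).
have Hpq' : (src w q < src w p)%N.
  by rewrite ltn_neqAle Hpq andbT (inj_eq (@ord_inj _)) (inj_eq (@src_inj w)) eq_sym.
case: tpermP => [ip|iq|/eqP ip /eqP iq]; case: tpermP => [jp|jq|/eqP jp /eqP jq].
- by move: Hij; rewrite ip jp ltnn.
- exact: Hpq'.
- by apply: M'; [move: Hij jq; rewrite ip -val_eqE /=; lia|rewrite /=; apply/orP; left; lia].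
- by move: Hij; rewrite iq jp /=; lia.
- by move: Hij; rewrite iq jq /=; lia.
- by apply: M'; [move: Hij; rewrite iq /=; lia|rewrite -val_eqE in jq; rewrite jq orbT].
- by apply: M'; [move: Hij; rewrite jp /=; lia|rewrite -val_eqE in ip; rewrite ip].
- apply: M'; [move: Hij ip; rewrite jq -val_eqE /=; lia|rewrite /=; apply/orP; right; lia].
by apply: M' => //; rewrite -val_eqE in ip; rewrite ip.
Qed.

End Coord.

(** * Spin-permissibility in coordinates *)

Section Spin.
Variable N : nat.
Implicit Types (w u : affperm (2 * N)) (i j l q : 'I_(2 * N)) (k : nat).

(* The l-th entry of mu_k^w - 1, for 0 <= k <= 2N; as mu_k^w is 2N-periodic in k,
   that of mu_{-k}^w - 1 is X w (2N - k) l. *)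
Definition X w k l : int := tr w l - 1 + (l < k)%N%:Z - (src w l < k)%N%:Z.
Definition nn w k : int := \sum_l (X w k l == 1)%N%:Z.
(* For k <= N this says that l is in B_k, and otherwise l is in A_k. *)
Definition sideB k l : bool := (l < k)%N != (l < 2 * N - k)%N.

(** The conditions are imposed for all k up to 2N so that k and 2N - k can be interchanged.
    Membership in the coroot lattice becomes a parity, and [b] runs over the two sides A_k and
    B_k. *)
Definition spinX (s : nat) w : Prop :=
  [/\ Wext w, dualsum w 2, forall k l, (k <= 2 * N)%N -> -1 <= X w k l <= 1,
    forall k, (k <= 2 * N)%N -> nn w k <= s%:Z &
    forall k, (k <= 2 * N)%N -> X w k =1 X w (2 * N - k) -> ~~ (2 %| nn w k - s%:Z)%Z ->
      forall b, exists2 l, sideB k l = b & X w k l = 0].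

Lemma X_dual w k l : Wext w -> dualsum w 2 -> (k <= 2 * N)%N ->
  X w (2 * N - k) (rev_ord l) = - X w k l.
Proof.
move=> Hw Hd Hk; rewrite /X src_rev //=; have := Hd l.
have := ltn_ord l; have := ltn_ord (src w l); lia.
Qed.

Lemma X_dual' w k l : Wext w -> dualsum w 2 -> (k <= 2 * N)%N ->
  X w k (rev_ord l) = - X w (2 * N - k) l.
Proof.
by move=> Hw Hd Hk; rewrite -X_dual ?leq_subr // subKn.
Qed.

Lemma sideB_rev k l : (k <= 2 * N)%N -> sideB k (rev_ord l) = sideB k l.
Proof. rewrite /sideB /=; have := ltn_ord l; lia. Qed.

Lemma sideB_sym k l : (k <= 2 * N)%N -> sideB (2 * N - k) l = sideB k l.
Proof. by move=> Hk; rewrite /sideB subKn // eq_sym. Qed.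

Lemma sumX w k : Wext w -> dualsum w 2 -> \sum_l X w k l = 0.
Proof.
move=> Hw Hd; rewrite sumrB big_split /=.
rewrite [X in _ - X](_ : _ = \sum_(l < 2 * N) (l < k)%N%:Z); last first.
  by rewrite [RHS](reindex_inj (@src_inj _ w)).
rewrite addrK; set S := \sum_l _.
have : S = - S.
  rewrite {1}/S (reindex_inj rev_ord_inj) /= -sumrN; apply: eq_bigr => l _.
  by have := Hd l; lia.
by lia.
Qed.

(** The entries of X sum to 0, so 1 and -1 occur equally often, and duality exchanges them while
    passing to 2N - k. *)
Lemma nn_sym w k : Wext w -> dualsum w 2 -> (k <= 2 * N)%N ->
  (forall l, -1 <= X w k l <= 1) -> nn w (2 * N - k) = nn w k.
Proof.
move=> Hw Hd Hk Hb; apply/eqP; rewrite -subr_eq0.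
rewrite /nn (reindex_inj rev_ord_inj) /= -sumrB -oppr_eq0 -sumrN -[X in _ == X](sumX k Hw Hd).
by apply/eqP/eq_bigr => l _; rewrite X_dual //; have := Hb l; lia.
Qed.

(** At a self-dual vertex dual entries are opposite, so each dual pair of nonzero entries contains
    exactly one 1. *)
Lemma nn_half w k : Wext w -> dualsum w 2 -> (k <= 2 * N)%N ->
  (forall l, -1 <= X w k l <= 1) -> X w k =1 X w (2 * N - k) ->
  nn w k = \sum_(l < 2 * N | (l < N)%N) `|X w k l|.
Proof.
move=> Hw Hd Hk Hb Hs.
have E : \sum_l `|X w k l| = 2 * \sum_(l < 2 * N | (l < N)%N) `|X w k l|.
  by apply: sum_half => l; rewrite X_dual' // normrN -Hs.
have : \sum_l `|X w k l| = 2 * nn w k.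
  transitivity (2 * nn w k - \sum_l X w k l); last by rewrite sumX // subr0.
  rewrite /nn mulr_sumr -sumrB; apply: eq_bigr => l _.
  by have := Hb l; lia.
by rewrite E => /mulfI ->.
Qed.

Lemma omegaE (q : int) (c : nat) l : (c < 2 * N)%N ->
  omega N (q * (2 * N)%N%:Z + c%:Z) 0 l = - (l < c)%N%:Z - q.
Proof.
move=> Hc; rewrite mxE.
have -> : ((q * (2 * N)%N%:Z + c%:Z) %% (2 * N)%N)%Z = c%:Z.
  by rewrite modzMDl modz_small //; lia.
have -> : ((q * (2 * N)%N%:Z + c%:Z) %/ (2 * N)%N)%Z = q.
  by rewrite divzMDl ?divz_small ?addr0 //; lia.
by rewrite ltz_nat; case: (l < c)%N; lia.
Qed.

Lemma mu_kE w k l : (k <= N)%N -> mu_k w k%:Z 0 l = X w k l + 1.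
Proof.
move=> Hk; have Hk2 : (k < 2 * N)%N by have := ltn_ord l; lia.
have O q : omega N k%:Z 0 q = - (q < k)%N%:Z.
  by have := omegaE 0 q Hk2; rewrite mul0r add0r subr0.
have -> : mu_k w k%:Z 0 l = tr w l + omega N k%:Z 0 (src w l) - omega N k%:Z 0 l.
  by rewrite /mu_k !mxE intz.
by rewrite !O /X; lia.
Qed.

Lemma mu_kNE w k l : (k <= N)%N -> mu_k w (- k%:Z) 0 l = X w (2 * N - k) l + 1.
Proof.
(* The division -k = (-1) * 2N + (2N - k) has an admissible remainder only for k > 0. *)
move=> Hk; have [k0|k0] := posnP k.
  have -> : - k%:Z = 0%N%:Z by rewrite k0.
  rewrite mu_kE // /X k0; have := ltn_ord l; have := ltn_ord (src w l); lia.
have Hk2 : (2 * N - k < 2 * N)%N by lia.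
have O q : omega N (- k%:Z) 0 q = - (q < 2 * N - k)%N%:Z + 1.
  have := omegaE (-1) q Hk2; rewrite opprK => <-; congr (omega _ _ _ _).
  by rewrite mulN1r; lia.
have -> : mu_k w (- k%:Z) 0 l = tr w l + omega N (- k%:Z) 0 (src w l) - omega N (- k%:Z) 0 l.
  by rewrite /mu_k !mxE intz.
by rewrite !O /X; lia.
Qed.

Lemma sum_lt_ord (n a : nat) : \sum_(l < n) (l < a)%N%:Z = (minn n a)%:Z.
Proof.
elim: n => [|n IH]; first by rewrite big_ord0 min0n.
by rewrite big_ord_recr /= IH; lia.
Qed.

Lemma mu_DE s l : (s <= N)%N ->
  mu_D N s 0 l = 1 + (l < s)%N%:Z - (2 * N - s <= l)%N%:Z.
Proof. by move=> Hs; rewrite mxE; case: ltnP => H1; case: ltnP => H2; have := ltn_ord l; lia. Qed.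

(** At a self-dual vertex the difference is antisymmetric, so only its half-sum modulo 2 matters;
    there X may be replaced by its absolute value, whose half-sum is [nn w k]. *)
Lemma coroot_parity s w k : (s <= N)%N -> (k <= N)%N -> Wext w -> dualsum w 2 ->
  (forall l, -1 <= X w k l <= 1) -> X w k =1 X w (2 * N - k) ->
  in_coroot (mu_k w k%:Z - mu_D N s) = (2 %| nn w k - s%:Z)%Z.
Proof.
move=> Hs Hk Hw Hd Hb Hsd; have Hk2 : (k <= 2 * N)%N by lia.
have Z l : (mu_k w k%:Z - mu_D N s) 0 l + (mu_k w k%:Z - mu_D N s) 0 (rev_ord l) = 0.
  have H1 : (mu_k w k%:Z - mu_D N s) 0 l = X w k l + 1 - mu_D N s 0 l.
    by rewrite -mu_kE // !mxE.
  have H2 : (mu_k w k%:Z - mu_D N s) 0 (rev_ord l) = X w k (rev_ord l) + 1 - mu_D N s 0 (rev_ord l).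
    by rewrite -mu_kE // !mxE.
  rewrite H1 H2 X_dual' // -Hsd !mu_DE //=; have := ltn_ord l; lia.
rewrite /in_coroot; have -> /= : in_Xstar (mu_k w k%:Z - mu_D N s).
  by apply/forallP => a; apply/forallP => b; rewrite !Z.
have -> /= : [forall i, (mu_k w k%:Z - mu_D N s) 0 i + (mu_k w k%:Z - mu_D N s) 0 (rev_ord i) == 0].
  by apply/forallP => a; rewrite Z.
rewrite nn_half // (eq_bigr (fun l : 'I_(2 * N) => X w k l - (l < s)%N%:Z)); last first.
  move=> l Hl; have -> : (mu_k w k%:Z - mu_D N s) 0 l = X w k l + 1 - mu_D N s 0 l.
    by rewrite -mu_kE // !mxE.
  by rewrite mu_DE //; have := ltn_ord l; lia.
rewrite sumrB.
have -> : \sum_(l < 2 * N | (l < N)%N) (l < s)%N%:Z = s%:Z.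
  have := sum_lt_ord (2 * N) s; rewrite (bigID (fun l : 'I_(2 * N) => (l < N)%N)) /=.
  rewrite [X in _ + X]big1 => [|l Hl]; first by rewrite addr0 => ->; congr Posz; lia.
  by case: ltnP => // H; lia.
have D (a b c : int) : (2 %| a)%Z = (2 %| b)%Z -> (2 %| a - c)%Z = (2 %| b - c)%Z by lia.
exact: D (modZ2_abs _ _).
Qed.

Lemma spinP s w : (s <= N)%N -> Wext w -> spin_permissible s w <-> spinX s w.
Proof.
move=> Hs Hw; split=> [H|[_ Hd Hb Hn Hp] k Hk].
  have Hd : dualsum w 2.
    have [[/rowP H1 _] _ _] := H 0%N (leq0n _).
    move=> l; have := H1 l; rewrite [LHS]mxE [X in _ + X]mxE mu_kE // mu_kNE // mxE /X src_rev //=.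
    have := ltn_ord l; have := ltn_ord (src w l); lia.
  have Hb k l : (k <= 2 * N)%N -> -1 <= X w k l <= 1.
    move=> Hk; have [kN|kN] := leqP k N.
      by have [[_ /(_ l) Hx] _ _] := H k kN; move: Hx; rewrite mu_kE //; lia.
    have kN' : (2 * N - k <= N)%N by lia.
    have [[_ /(_ (rev_ord l)) Hx] _ _] := H _ kN'; move: Hx; rewrite mu_kE // X_dual //; lia.
  have Hn k : (k <= N)%N -> nn w k <= s%:Z.
    move=> kN; have [_ + _] := H k kN; rewrite /SP2 -sum1_card big_mkcond /= => H1.
    rewrite /nn (eq_bigr (fun l => ((if (mu_k w k%:Z 0%R l == 2)%R then 1%N else 0%N) : nat)%:Z)).
      by rewrite -(big_morph Posz PoszD (erefl _)) lez_nat; exact: H1.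
    by move=> l _; rewrite mu_kE //; case: eqP; case: eqP => //; lia.
  have Hp k : (k <= N)%N -> X w k =1 X w (2 * N - k) -> ~~ (2 %| nn w k - s%:Z)%Z ->
      forall b, exists2 l, sideB k l = b & X w k l = 0.
    move=> kN Hsd Hpar; have [_ _ Hsp] := H k kN.
    have Sd : self_dual w k%:Z by apply/rowP => l; rewrite mu_kE // mu_kNE // Hsd.
    have kN2 : (k <= 2 * N)%N by lia.
    move: Hsp => /(_ Sd); rewrite coroot_parity // => [|l]; last exact: Hb.
    move=> /(_ Hpar)[l1 [l2 []]]; rewrite !inE !mu_kE // => s1 s2 x1 x2.
    case; [exists l2|exists l1]; try lia.
      by rewrite /sideB; have := ltn_ord l2; lia.
    by rewrite /sideB; have := ltn_ord l1; lia.
  split=> // k Hk.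
    have [kN|kN] := leqP k N; first exact: Hn.
    by rewrite -nn_sym // => [|l]; [apply: Hn; lia|apply: Hb].
  have [kN|kN] := leqP k N; first exact: Hp.
  move=> Hsd; rewrite -nn_sym // => [Hpar b|l]; last exact: Hb.
  have [|l|l Hl1 Hl2] := Hp (2 * N - k)%N _ _ Hpar b; first by lia.
    by rewrite subKn // Hsd.
  by exists l; [rewrite -sideB_sym|rewrite Hsd].
have Hk2 : (k <= 2 * N)%N by lia.
split.
- split; last by move=> l; rewrite mu_kE //; have := Hb k l Hk2; lia.
  apply/rowP => l; rewrite [LHS]mxE [X in _ + X]mxE mu_kE // mu_kNE // X_dual // mxE; lia.
- have := Hn k Hk2; rewrite /SP2 -sum1_card big_mkcond /=.
  rewrite /nn (eq_bigr (fun l => ((if (mu_k w k%:Z 0%R l == 2)%R then 1%N else 0%N) : nat)%:Z)).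
    by rewrite -(big_morph Posz PoszD (erefl _)) lez_nat.
  by move=> l _; rewrite mu_kE //; case: eqP; case: eqP => //; lia.
move=> Sd Hpar.
have Hsd : X w k =1 X w (2 * N - k).
  by move=> l; have := congr1 (fun v : 'rV_(2 * N) => v 0 l) Sd; rewrite mu_kE // mu_kNE //; lia.
move: Hpar; rewrite coroot_parity // => [Hpar|l]; last exact: Hb.
have Z := Hp k Hk2 Hsd Hpar.
have [l1 a1 b1] := Z false; have [l2 a2 b2] := Z true.
exists l1, l2; rewrite !inE !mu_kE //; move: a1 a2; rewrite /sideB.
have := ltn_ord l1; have := ltn_ord l2; split; lia.
Qed.

End Spin.

(** * Reflections towards the base alcove *)

Section Refl.
Variable N : nat.
Implicit Types (w u : affperm (2 * N)) (i j l q : 'I_(2 * N)) (k : nat).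

(* The values of x_i - x_j - d at w omega_k and at omega_k. *)
Definition ud w i j (d : int) k : int :=
  tr w i - tr w j - d - (src w i < k)%N%:Z + (src w j < k)%N%:Z.
Definition vd i j (d : int) k : int := - (i < k)%N%:Z + (j < k)%N%:Z - d.

Lemma ud_vd w i j d k : ud w i j d k - vd i j d k = X w k i - X w k j.
Proof. rewrite /ud /vd /X; lia. Qed.

(** The entries of omega_k increase weakly with the index and span at most 1, as those of base / (4
    N) do strictly; a strict inequality on the alcove of w thus becomes a weak one at w omega_k. *)
Lemma ud_ge0 w i j d k : 0 < sd w i j d -> 0 <= ud w i j d k.
Proof.
rewrite sdE => /(modM_gt0 (base_diff_lt _ _)) [q0 H]; rewrite /ud.
have [q1|q1] : tr w i - tr w j - d = 0 \/ 1 <= tr w i - tr w j - d by lia.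
  by have := H q1; rewrite /base; lia.
by lia.
Qed.

Lemma ud_le0 w i j d k : sd w i j d < 0 -> ud w i j d k <= 0.
Proof.
rewrite sdE => /(modM_lt0 (base_diff_lt _ _)) [q0 H]; rewrite /ud.
have [q1|q1] : tr w i - tr w j - d = 0 \/ tr w i - tr w j - d <= -1 by lia.
  by have := H q1; rewrite /base; lia.
by lia.
Qed.

Lemma vdE i j d k : vd i j d k = ud 1%g i j d k.
Proof. rewrite /vd /ud !tr1 !src1; lia. Qed.

Lemma X_refl w i j d k l : Wext w -> is_root i j -> (k <= 2 * N)%N ->
  X (root_reflection i j d * w)%g k l =
  if l == i then X w k i - ud w i j d k else if l == j then X w k j + ud w i j d k else
  if l == rev_ord i then X w k (rev_ord i) + ud w i j d (2 * N - k) else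
  if l == rev_ord j then X w k (rev_ord j) - ud w i j d (2 * N - k) else X w k l.
Proof.
move=> Hw Hr Hk; have [[c Hc] _ _] := Hw.
rewrite {1}/X trM srcM tr_refl // src_refl //.
case: (l =P i) => [->|_]; first by rewrite /X /ud; lia.
case: (l =P j) => [->|_]; first by rewrite /X /ud; lia.
have := Hc i; have := Hc j.
case: (l =P rev_ord i) => [->|_].
  rewrite /X /ud !src_rev //=; have := ltn_ord (src w i); have := ltn_ord (src w j); lia.
case: (l =P rev_ord j) => [->|_].
  rewrite /X /ud !src_rev //=; have := ltn_ord (src w i); have := ltn_ord (src w j); lia.
by rewrite /X; lia.
Qed.

Lemma dualsum_reflM w i j d c : Wext w -> is_root i j -> dualsum w c ->
  dualsum (root_reflection i j d * w)%g c.
Proof.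
move=> Hw Hr Hc; rewrite -[c]add0r; apply: dualsumM => //; first exact: WextR.
exact: dualsum_refl.
Qed.

Lemma nn_refl w i j d k (f := fun x : int => (x == 1)%N%:Z) : Wext w -> is_root i j -> (k <= 2 * N)%N ->
  nn (root_reflection i j d * w)%g k = nn w k +
   (f (X w k i - ud w i j d k) - f (X w k i)) + (f (X w k j + ud w i j d k) - f (X w k j)) +
   (f (X w k (rev_ord i) + ud w i j d (2 * N - k)) - f (X w k (rev_ord i))) +
   (f (X w k (rev_ord j) - ud w i j d (2 * N - k)) - f (X w k (rev_ord j))).
Proof.
move=> Hw Hr Hk; have E := root_eqF Hr.
rewrite /nn (sum_update4 (G := fun l => f (X w k l)) Hr) /f.
  by rewrite !X_refl // ?eqxx ?E.
by move=> l l1 l2 l3 l4; rewrite X_refl // (negbTE l1) (negbTE l2) (negbTE l3) (negbTE l4).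
Qed.

Lemma sideB_vd i j d k : (k <= 2 * N)%N ->
  (vd i j d k == vd i j d (2 * N - k)) = (sideB k i == sideB k j).
Proof. rewrite /vd /sideB; lia. Qed.

(** By [ud_vd], X_i - X_j = u - v >= u >= 0, so the new entries X_i - u and X_j + u stay between X_j
    and X_i and keep their sum. On {-1, 0, 1} the indicator of 1 is the convex function max(x, 0),
    hence [nn] does not increase. *)
Lemma spinX_down_pos s w i j d : is_root i j ->
  (forall k, 0 <= ud w i j d k) -> (forall k, vd i j d k <= 0) ->
  spinX s w -> spinX s (root_reflection i j d * w)%g.
Proof.
move=> Hr Hu Hv [Hw Hd Hb Hn Hp]; have E := root_eqF Hr.
set r := root_reflection i j d.
have Hrw : Wext (r * w)%g by apply: WextM => //; apply: WextR.
have Hrd : dualsum (r * w)%g 2 by apply: dualsum_reflM.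
have Hb' k l : (k <= 2 * N)%N -> -1 <= X (r * w)%g k l <= 1.
  move=> Hk; have Hk' : (2 * N - k <= 2 * N)%N by lia.
  rewrite X_refl //.
  have := Hb k i Hk; have := Hb k j Hk; have := Hb _ i Hk'; have := Hb _ j Hk'.
  have := ud_vd w i j d k; have := ud_vd w i j d (2 * N - k).
  have := Hu k; have := Hu (2 * N - k)%N; have := Hv k; have := Hv (2 * N - k)%N.
  rewrite !X_dual' // -/r.
  do 4![case: eqP => [_|_]; first lia].
  by move=> *; apply: Hb.
split=> // k Hk.
  apply: le_trans (Hn k Hk); rewrite nn_refl // !X_dual' //.
  have Hk' : (2 * N - k <= 2 * N)%N by lia.
  have := Hb k i Hk; have := Hb k j Hk; have := Hb _ i Hk'; have := Hb _ j Hk'.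
  have := ud_vd w i j d k; have := ud_vd w i j d (2 * N - k).
  have := Hu k; have := Hu (2 * N - k)%N; have := Hv k; have := Hv (2 * N - k)%N.
  move: (X w _ _) (X w _ _) (X w _ _) (X w _ _) (ud _ _ _ _ _) (ud _ _ _ _ _) (vd _ _ _ _) (vd _ _ _ _).
  move: (nn w k) => n a b c e f g h o *; lia.
move=> Hsd Hpar b.
have Hk' : (2 * N - k <= 2 * N)%N by lia.
have Si : X w k i - ud w i j d k = X w (2 * N - k) i - ud w i j d (2 * N - k).
  by have := Hsd i; rewrite !X_refl // eqxx.
have Sj : X w k j + ud w i j d k = X w (2 * N - k) j + ud w i j d (2 * N - k).
  by have := Hsd j; rewrite !X_refl // eqxx E.
have B1 := Hb k i Hk; have B2 := Hb k j Hk; have B3 := Hb _ i Hk'; have B4 := Hb _ j Hk'.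
have U1 := ud_vd w i j d k; have U2 := ud_vd w i j d (2 * N - k).
have P1 := Hu k; have P2 := Hu (2 * N - k)%N; have M1 := Hv k; have M2 := Hv (2 * N - k)%N.
have B5 := Hb' k i Hk; have B6 := Hb' k j Hk.
have B7 := Hb' _ i Hk'; have B8 := Hb' _ j Hk'.
have Xi : X (r * w)%g k i = X w k i - ud w i j d k by rewrite X_refl // eqxx.
have Xj : X (r * w)%g k j = X w k j + ud w i j d k by rewrite X_refl // eqxx E.
have SB := sideB_vd i j d Hk.
(* If u differs at k and 2N - k, self-duality after the reflection makes v differ too, so i and j
   are on opposite sides; the bounds leave only 0 for both new entries. *)
have [Huu|Huu] := eqVneq (ud w i j d k) (ud w i j d (2 * N - k)); last first.
  have Z1 : X (r * w)%g k i = 0.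
    move: Hsd B7 B8 => /[dup]/(_ i) <- /(_ j) <- *; rewrite !Xi !Xj in B5 B6 *; lia.
  have Z2 : X (r * w)%g k j = 0.
    move: Hsd B7 B8 => /[dup]/(_ i) <- /(_ j) <- *; rewrite !Xi !Xj in B5 B6 *; lia.
  have Sij : sideB k i != sideB k j.
    by apply/negP => /eqP Sij; move: SB; rewrite Sij eqxx => /eqP Hvv; lia.
  have [<-|Sb] := eqVneq (sideB k i) b; first by exists i.
  by exists j => //; move: Sij Sb; case: (sideB k i); case: (sideB k j); case: b.
(* Otherwise w is already self-dual at k with the same parity, and a zero among the moved entries is
   handed over to a moved entry on the same side. *)
have Hsd' : X w k =1 X w (2 * N - k).
  move=> l; have := Hsd l; rewrite !X_refl // subKn // Huu.
  case: (l =P i) => [->|_]; first lia.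
  case: (l =P j) => [->|_]; first lia.
  case: (l =P rev_ord i) => [->|_]; first lia.
  by case: (l =P rev_ord j) => [->|_]; first lia.
have Hpar' : ~~ (2 %| nn w k - s%:Z)%Z.
  move: Hpar; rewrite nn_refl // !X_dual' // -!Hsd' -Huu.
  move: B1 B2 B5 B6 P1 {B3 B4 B7 B8 Hsd Hsd' U2 P2 M2 SB}; rewrite Xi Xj.
  move: (X w k i) (X w k j) (ud w i j d k) (nn w k) U1 M1 => a c u n U1 M1 B1 B2 B5 B6 P1.
  apply: contra => H.
  have D : (2 %| (((a - u == 1) : nat)%:Z - ((a == 1) : nat)%:Z) + (((c + u == 1) : nat)%:Z - ((c == 1) : nat)%:Z)
     + (((- a + u == 1) : nat)%:Z - ((- a == 1) : nat)%:Z) + (((- c - u == 1) : nat)%:Z - ((- c == 1) : nat)%:Z))%Z by lia.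
  by move: D H; lia.
have [l Hl Zl] := Hp k Hk Hsd' Hpar' b.
have Side l' : sideB k l' = b -> X (r * w)%g k l' = 0 -> exists2 l, sideB k l = b & X (r * w)%g k l = 0.
  by move=> *; exists l'.
have [u0|u0] := eqVneq (ud w i j d k) 0.
  apply: (Side l) => //; rewrite X_refl // -Huu u0 subr0 addr0.
  case: eqP => [<- //|_]; case: eqP => [<- //|_].
  by rewrite addr0 subr0; case: eqP => [<- //|_]; case: eqP => [<- //|_].
have SE : X w k i = 0 \/ X w k j = 0 -> sideB k i = sideB k j.
  move=> H; suff Hvv : vd i j d k = vd i j d (2 * N - k).
    by move: SB; rewrite Hvv eqxx => /esym/eqP.
  rewrite Xi Xj in B5 B6.
  have := Hsd' i; have := Hsd' j; lia.
have Zj : X w k i = 0 -> X (r * w)%g k j = 0 by move=> H; rewrite Xi Xj in B5 B6 *; lia.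
have Zi : X w k j = 0 -> X (r * w)%g k i = 0 by move=> H; rewrite Xi Xj in B5 B6 *; lia.
have [li|li] := eqVneq l i.
  by rewrite li in Hl Zl; apply: (Side j); [rewrite -SE //; left|apply: Zj].
have [lj|lj] := eqVneq l j.
  by rewrite lj in Hl Zl; apply: (Side i); [rewrite SE //; right|apply: Zi].
have [lri|lri] := eqVneq l (rev_ord i).
  rewrite lri sideB_rev // X_dual' // -Hsd' in Hl Zl.
  have Zl' : X w k i = 0 by lia.
  by apply: (Side j); [rewrite -SE //; left|apply: Zj].
have [lrj|lrj] := eqVneq l (rev_ord j).
  rewrite lrj sideB_rev // X_dual' // -Hsd' in Hl Zl.
  have Zl' : X w k j = 0 by lia.
  by apply: (Side i); [rewrite SE //; right|apply: Zi].
apply: (Side l) => //.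
by rewrite X_refl // (negbTE li) (negbTE lj) (negbTE lri) (negbTE lrj).
Qed.

End Refl.

(** * Upward moves *)

Section PMove.
Variable N : nat.
Implicit Types (w u : affperm (2 * N)) (b e f g i j l q t : 'I_(2 * N)) (k : nat).

(* Indicator of b < k <= e in the cyclic order. *)
Definition cc b e k : int := (e < b)%N%:Z + (b < k)%N%:Z - (e < k)%N%:Z.

Lemma cc01 b e k : b != e -> cc b e k = 0 \/ cc b e k = 1.
Proof. rewrite -val_eqE /cc /=; lia. Qed.

(** The constant [e < b] accounts for the wrap-around: with it, x_b - x_e - [e < b] takes the value
    [- cc b e k] at omega_k. *)
Definition pmove w b e : affperm (2 * N) := (w * root_reflection b e (e < b)%N%:Z)%g.

Lemma is_root_linpart w i j : Wext w -> is_root i j -> is_root (linpart w i) (linpart w j).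
Proof. by case=> _ _ Hl; rewrite /is_root -Hl !(inj_eq perm_inj). Qed.

Section Fixed.
Variables (s : nat) (w : affperm (2 * N)) (b e : 'I_(2 * N)).
Hypothesis Hsp : spinX s w.
Hypothesis Hr : is_root b e.
Let f := linpart w b.
Let g := linpart w e.
Let d' := (e < b)%N%:Z + tr w f - tr w g.

Let Hw : Wext w. Proof. by case: Hsp. Qed.
Let Hd : dualsum w 2. Proof. by case: Hsp. Qed.
Let Hb k l : (k <= 2 * N)%N -> -1 <= X w k l <= 1. Proof. by case: Hsp => _ _ H _ _; exact: H. Qed.

Lemma pmoveE : pmove w b e = (root_reflection f g d' * w)%g.
Proof. by rewrite /pmove -refl_conj // mulgKV. Qed.

Let Hrfg : is_root f g. Proof. exact: is_root_linpart. Qed.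

Lemma ud_pmove k : ud w f g d' k = - cc b e k.
Proof. rewrite /ud /d' /cc /f /g !linpartK; lia. Qed.

Lemma pmove_Wext : Wext (pmove w b e).
Proof. by apply: WextM => //; apply: WextR. Qed.

Lemma pmove_dual : dualsum (pmove w b e) 2.
Proof. by rewrite pmoveE; apply: dualsum_reflM. Qed.

Lemma X_pmove k l : (k <= 2 * N)%N ->
  X (pmove w b e) k l =
  if l == f then X w k f + cc b e k else if l == g then X w k g - cc b e k else
  if l == rev_ord f then X w k (rev_ord f) - cc b e (2 * N - k) else
  if l == rev_ord g then X w k (rev_ord g) + cc b e (2 * N - k) else X w k l.
Proof. by move=> Hk; rewrite pmoveE X_refl // !ud_pmove !opprK. Qed.

(** The alcove of w is always on the negative side. Were that of 1 on the positive side, [vd] would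
    be nonnegative at all times, which by [ud_vd] contradicts the inequality at [k0]. *)
Lemma pmove_up k0 : (k0 <= 2 * N)%N -> 0 < X w k0 f - X w k0 g + cc b e k0 ->
  (0 < sd 1%g f g d') = (0 < sd w f g d').
Proof.
move=> Hk0 H.
have nbe : b != e by have [n1 _] := andP Hr; rewrite eq_sym.
have -> : (0 < sd w f g d') = false.
  rewrite /sd /pt /f /g !linpartK -/f -/g /d' /base.
  have -> : (4 * N)%N%:Z * tr w f + ((2 * b)%N%:Z - (2 * N)%N%:Z + 1) -
   ((4 * N)%N%:Z * tr w g + ((2 * e)%N%:Z - (2 * N)%N%:Z + 1)) -
   (4 * N)%N%:Z * ((e < b)%N%:Z + tr w f - tr w g) = 2 * (b%:Z - e%:Z) - (4 * N)%N%:Z * (e < b)%N%:Z.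
    by lia.
  move: nbe (ltn_ord b) (ltn_ord e); rewrite -val_eqE /=; lia.
apply/negP => Hs0; have := @ud_ge0 N 1%g f g d' k0 Hs0; rewrite -vdE //.
have := ud_vd w f g d' k0; rewrite ud_pmove; lia.
Qed.

Lemma nn_pmove k (F := fun x : int => (x == 1)%N%:Z) : (k <= 2 * N)%N ->
  nn (pmove w b e) k = nn w k +
   (F (X w k f + cc b e k) - F (X w k f)) + (F (X w k g - cc b e k) - F (X w k g)) +
   (F (- X w (2 * N - k) f - cc b e (2 * N - k)) - F (- X w (2 * N - k) f)) +
   (F (- X w (2 * N - k) g + cc b e (2 * N - k)) - F (- X w (2 * N - k) g)).
Proof.
by move=> Hk; rewrite pmoveE nn_refl // !ud_pmove !X_dual' // !opprK.
Qed.

(** A time outside the interval either has its mirror image inside, and follows by duality, or X is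
    unchanged there. *)
Lemma spinX_pmove :
  (forall k, (k <= 2 * N)%N -> cc b e k = 1 -> -1 <= X w k f <= 0 /\ 0 <= X w k g <= 1) ->
  (forall k, (k <= 2 * N)%N -> nn (pmove w b e) k <= s%:Z) ->
  (forall k, (k <= 2 * N)%N -> cc b e k = 1 -> X (pmove w b e) k =1 X (pmove w b e) (2 * N - k) ->
     ~~ (2 %| nn (pmove w b e) k - s%:Z)%Z ->
     forall c, exists2 l, sideB k l = c & X (pmove w b e) k l = 0) ->
  spinX s (pmove w b e).
Proof.
move=> H1 H2 H3; have E := root_eqF Hrfg.
have nbe : b != e by have [n1 _] := andP Hr; rewrite eq_sym.
have Bd k l : (k <= 2 * N)%N -> -1 <= X (pmove w b e) k l <= 1.
  move=> Hk; have Hk' : (2 * N - k <= 2 * N)%N by lia.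
  rewrite X_pmove // !X_dual' //.
  have := Hb f Hk; have := Hb g Hk; have := Hb f Hk'; have := Hb g Hk'.
  have := H1 k Hk; have := H1 _ Hk'; have := cc01 k nbe; have := cc01 (2 * N - k) nbe.
  move=> [->|->] [->|->]; do 4![case: eqP => [_|_]; first lia]; move=> *; exact: Hb.
split=> // [||k Hk Hsd Hpar c]; [exact: pmove_Wext|exact: pmove_dual|].
have Hk' : (2 * N - k <= 2 * N)%N by lia.
have [c1|c1] := cc01 k nbe; last exact: H3.
have [c2|c2] := cc01 (2 * N - k) nbe; last first.
  have [||l Hl1 Hl2] := H3 _ Hk' c2 _ _ c.
  - by move=> l; rewrite subKn // Hsd.
  - by rewrite nn_sym //; [exact: pmove_Wext|exact: pmove_dual|move=> l; exact: Bd].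
  by exists l; [rewrite -sideB_sym|rewrite Hsd].
have Xk l : X (pmove w b e) k l = X w k l.
  rewrite X_pmove // c1 c2 ?addr0 ?subr0.
  by do 4![case: eqP => [->//|_]].
have XK l : X (pmove w b e) (2 * N - k) l = X w (2 * N - k) l.
  rewrite X_pmove // subKn // c1 c2 ?addr0 ?subr0.
  by do 4![case: eqP => [->//|_]].
have [_ _ _ _ Hp] := Hsp.
have [||l Hl1 Hl2] := Hp k Hk _ _ c.
- by move=> l; rewrite -Xk Hsd XK.
- by move: Hpar; rewrite /nn (eq_bigr (fun l => (X w k l == 1)%N%:Z)) // => l _; rewrite Xk.
by exists l; rewrite ?Xk.
Qed.

Definition upmove w1 := exists i j d, [/\ is_root i j, (0 < sd 1%g i j d) = (0 < sd w1 i j d) &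
  spinX s (root_reflection i j d * w1)%g].

Lemma pmove_upmove k0 : (k0 <= 2 * N)%N -> 0 < X w k0 f - X w k0 g + cc b e k0 ->
  spinX s (pmove w b e) -> upmove w.
Proof.
move=> Hk0 H Hs; exists f, g, d'; split=> //; first exact: pmove_up H.
by rewrite -pmoveE.
Qed.

(** The term 1 + [cc b e (2 * N - k)] counts the ones created at time k: one at f and, if the mirror
    time lies in the interval, one at the dual of g. *)
Lemma fill_up :
  (forall k, (k <= 2 * N)%N -> cc b e k = 1 -> X w k f = 0 /\ X w k g = 0) ->
  (forall k, (k <= 2 * N)%N -> cc b e k = 1 -> nn w k + 1 + cc b e (2 * N - k) <= s%:Z) ->
  (forall k, (k <= 2 * N)%N -> cc b e k = 1 -> X (pmove w b e) k =1 X (pmove w b e) (2 * N - k) ->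
     ~~ (2 %| nn w k + 1 + cc b e (2 * N - k) - s%:Z)%Z ->
     forall c, exists2 l, sideB k l = c & X (pmove w b e) k l = 0) ->
  upmove w.
Proof.
move=> H1 H2 H3.
have nbe : b != e by have [n1 _] := andP Hr; rewrite eq_sym.
have Hn k : (k <= 2 * N)%N -> nn (pmove w b e) k = nn w k + cc b e k + cc b e (2 * N - k).
  move=> Hk; have Hk' : (2 * N - k <= 2 * N)%N by lia.
  rewrite nn_pmove //; have := H1 k Hk; have := H1 _ Hk'.
  have := cc01 k nbe; have := cc01 (2 * N - k) nbe.
  move=> [->|->] [->|->].
  - by move=> _ _; rewrite ?subr0 ?addr0; lia.
  - by move=> _ /(_ erefl)[-> ->]; rewrite ?subr0 ?addr0 add0r; lia.
  - by move=> /(_ erefl)[-> ->] _; rewrite ?subr0 ?addr0 add0r; lia.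
  by move=> /(_ erefl)[-> ->] /(_ erefl)[-> ->]; rewrite add0r; lia.
have b1 : (b.+1 <= 2 * N)%N by [].
have cb : cc b e b.+1 = 1 by move: nbe; rewrite -val_eqE /cc /=; lia.
apply: (@pmove_upmove b.+1) => //.
  by have [-> ->] := H1 _ b1 cb; rewrite cb.
apply: spinX_pmove => [k Hk c1|k Hk|k Hk c1].
- by have [-> ->] := H1 _ Hk c1.
- rewrite Hn //; have Hk' : (2 * N - k <= 2 * N)%N by lia.
  have [c1|c1] := cc01 k nbe; last by have := H2 k Hk c1; lia.
  have [c2|c2] := cc01 (2 * N - k) nbe; first by case: Hsp => _ _ _ /(_ k Hk); lia.
  have := H2 _ Hk' c2; rewrite subKn // nn_sym // => [|l]; last exact: Hb.
  by lia.
by rewrite Hn // c1 => *; apply: H3.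
Qed.

(** Inside the interval the difference in the hypothesis on [k0] is -1 - 0 + 1 = 0, so the witness
    [k0] that the move goes up must lie outside. *)
Lemma exchange_up k0 : (k0 <= 2 * N)%N -> 0 < X w k0 f - X w k0 g + cc b e k0 ->
  (forall k, (k <= 2 * N)%N -> cc b e k = 1 -> X w k f = -1 /\ X w k g = 0) ->
  (forall k, (k <= 2 * N)%N -> cc b e k = 1 -> X (pmove w b e) k =1 X (pmove w b e) (2 * N - k) ->
     ~~ (2 %| nn w k - s%:Z)%Z ->
     forall c, exists2 l, sideB k l = c & X (pmove w b e) k l = 0) ->
  upmove w.
Proof.
move=> Hk0 Hup H1 H3.
have nbe : b != e by have [n1 _] := andP Hr; rewrite eq_sym.
have Hn k : (k <= 2 * N)%N -> nn (pmove w b e) k = nn w k.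
  move=> Hk; have Hk' : (2 * N - k <= 2 * N)%N by lia.
  rewrite nn_pmove //; have := H1 k Hk; have := H1 _ Hk'.
  have := cc01 k nbe; have := cc01 (2 * N - k) nbe.
  move=> [->|->] [->|->].
  - by move=> _ _; rewrite ?subr0 ?addr0; lia.
  - by move=> _ /(_ erefl)[-> ->]; rewrite ?subr0 ?addr0; lia.
  - by move=> /(_ erefl)[-> ->] _; rewrite ?subr0 ?addr0; lia.
  by move=> /(_ erefl)[-> ->] /(_ erefl)[-> ->]; lia.
apply: (@pmove_upmove k0) => //.
apply: spinX_pmove => [k Hk c1|k Hk|k Hk c1].
- by have [-> ->] := H1 _ Hk c1.
- by rewrite Hn //; case: Hsp => _ _ _ /(_ k Hk).
by rewrite Hn // => *; apply: H3.
Qed.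

End Fixed.

(* The map iw exchanges, up to sign, X w e e and X w e (linpart w e), and thus
   halves the number of cases to consider. *)
Definition shift2 : affperm (2 * N) := AffPerm (const_mx 2) 1%g.
Definition iw w : affperm (2 * N) := (shift2 * w^-1)%g.

Lemma tr_shift2 l : tr shift2 l = 2.
Proof. by rewrite /tr mxE. Qed.

Lemma src_shift2 l : src shift2 l = l.
Proof. by rewrite /src /= invg1 perm1. Qed.

Lemma Wext_shift2 : Wext shift2.
Proof.
split=> [|| i]; first by exists 4 => i; rewrite !tr_shift2.
  by rewrite odd_perm1.
by rewrite !perm1.
Qed.

Lemma shift2C w : (shift2 * w = w * shift2)%g.
Proof.
apply: affperm_eqP => l; last by rewrite !srcM !src_shift2.
by rewrite !trM !tr_shift2 src_shift2 addrC.
Qed.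

Lemma src_iw w l : src (iw w) l = linpart w l.
Proof. by rewrite srcM src_shift2 srcV. Qed.

Lemma linpart_iw w l : linpart (iw w) l = src w l.
Proof. by apply: (@src_inj _ (iw w)); rewrite linpartK src_iw srcK. Qed.

Lemma X_iw w k l : X (iw w) k l = - X w k (linpart w l).
Proof. by rewrite /X src_iw linpartK trM tr_shift2 src_shift2 trV; lia. Qed.

Lemma iw_Wext w : Wext w -> Wext (iw w).
Proof. by move=> Hw; apply: WextM; [exact: Wext_shift2|exact: WextV]. Qed.

Lemma nn_iw w k : Wext w -> dualsum w 2 -> (k <= 2 * N)%N ->
  (forall l, -1 <= X w k l <= 1) -> nn (iw w) k = nn w k.
Proof.
move=> Hw Hd Hk Hb; rewrite -[RHS]nn_sym // /nn.
rewrite (reindex_inj (@src_inj _ w)) [RHS](reindex_inj rev_ord_inj) /=.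
by apply: eq_bigr => l _; rewrite X_iw srcK X_dual.
Qed.

Lemma spinX_iw s w : spinX s w -> spinX s (iw w).
Proof.
case=> Hw Hd Hb Hn Hp; have Hl : forall l, linpart w (rev_ord l) = rev_ord (linpart w l) by case: Hw.
split.
- exact: iw_Wext.
- move=> l; rewrite !trM !tr_shift2 !src_shift2 !trV Hl; have := Hd (linpart w l); lia.
- by move=> k l Hk; rewrite X_iw; have := Hb k (linpart w l) Hk; lia.
- by move=> k Hk; rewrite nn_iw // => [|l]; [apply: Hn|apply: Hb].
move=> k Hk Hsd; rewrite nn_iw // => [Hpar c|l]; last exact: Hb.
have Hsd' : X w k =1 X w (2 * N - k).
  by move=> l; have := Hsd (src w l); rewrite !X_iw !srcK; lia.
have [l Hl1 Hl2] := Hp k Hk Hsd' Hpar c.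
exists (src w l); last by rewrite X_iw srcK Hl2 oppr0.
(* Self-duality at k forces [src w] to preserve the sides A_k and B_k. *)
by have := Hsd' l; rewrite -Hl1 /X /sideB; lia.
Qed.

(** Inversion turns left multiplication of [iw w] by a reflection into right multiplication of w,
    that is, left multiplication by a conjugate reflection; the translation [shift2] is central. *)
Lemma iw_upmove s w : Wext w -> upmove s (iw w) -> upmove s w.
Proof.
move=> Hw [i [j [d [Hr Hs /spinX_iw Hx]]]].
have Hc := refl_conj d Hw Hr.
exists (linpart w i), (linpart w j), (d + tr w (linpart w i) - tr w (linpart w j)); split.
- exact: is_root_linpart.
- have -> : sd 1%g (linpart w i) (linpart w j) (d + tr w (linpart w i) - tr w (linpart w j)) = sd (iw w) i j d.
    by rewrite /sd !pt1 /pt !src_iw !trM !tr_shift2 !src_shift2 !trV; ring.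
  rewrite -Hs; congr (0 < _).
  by rewrite /sd !pt1 /pt !linpartK; ring.
rewrite -Hc mulgKV.
suff <- : iw (root_reflection i j d * iw w)%g = (w * root_reflection i j d)%g by [].
by rewrite /iw !invMg invgK reflV // !mulgA shift2C mulgK.
Qed.

End PMove.

Lemma rev_val n (b : 'I_n) : (n.-1 - b)%N = rev_ord b.
Proof. by rewrite /= -subn1 -subnDA add1n. Qed.

(** * Cyclic intervals of times *)

Section Cyclic.
Local Open Scope nat_scope.

Definition cyc (b e k : nat) : bool := if (e < b)%N then (k <= e)%N || (b < k)%N else (b < k <= e)%N.

(** Ranks the n + 1 times 0, ..., n in cyclic order starting just after e, so that intervals
    starting at e become initial segments. *)
Definition rk (n e k : nat) : nat := if (e < k)%N then k else (k + n.+1)%N.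

Lemma cyc_rk (n e p q t : nat) : (q <= n)%N -> (t <= n)%N -> cyc e p t -> ~~ cyc e p q -> (rk n e t < rk n e q)%N.
Proof.
rewrite /cyc /rk; case: (ltnP p e) => H1; case: (ltnP e t) => H2; case: (ltnP e q) => H3; lia.
Qed.

Lemma rk_cyc (n e p q t : nat) : (p < n)%N -> (q <= n)%N -> (t <= n)%N -> p <> e -> cyc e p q -> (rk n e t < rk n e q)%N -> cyc e p t.
Proof.
rewrite /cyc /rk; case: (ltnP p e) => H1; case: (ltnP e t) => H2; case: (ltnP e q) => H3; lia.
Qed.

(** Serves the exchange starting at e when it ends at the mirror image of b: that interval ends no
    later than (e, g]. *)
Lemma cyc_rev_sub (n b e g k t : nat) : (b < n)%N -> (e < n)%N -> (g < n)%N -> (k <= n)%N -> (t <= n)%N ->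
  b <> e -> e <> (n.-1 - b)%N -> g <> e -> 
  cyc b e k -> ~~ cyc b e (n - k) -> cyc e g (n - k) -> 
  ~~ (cyc b e (n.-1-g) && cyc b e (n-g)) ->
  cyc e (n.-1 - b) t -> cyc e g t.
Proof.
rewrite /cyc; case: (ltnP e b) => H1; case: (ltnP g e) => H2; case: (ltnP (n.-1 - b) e) => H3.
all: lia.
Qed.

(** This lemma and [cyc_rev_mem] place the mirror image of an exchange time in the filled interval
    (b, e]; the latter treats an exchange ending at the mirror image of b. *)
Lemma rk_mem (n b e k h : nat) : (b < n)%N -> (e < n)%N -> (k <= n)%N -> (h <= n)%N -> 
  b <> e -> cyc b e k -> ~~ cyc b e (n - k) -> (rk n e h < rk n e (n - k))%N ->
  (rk n e (n - k) < rk n e (n - h))%N -> cyc b e (n - h).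
Proof.
move=> Hb He Hk Hh; rewrite /rk /cyc; case: (ltnP e b) => H1; case: (ltnP e h) => H2; case: (ltnP e (n - h)) => H3; case: (ltnP e (n - k)) => H4; lia.
Qed.

Lemma cyc_rev_mem (n b e k h : nat) : (b < n)%N -> (e < n)%N -> (k <= n)%N -> (h <= n)%N -> 
  b <> e -> e <> (n.-1 - b)%N -> cyc b e k -> ~~ cyc b e (n - k) -> 
  cyc e (n.-1 - b) h -> ~~ cyc e (n.-1 - b) (n - h) -> 
  (rk n e (n - k) < rk n e (n - h))%N -> cyc b e (n - h).
Proof.
move=> Hb He Hk Hh; rewrite /rk /cyc; case: (ltnP e b) => H1; case: (ltnP (n.-1-b) e) => H2; case: (ltnP e (n - h)) => H3;case: (ltnP e (n - k)) => H4; lia.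
Qed.

End Cyclic.

(** * Filling an interval disjoint from its mirror image *)

Section Fill.
Variable N : nat.
Implicit Types (w u : affperm (2 * N)) (b e f g i j l q t : 'I_(2 * N)) (k : nat).

Lemma ccE b e k : b != e -> cc b e k = (cyc b e k)%:Z.
Proof. by rewrite -val_eqE /cc /cyc /=; case: (ltnP e b); lia. Qed.

(** The index t acts in the step from time t to t + 1, so this says that the step stays within the
    interval. *)
Definition inter b e t := cc b e t = 1 /\ cc b e t.+1 = 1.
(* Then X w k t is a nonzero constant in k. *)
Definition full w t := src w t = t /\ tr w t != 1.

Lemma X_triv w k l : src w l = l -> X w k l = tr w l - 1.
Proof. by move=> H; rewrite /X H addrK. Qed.

(* Between the times t and t + 1, only the entries t and linpart w t of X change. *)
Lemma X_step w t l : X w t.+1 l = X w t l + (l == t)%N%:Z - (src w l == t)%N%:Z.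
Proof. rewrite -!val_eqE /X /=; lia. Qed.

Lemma X_neg w e (t : nat) : (t <= 2 * N)%N -> src w e != e -> X w e e = -1 -> X w t e = cc e (src w e) t - 1.
Proof. rewrite -val_eqE /X /cc /=; lia. Qed.

Lemma X_null w e g (t : nat) : (t <= 2 * N)%N -> src w g = e -> g != e -> X w e g = 0 -> X w t g = - cc e g t.
Proof. move=> Ht sg; rewrite -val_eqE /X sg /cc /=; lia. Qed.

(** Along the interval the truth of l < k can only change when k passes l, which is excluded, or
    wraps round from 2N to 0; [k <= b] records the wrap. *)
Lemma inter_const b e k l : b != e -> (k <= 2 * N)%N -> cc b e k = 1 -> ~ inter b e l ->
  (l < k)%N%:Z - (l < b.+1)%N%:Z = - (k <= b)%N%:Z.
Proof.
move=> nbe Hk Hc n1.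
have H : cc b e l = 0 \/ cc b e l.+1 = 0.
  have [c1|c1] := cc01 l nbe; first by left.
  have [c2|c2] := cc01 l.+1 nbe; first by right.
  by case: n1.
move: nbe Hk Hc; rewrite -val_eqE {1}/cc /= => nbe Hk Hc.
move: H; rewrite /cc {n1}; case: (ltnP e b) => /= H1; case: (ltnP b k) => /= H2; case: (leqP k b) => H3;
  rewrite ?H1 /=; move: Hc; have := ltn_ord l; lia.
Qed.

Lemma X_const w b e l k : b != e -> (k <= 2 * N)%N -> cc b e k = 1 ->
  (forall t, inter b e t -> src w t = t) -> X w k l = X w b.+1 l.
Proof.
move=> nbe Hk Hc Hi.
have [H|H] := eqVneq (src w l) l; first by rewrite !X_triv.
have n1 : ~ inter b e l by move=> /Hi /eqP; apply/negP.
have n2 : ~ inter b e (src w l) by move=> /Hi /src_inj /eqP; apply/negP.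
have := inter_const nbe Hk Hc n1; have := inter_const nbe Hk Hc n2; rewrite /X; lia.
Qed.

Lemma nn_const w b e k : b != e -> (k <= 2 * N)%N -> cc b e k = 1 ->
  (forall t, inter b e t -> src w t = t) -> nn w k = nn w b.+1.
Proof. by move=> *; apply: eq_bigr => l _; rewrite (@X_const w b e). Qed.

Lemma nn_step0 w t : src w t = t -> nn w t.+1 = nn w t.
Proof.
move=> H; apply: eq_bigr => l _; rewrite X_step.
have -> : (src w l == t) = (l == t) by rewrite -{1}H (inj_eq (@src_inj _ w)).
by rewrite addrK.
Qed.

Lemma nn_step w t (F := fun x : int => (x == 1)%N%:Z) (f := linpart w t) : src w t != t ->
  nn w t.+1 = nn w t + (F (X w t t + 1) - F (X w t t)) + (F (X w t f - 1) - F (X w t f)).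
Proof.
move=> H; have Hf : f != t by apply: contra H => /eqP Hf; rewrite -{1}Hf /f linpartK.
rewrite /nn (bigD1 t) // (bigD1 f) //= [in RHS](bigD1 t) // [in RHS](bigD1 f) //=.
rewrite !X_step !eqxx /f !linpartK eqxx -/f (negbTE H) (negbTE Hf) /F.
rewrite (eq_bigr (fun l => (X w t l == 1)%N%:Z)); last first.
  move=> l /andP[l1 l2]; rewrite X_step (negbTE l1).
  have -> : (src w l == t) = false; last by congr ((_ == _) : nat)%:Z; lia.
  by apply: contraNF l2 => /eqP H2; rewrite /f -H2 srcK.
rewrite ?addr0 ?subr0; lia.
Qed.

Lemma cc_next b e : b != e -> cc b e b.+1 = 1 /\ cc b e e = 1.
Proof. rewrite -val_eqE /cc /=; lia. Qed.

Lemma sideE k l : (k <= 2 * N)%N -> sideB k l = ((l < k)%N == (rev_ord l < k)%N).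
Proof. by rewrite /sideB /=; have := ltn_ord l; lia. Qed.

Lemma inter_side b e k h l : b != e -> (k <= 2 * N)%N -> (h <= 2 * N)%N ->
  cc b e k = 1 -> cc b e h = 1 -> ~ inter b e l -> ~ inter b e (rev_ord l) ->
  sideB h l = sideB k l.
Proof.
move=> nbe Hk Hh ck ch n1 n2; rewrite !sideE //.
have := inter_const nbe Hk ck n1; have := inter_const nbe Hk ck n2.
have := inter_const nbe Hh ch n1; have := inter_const nbe Hh ch n2; lia.
Qed.

Lemma sideB_S h l : (h < 2 * N)%N -> l != h :> nat -> rev_ord l != h :> nat -> sideB h.+1 l = sideB h l.
Proof. by move=> Hh; rewrite !sideE ?(ltnW Hh) //= => *; lia. Qed.

(** If the interval met its mirror image, the mirror image of b or e would be interior, hence full,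
    and so by duality would be b or e. But w moves b, and a full e would make X nonzero at w(e) =
    e. *)
Lemma spinX_fill_side s w b e : spinX s w -> b != e -> e != rev_ord b ->
  (forall t, inter b e t -> full w t) -> src w b != b -> X w e (linpart w e) = 0 ->
  forall k, (k <= 2 * N)%N -> cc b e k = 1 -> cc b e (2 * N - k) = 0.
Proof.
move=> [Hw Hd _ _ _] nbe nre Hi Hb He k Hk Hc.
have [//|HK] := cc01 (2 * N - k) nbe.
have [H|H] : inter b e (rev_ord b) \/ inter b e (rev_ord e).
  move: Hc HK nbe nre; rewrite -!val_eqE /inter /cc /=.
  have := ltn_ord b; have := ltn_ord e; case: (leqP (2 * N - b) e) => H; [left|right];
    case: (ltnP e b) => /= He1; split; lia.
- have [/(congr1 (@rev_ord _)) H1 _] := Hi _ H.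
  by move: H1 Hb; rewrite src_rev // !rev_ordK => ->; rewrite eqxx.
have [H1 H2] := Hi _ H; have H3 : src w e = e.
  by move: H1; rewrite src_rev // => /rev_ord_inj.
move: He; have -> : linpart w e = e by rewrite -{1}H3 srcK.
rewrite X_triv //; have := Hd e; lia.
Qed.

Section NonSym.
Variables (s : nat) (w : affperm (2 * N)) (b e : 'I_(2 * N)).
Hypothesis Hsp : spinX s w.
Hypothesis nbe : b != e.
Hypothesis nre : e != rev_ord b.
Hypothesis Hi : forall t, inter b e t -> full w t.
Let f := linpart w b.
Let g := linpart w e.
Hypothesis Xbb : X w b b = -1.
Hypothesis Xbf : X w b f = 1.
Hypothesis Xeg : X w e g = 0.
Let m := nn w b.+1.
Hypothesis Hm : m < s%:Z.

Let Hw : Wext w. Proof. by case: Hsp. Qed.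
Let Hd : dualsum w 2. Proof. by case: Hsp. Qed.
Let Hb k l : (k <= 2 * N)%N -> -1 <= X w k l <= 1. Proof. by case: Hsp => _ _ H _ _; exact: H. Qed.
Let Hi1 t : inter b e t -> src w t = t. Proof. by case/Hi. Qed.
Let nbf : f != b. Proof. by apply/eqP => H; move: Xbf; rewrite H Xbb. Qed.
Let sb : src w b != b.
Proof. by apply: contra nbf => /eqP H; rewrite /f -{1}H srcK. Qed.
Let Hr : is_root b e.
Proof. by rewrite /is_root eq_sym nbe. Qed.
Let Hrfg : is_root f g. Proof. exact: is_root_linpart. Qed.
Let c0 k : (k <= 2 * N)%N -> cc b e k = 1 -> cc b e (2 * N - k) = 0.
Proof. exact: (spinX_fill_side Hsp nbe nre Hi sb Xeg). Qed.
Let Xc k l : (k <= 2 * N)%N -> cc b e k = 1 -> X w k l = X w b.+1 l.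
Proof. by move=> Hk Hc; exact: (X_const l nbe Hk Hc Hi1). Qed.
Let b1 : (b.+1 <= 2 * N)%N. Proof. by []. Qed.
Let e1 : (e <= 2 * N)%N. Proof. by rewrite ltnW. Qed.
Let Xkb k l : (k <= 2 * N)%N -> cc b e k = 1 -> X w k l = X w b l + (l == b)%N%:Z - (l == f)%N%:Z.
Proof.
move=> Hk Hc; rewrite Xc // X_step; congr (_ - (_ : nat)%:Z).
by rewrite /f -(can2_eq (srcK w) (linpartK w)).
Qed.
Let Xke k l : (k <= 2 * N)%N -> cc b e k = 1 -> X w e.+1 l = X w k l + (l == e)%N%:Z - (l == g)%N%:Z.
Proof.
move=> Hk Hc; rewrite (Xc l Hk Hc) -(Xc l e1 (cc_next nbe).2) X_step; congr (_ - (_ : nat)%:Z).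
by rewrite /g -(can2_eq (srcK w) (linpartK w)).
Qed.
Let Xf k : (k <= 2 * N)%N -> cc b e k = 1 -> X w k f = 0.
Proof. by move=> Hk Hc; rewrite Xkb // Xbf eqxx (negbTE nbf). Qed.
Let Xg k : (k <= 2 * N)%N -> cc b e k = 1 -> X w k g = 0.
Proof. by move=> Hk Hc; rewrite (Xc g Hk Hc) -(Xc g e1 (cc_next nbe).2). Qed.
Let Hn k : (k <= 2 * N)%N -> cc b e k = 1 -> nn w k = m.
Proof. by move=> Hk Hc; rewrite (@nn_const w b e). Qed.
Let nnb : nn w b = m + 1.
Proof. by have := nn_step sb; rewrite -/f -/m Xbb Xbf => ->; lia. Qed.

Let full_nz k t : inter b e t -> X w k t <> 0 /\ X w k (rev_ord t) <> 0.
Proof.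
case/Hi => Ht Htr; have H2 : src w (rev_ord t) = rev_ord t by rewrite src_rev // Ht.
by rewrite !X_triv //; have := Hd t; move: Htr; clear; lia.
Qed.

Let sd' k := X (pmove w b e) k =1 X (pmove w b e) (2 * N - k).

(** The mirror time is outside the interval, so if X is self-dual after the filling, then at 2N - k
    the entries f and g of w already had their filled values. *)
Let sd_cons k : (k <= 2 * N)%N -> cc b e k = 1 -> sd' k ->
  [/\ X w (2 * N - k) f = 1, X w (2 * N - k) g = -1 &
   forall l, l != f -> l != g -> l != rev_ord f -> l != rev_ord g ->
   X w (2 * N - k) l = X w k l /\ X (pmove w b e) k l = X w k l].
Proof.
move=> Hk Hc Hs; have Hk' : (2 * N - k <= 2 * N)%N by lia.
have E := root_eqF Hrfg; have Hc' := c0 Hk Hc.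
have Pk l := X_pmove Hsp Hr l Hk; have PK l := X_pmove Hsp Hr l Hk'.
split.
- by have := Hs f; rewrite Pk PK !eqxx Hc Hc' -/f Xf // => H; lia.
- by have := Hs g; rewrite Pk PK !eqxx Hc Hc' -/f -/g !E Xg // => H; lia.
move=> l l1 l2 l3 l4; have := Hs l.
by rewrite Pk PK -/f -/g (negbTE l1) (negbTE l2) (negbTE l3) (negbTE l4).
Qed.

(* At a time h next to the filled interval where the two modified coordinates are
   already +-1, the condition on self-dual vertices yields the zeros needed after filling. *)
Let zero_near k h (c : bool) : (k <= 2 * N)%N -> (h <= 2 * N)%N -> cc b e k = 1 -> sd' k ->
  ~~ (2 %| m + 1 - s%:Z)%Z -> nn w h = m + 1 ->
  (forall l, X w h l = X w k l + (l == f)%N%:Z - (l == g)%N%:Z) ->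
  (forall l, l != f -> l != g -> l != rev_ord f -> l != rev_ord g ->
     ~ inter b e l -> ~ inter b e (rev_ord l) -> sideB h l = c -> sideB k l = c) ->
  exists2 l, sideB k l = c & X (pmove w b e) k l = 0.
Proof.
move=> Hk Hh Hc Hs Hpar Hnn Hx Hside.
have [S1 S2 S3] := sd_cons Hk Hc Hs.
have E := root_eqF Hrfg.
have Dk l : X w k (rev_ord l) = - X w (2 * N - k) l by rewrite X_dual'.
have Vf : X w h f = 1 by rewrite Hx Xf // eqxx E.
have Vg : X w h g = -1 by rewrite Hx Xg // eqxx E.
have Vrf : X w h (rev_ord f) = -1 by rewrite Hx Dk S1 !E.
have Vrg : X w h (rev_ord g) = 1 by rewrite Hx Dk S2 !E.
have Hsd : X w h =1 X w (2 * N - h).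
  move=> l; rewrite -[RHS]opprK -X_dual' //.
  have [->|l1] := eqVneq l f; first by rewrite Vf Vrf.
  have [->|l2] := eqVneq l g; first by rewrite Vg Vrg.
  have [->|l3] := eqVneq l (rev_ord f); first by rewrite rev_ordK Vf Vrf.
  have [->|l4] := eqVneq l (rev_ord g); first by rewrite rev_ordK Vg Vrg.
  have [S4 _] := S3 l l1 l2 l3 l4.
  rewrite !Hx Dk S4 !(can2_eq rev_ordK rev_ordK) (negbTE l1) (negbTE l2) (negbTE l3) (negbTE l4).
  by rewrite ?addr0 ?subr0 opprK.
have [_ _ _ _ Hp] := Hsp.
have [|l Hl Zl] := Hp h Hh Hsd _ c; first by rewrite Hnn.
have l1 : l != f by apply/eqP => H; move: Zl; rewrite H Vf.
have l2 : l != g by apply/eqP => H; move: Zl; rewrite H Vg.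
have l3 : l != rev_ord f by apply/eqP => H; move: Zl; rewrite H Vrf.
have l4 : l != rev_ord g by apply/eqP => H; move: Zl; rewrite H Vrg.
have [_ S5] := S3 l l1 l2 l3 l4.
exists l; last by rewrite S5 -Zl Hx (negbTE l1) (negbTE l2) ?addr0 ?subr0.
apply: Hside => //.
  by move=> H; have [] := full_nz h H.
by move=> H; have [_] := full_nz h H; rewrite rev_ordK.
Qed.

(** The witnesses are b and e: exactly one of k and 2N - k is in the interval, which puts them on
    opposite sides, and X vanishes at both. Filling spoils them only if b = g or e = f; then X at
    time b, respectively e + 1, already has the filled values at f and g, and [zero_near]
    applies. *)
Let fill_par k (c : bool) : (k <= 2 * N)%N -> cc b e k = 1 -> sd' k ->
  ~~ (2 %| m + 1 - s%:Z)%Z -> (src w e = e \/ X w e e != -1) ->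
  exists2 l, sideB k l = c & X (pmove w b e) k l = 0.
Proof.
move=> Hk Hc Hs Hpar He.
have [S1 S2 S3] := sd_cons Hk Hc Hs.
have E := root_eqF Hrfg.
have Hc' := c0 Hk Hc.
have Hk' : (2 * N - k <= 2 * N)%N by lia.
have Pk l := X_pmove Hsp Hr l Hk.
have Sbe : sideB k b != sideB k e.
  by move: Hc Hc' nbe; rewrite -val_eqE /cc /sideB /=; lia.
have Z l : l != f -> l != g -> X w k l = 0 -> X (pmove w b e) k l = 0.
  move=> l1 l2 Zl; rewrite Pk -/f -/g (negbTE l1) (negbTE l2) Hc' ?subr0 ?addr0.
  by case: eqP => [<-//|_]; case: eqP => [<-//|_].
have Zb : X w k b = 0 by rewrite Xkb // Xbb eqxx eq_sym (negbTE nbf).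
have [cb|cb] := eqVneq (sideB k b) c.
  have [bg|bg] := eqVneq b g; last by exists b => //; apply: Z => //; rewrite eq_sym.
  apply: (@zero_near k b) => //.
    by rewrite ltnW.
    by move=> l; rewrite (Xkb l Hk Hc) -bg; ring.
  move=> l _ l2 _ l4 n1 n2 <-; rewrite -bg in l2 l4.
  rewrite -(sideB_S (h := b)) //; first exact: (inter_side nbe b1 Hk (cc_next nbe).1 Hc n1 n2).
  by move: l4; rewrite -!val_eqE /=; have := ltn_ord l; have := ltn_ord b; clear; lia.
have ce : sideB k e = c by move: Sbe cb; case: sideB; case: sideB; case: c.
have see : src w e != e.
  (* A fixed e equals g and has a constant entry, but this entry is 0 at e and -1 at 2N - k. *)
  apply/eqP => H; have Ee : e = g by rewrite /g -{2}H srcK.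
  have := X_triv e H; move=> H2.
  have : X w (2 * N - k) g = X w e g by rewrite -Ee !X_triv.
  by rewrite S2 Xeg.
have Xee : X w e e = 0.
  have He' : X w e e != -1 by case: He => // H; rewrite H eqxx in see.
  have := Hb e (ltn_ord e); rewrite X_step eqxx (negbTE see); have := Hb e e1.
  by move: He'; clear; lia.
have Ze : X w k e = 0 by rewrite (Xc e Hk Hc) -(Xc e e1 (cc_next nbe).2).
have eg : e != g by apply: contra see => /eqP H; rewrite {1}H /g linpartK.
have [ef|ef] := eqVneq e f; last by exists e => //; apply: Z.
have Xh l : X w e.+1 l = X w k l + (l == f)%N%:Z - (l == g)%N%:Z by rewrite (Xke l Hk Hc) ef.
apply: (@zero_near k e.+1) => //.
- have := nn_step see; rewrite -/g Xee Xeg (Hn e1 (cc_next nbe).2) => ->; rewrite /=; ring.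
move=> l l1 _ l3 _ n1 n2 <-; rewrite -ef in l1 l3.
rewrite (sideB_S (h := e)) //; first exact: (inter_side nbe e1 Hk (cc_next nbe).2 Hc n1 n2).
by move: l3; rewrite -!val_eqE /=; have := ltn_ord l; have := ltn_ord e; clear; lia.
Qed.

(** With p = [src w e], [X_neg] and [X_null] express the entries e and g at all times by the
    intervals (e, p] and (e, g]; the exchange runs over (e, p]. *)
Let exchange k : (k <= 2 * N)%N -> cc b e k = 1 -> sd' k ->
  ~~ (2 %| m + 1 - s%:Z)%Z -> src w e != e -> X w e e = -1 -> upmove s w.
Proof.
move=> Hk Hc Hs Hpar see Xee.
have [S1 S2 S3] := sd_cons Hk Hc Hs.
have Hc' := c0 Hk Hc.
have Hk' : (2 * N - k <= 2 * N)%N by rewrite leq_subr.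
pose p := src w e.
have ge : g != e by apply: contra see => /eqP H; rewrite -{1}H /g linpartK.
have Lp : linpart w p = e by rewrite srcK.
have sg : src w g = e by rewrite /g linpartK.
have Xe (t : nat) : (t <= 2 * N)%N -> X w t e = cc e p t - 1.
  by move=> Ht; apply: X_neg.
have Xg' (t : nat) : (t <= 2 * N)%N -> X w t g = - cc e g t.
  by move=> Ht; apply: X_null.
have np : p != e by [].
have CK : cc e g (2 * N - k) = 1.
  by have := Xg' _ Hk'; rewrite S2 => /eqP; rewrite eqr_opp => /eqP.
have Xke' : X w k e = -1 by rewrite (Xc e Hk Hc) -(Xc e e1 (cc_next nbe).2).
have ef : e != f by apply/eqP => H; move: Xke'; rewrite H Xf.
(* Unless e is dual to f, which means p = b^*, the filling leaves the entry e alone, so it is still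
   -1 at 2N - k. *)
have CP : cc e p (2 * N - k) = 0 \/ p = rev_ord b.
  have [erf|erf] := eqVneq e (rev_ord f).
    by right; rewrite /p erf src_rev // /f linpartK.
  have [erg|erg] := eqVneq e (rev_ord g).
    exfalso; have : X w k e = - X w (2 * N - k) g by rewrite {1}erg X_dual'.
    by rewrite S2 Xke'.
  left; have [] := S3 e ef _ erf erg; first by rewrite eq_sym.
  by rewrite Xe // Xke' => H _; move: H; clear; lia.
have ni l : src w l != l -> ~ inter b e l /\ ~ inter b e (rev_ord l).
  move=> Hl; split=> /Hi1 H; first by rewrite H eqxx in Hl.
  by move: H; rewrite src_rev // => /rev_ord_inj H; rewrite H eqxx in Hl.
have [ng1 ng2] : ~ inter b e g /\ ~ inter b e (rev_ord g) by apply: ni; rewrite sg eq_sym.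
have N0 (a d : 'I_(2 * N)) h : a != d -> cc a d h = 0 -> ~~ cyc a d h.
  by move=> nad; rewrite (ccE _ nad); case: cyc.
have N2 (a d : 'I_(2 * N)) h : a != d -> cc a d h = 1 -> cyc a d h.
  by move=> nad; rewrite (ccE _ nad); case: cyc.
have nep : e != p by rewrite eq_sym.
have neg : e != g by rewrite eq_sym.
have Cb := N2 _ _ _ nbe Hc; have Cb' := N0 _ _ _ nbe Hc'; have Cg := N2 _ _ _ neg CK.
have vbe : b <> e :> nat by apply/eqP; rewrite val_eqE.
have vge : g <> e :> nat by apply/eqP; rewrite val_eqE.
have vre : e <> ((2 * N).-1 - b)%N :> nat by rewrite rev_val; apply/eqP.
(* Both intervals start at e, and 2N - k lies in (e, g]; when it is not in (e, p], the latter is the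
   shorter one. *)
have F1 (t : nat) : (t <= 2 * N)%N -> cc e p t = 1 -> cc e g t = 1.
  move=> Ht; rewrite !ccE // => Hp; suff -> : cyc e g t by [].
  have {Hp} Hp : cyc e p t by move: Hp; case: cyc.
  case: CP => CP.
    apply: (@rk_cyc (2 * N) _ _ (2 * N - k)) => //.
    by apply: (@cyc_rk (2 * N) _ p) => //; exact: N0.
  apply: (@cyc_rev_sub (2 * N) b e g k t) => //.
    apply/andP => -[h1 h2]; apply: ng2; rewrite /inter !ccE //=.
    by move: h1 h2; rewrite rev_val -subSn //= subSS => -> ->.
  have -> : ((2 * N).-1 - b)%N = p by rewrite rev_val CP.
  by [].
have F2 (h : nat) : (h <= 2 * N)%N -> cc e p h = 1 -> cc e p (2 * N - h) = 0 ->
   cc e g (2 * N - h) = 0 -> cc b e (2 * N - h) = 1.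
  move=> Hh /(N2 _ _ _ nep) h1 /(N0 _ _ _ nep) h2 /(N0 _ _ _ neg) h3.
  rewrite ccE //; suff -> : cyc b e (2 * N - h) by [].
  have Hh' : (2 * N - h <= 2 * N)%N by rewrite leq_subr.
  have r2 : (rk (2 * N) e (2 * N - k) < rk (2 * N) e (2 * N - h))%N by apply: (cyc_rk (p := g)).
  case: CP => CP.
    apply: (@rk_mem (2 * N) b e k h) => //.
    by apply: (cyc_rk (p := p)) => //; exact: N0.
  have Ep : ((2 * N).-1 - b)%N = p by rewrite rev_val CP.
  by apply: (@cyc_rev_mem (2 * N) b e k h) => //; rewrite Ep.
have Hrp : is_root e p.
  rewrite /is_root np /=; apply/eqP => Hp.
  have Eg : g = rev_ord e by apply: (@src_inj _ w); rewrite sg src_rev // -/p Hp rev_ordK.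
  have := Xg' (2 * N - e)%N (leq_subr _ _); rewrite {1}Eg X_dual // Xee.
  by case: (cc01 (2 * N - e) neg) => ->.
have Hrge : is_root g e by rewrite /g -{2}Lp; apply: is_root_linpart.
have E := root_eqF Hrge.
have cpe : cc e p e = 0 by rewrite /cc ltnn addr0 subrr.
apply: (@exchange_up N s w e p Hsp Hrp e) => //; rewrite ?Lp -/g.
- by rewrite Xeg Xee cpe.
- by move=> h Hh ch; rewrite Xg' // F1 // Xe // ch.
move=> h Hh ch Hs' Hpar' c.
have Hh' : (2 * N - h <= 2 * N)%N by rewrite leq_subr.
have Ph l := X_pmove Hsp Hrp l Hh; have PH l := X_pmove Hsp Hrp l Hh'.
have Vg : X w h g = -1 by rewrite Xg' // F1.
have Ve : X w h e = 0 by rewrite Xe // ch.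
(* If the mirror time is exchanged too, w itself is self-dual at h, and its zeros stay or move to an
   entry on the same side. *)
have [cH|cH] := cc01 (2 * N - h) nep; last first.
  have Sd : X w h =1 X w (2 * N - h).
    move=> l; have := Hs' l; rewrite Ph PH subKn // Lp -/g ch cH.
    case: (l =P g) => [->|_]; first by move/addIr.
    case: (l =P e) => [->|_]; first by move/addIr.
    case: (l =P rev_ord g) => [->|_]; first by move/addIr.
    by case: (l =P rev_ord e) => [->|_]; first by move/addIr.
  have [_ _ _ _ Hp] := Hsp.
  have [l Hl Zl] := Hp h Hh Sd Hpar' c.
  have Zg : X (pmove w e p) h g = 0 by rewrite Ph -/g eqxx Vg ch.
  have Zrg : X (pmove w e p) h (rev_ord g) = 0.
    by rewrite Ph Lp -/g !E eqxx X_dual' // -Sd Vg cH.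
  have Sge : sideB h g = sideB h e.
    move: (Sd g); rewrite /X sg /sideB; clear; lia.
  have [le|le] := eqVneq l e; first by exists g => //; rewrite Sge -le.
  have [lre|lre] := eqVneq l (rev_ord e).
    by exists (rev_ord g) => //; rewrite sideB_rev // Sge -Hl lre sideB_rev.
  exists l => //; rewrite Ph Lp -/g (negbTE le) (negbTE lre).
  case: (l =P g) => [lg|_]; first by move: Zl; rewrite lg Vg.
  case: (l =P rev_ord g) => [lg|_ //]; by move: Zl; rewrite lg X_dual' // -Sd Vg.
(* By F2 the mirror time lies in (b, e], where [nn] is m; but m has the parity of s, since m + 1 has
   not. *)
exfalso; have := Hs' g; rewrite Ph PH -/g eqxx Vg ch cH.
rewrite Xg' // => /eqP; rewrite addr0 eq_sym oppr_eq0 => /eqP c3.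
have := Hn Hh' (F2 h Hh ch cH c3); rewrite nn_sym // => [Enn|l]; last exact: Hb.
by move: Hpar Hpar'; rewrite Enn; clear; lia.
Qed.

Lemma nonsym_fill : upmove s w.
Proof.
have fill : (~~ (2 %| m + 1 - s%:Z)%Z -> forall k, (k <= 2 * N)%N -> cc b e k = 1 -> sd' k ->
    forall c, exists2 l, sideB k l = c & X (pmove w b e) k l = 0) -> upmove s w.
  move=> H; apply: (fill_up Hsp Hr) => [k Hk Hc|k Hk Hc|k Hk Hc].
  - by split; [exact: Xf|exact: Xg].
  - by rewrite Hn // c0 // addr0; move: Hm; clear; lia.
  by rewrite Hn // c0 // addr0 => Hs Hpar; apply: H.
have [H|H] := boolP (2 %| m + 1 - s%:Z)%Z; first by apply: fill; rewrite H.
have [[k [Hk Hc Hs]]|Hno] := classic (exists k, [/\ (k <= 2 * N)%N, cc b e k = 1 & sd' k]); last first.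
  by apply: fill => _ k Hk Hc Hs; case: Hno; exists k.
have [He|He] := eqVneq (src w e) e.
  by apply: fill => _ k' Hk' Hc' Hs' c; apply: fill_par => //; left.
have [He'|He'] := eqVneq (X w e e) (-1); first exact: (exchange Hk).
by apply: fill => _ k' Hk' Hc' Hs' c; apply: fill_par => //; right.
Qed.

End NonSym.

Lemma nonsym s w b e : spinX s w -> b != e -> e != rev_ord b ->
  (forall t, inter b e t -> full w t) -> X w b b = -1 -> X w b (linpart w b) = 1 ->
  nn w b.+1 < s%:Z -> X w e (linpart w e) = 0 \/ X w e e = 0 -> upmove s w.
Proof.
move=> Hsp nbe nre Hi H1 H2 Hm [He|He]; first exact: (nonsym_fill Hsp nbe nre Hi).
have [Hw Hd Hb _ _] := Hsp.
apply: iw_upmove => //; apply: (nonsym_fill (spinX_iw Hsp) nbe nre) => //.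
- move=> t /Hi [Ht Htr]; have Lt : linpart w t = t by rewrite -{1}Ht srcK.
  rewrite /full src_iw Lt; split=> //.
  by rewrite trM tr_shift2 src_shift2 trV Lt; move: Htr; clear; lia.
1-3: by rewrite X_iw ?linpart_iw ?srcK ?H1 ?H2 ?He ?oppr0 ?opprK.
by rewrite nn_iw // => l; apply: Hb.
Qed.

End Fill.

(** In [symfill]: a time of the filled interval (b, d] that comes after the mirror image r of b has
    its own mirror image outside the interval. *)
Lemma cyc_three (n b d k : nat) (r := (n - b.+1)%N) (d' := (n - d.+1)%N) : (b < n)%N -> (d < n)%N -> (k <= n)%N ->
  b <> r -> d <> d' -> b <> d -> r <> d -> 
  ~~ (cyc b r d && cyc b r d.+1) -> ~~ (cyc r d d' && cyc r d d'.+1) -> ~~ (cyc b r d' && cyc b r d'.+1) ->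
  cyc r d k -> ~~ cyc b d (n - k)%N.
Proof.
rewrite /r /d'; move=> Hb Hd Hk H0 H00 H1 H2; rewrite /cyc.
case: (ltnP (n - b.+1)%N b) => H3; case: (ltnP d b) => H4; case: (ltnP d (n - b.+1)%N) => H5;
case: (ltnP (n - d.+1)%N b) => H6; case: (ltnP (n - d.+1)%N (n - b.+1)%N) => H7;
case: (ltnP (n - d.+1)%N d) => H8.
all: try (exfalso; lia).
all: lia.
Qed.

(** * Times at which n_k drops to its minimum *)

Section Up.
Variable N : nat.
Implicit Types (w u : affperm (2 * N)) (b d e f g i j l q t : 'I_(2 * N)) (k : nat).

(** Times 0 and N are always self-dual and one of A_k, B_k is empty there, so the required zeros
    cannot exist and the parity must be right. *)
Lemma parity_pole s w k : spinX s w -> k = 0 \/ k = N -> (2 %| nn w k - s%:Z)%Z.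
Proof.
case=> _ _ _ _ Hp [->|->]; apply/negPn/negP => Hpar.
  have [||l Hl _] := Hp 0%N _ _ Hpar false; [by []| |].
    by move=> l; rewrite /X subn0 !ltn_ord /=; ring.
  by move: Hl; rewrite /sideB subn0 ltn_ord.
have E : (2 * N - N = N)%N by rewrite mul2n -addnn addnK.
have [||l Hl _] := Hp N _ _ Hpar true; [by rewrite leq_pmull|by move=> l; rewrite E|].
by move: Hl; rewrite /sideB E eqxx.
Qed.

Lemma sum_absX w k : Wext w -> dualsum w 2 -> (forall l, -1 <= X w k l <= 1) ->
  \sum_l `|X w k l| = 2 * nn w k.
Proof.
move=> Hw Hd Hb; transitivity (2 * nn w k - \sum_l X w k l); last by rewrite sumX // subr0.
rewrite mulr_sumr -sumrB; apply: eq_bigr => l _; have := Hb l; clear; lia.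
Qed.

(** By [sum_absX] there are 2 [nn] nonzero entries, fewer than the 2N - 4 indices that remain. *)
Lemma zero_outside w k a1 a2 : Wext w -> dualsum w 2 -> (forall l, -1 <= X w k l <= 1) ->
  nn w k + 2 < N%:Z ->
  exists l, [/\ X w k l = 0, l != a1, l != rev_ord a1, l != a2 & l != rev_ord a2].
Proof.
move=> Hw Hd Hb Hn; apply: NNPP => Hno.
have S1 (a : 'I_(2 * N)) : \sum_l ((l == a) : nat)%:Z = 1.
  by rewrite (bigD1 a) //= eqxx big1 // => l /negbTE ->.
have : \sum_l `|X w k l| >= \sum_(l < 2 * N) (1 - (((l == a1) : nat)%:Z + ((l == rev_ord a1) : nat)%:Z
    + (((l == a2) : nat)%:Z + ((l == rev_ord a2) : nat)%:Z))).
  apply: ler_sum => l _.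
  have [H|H] := eqVneq (X w k l) 0; last by move: H; clear; lia.
  have [E|E1] := boolP (l == a1); first by move: (normr_ge0 (X w k l)); clear; lia.
  have [E|E2] := boolP (l == rev_ord a1); first by move: (normr_ge0 (X w k l)); clear; lia.
  have [E|E3] := boolP (l == a2); first by move: (normr_ge0 (X w k l)); clear; lia.
  have [E|E4] := boolP (l == rev_ord a2); first by move: (normr_ge0 (X w k l)); clear; lia.
  by case: Hno; exists l.
rewrite sum_absX // sumrB !big_split /= !S1 sumr_const card_ord.
by move: Hn; clear; lia.
Qed.

Definition fullb w t := (src w t == t) && (tr w t != 1).

Lemma fullP w t : reflect (full w t) (fullb w t).
Proof. by apply: (iffP andP) => [[/eqP ? ?]|[? ?]]; split=> //; apply/eqP. Qed.

Lemma full_rev w t : Wext w -> dualsum w 2 -> full w t -> full w (rev_ord t).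
Proof.
move=> Hw Hd [H1 H2]; split; first by rewrite src_rev // H1.
by have := Hd t; move: H2; clear; lia.
Qed.

Lemma full_X w k t : full w t -> X w k t != 0.
Proof. by case=> H1 H2; rewrite X_triv // subr_eq0. Qed.

(** The first non-full time met when going forward from b, with [off] counting the steps; the
    hypothesis provides a candidate other than b. *)
Lemma next_nonfull w b : ~ full w (rev_ord b) ->
  exists e, [/\ b != e, ~ full w e & forall t, inter b e t -> full w t].
Proof.
move=> Hb; pose off (t : 'I_(2 * N)) := if (b < t)%N then (t - b)%N else (t + 2 * N - b)%N.
pose P t := (b != t) && ~~ fullb w t.
have P0 : P (rev_ord b) by rewrite /P eq_sym rev_ord_neq /=; apply/fullP.
case: (@arg_minnP _ (rev_ord b) P off P0) => e /andP[nbe /fullP He] Hmin.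
exists e; split=> // t Hi; apply/fullP/negPn/negP => Ht.
have := Hmin t; rewrite /P Ht andbT => H.
have nbt : b != t by apply/eqP => E; move: Hi; rewrite -E /inter /cc; clear; lia.
have := H nbt; move: Hi nbt; rewrite -val_eqE /inter /cc /off /= ltnS; clear.
by have := ltn_ord b; have := ltn_ord e; have := ltn_ord t; case: (ltnP e b); case: (ltnP b t); case: (ltnP b e); lia.
Qed.

Lemma node_X w t : (forall k l, (k <= 2 * N)%N -> -1 <= X w k l <= 1) -> src w t != t ->
  (X w t t = -1 \/ X w t t = 0) /\ (X w t (linpart w t) = 0 \/ X w t (linpart w t) = 1).
Proof.
move=> Hb Ht; have t1 : (t <= 2 * N)%N by rewrite ltnW.
have Hf : linpart w t != t by apply: contra Ht => /eqP Hf; rewrite -{1}Hf linpartK.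
have := Hb t.+1 t (ltn_ord t); have := Hb t.+1 (linpart w t) (ltn_ord t).
rewrite !X_step !linpartK !eqxx (negbTE Ht) (negbTE Hf) /=.
have := Hb t t t1; have := Hb t (linpart w t) t1.
move: (X w t t) (X w t _) => x y; clear; split; lia.
Qed.

(** At a moved index the entries e and w(e) are -1 or 0 and 0 or 1; the only pair without a zero is
    (-1, 1), which becomes (0, 0). *)
Lemma nonfull_X w e : (forall k l, (k <= 2 * N)%N -> -1 <= X w k l <= 1) -> ~ full w e ->
  [\/ X w e (linpart w e) = 0, X w e e = 0 | nn w e.+1 = nn w e - 1].
Proof.
move=> Hb He; have [H|H] := eqVneq (src w e) e.
  have Le : linpart w e = e by rewrite -{1}H srcK.
  have [H2|H2] := eqVneq (tr w e) 1; last by case: He.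
  by constructor 1; rewrite Le X_triv // H2.
have := nn_step H; have [[->|->] [->|->]] := node_X Hb H; move=> E.
- by constructor 1.
- by constructor 3; rewrite E; move: (nn w e) => n; clear; lia.
- by constructor 1.
by constructor 2.
Qed.

Lemma drop_X w b : (forall k l, (k <= 2 * N)%N -> -1 <= X w k l <= 1) -> nn w b.+1 < nn w b ->
  [/\ src w b != b, X w b b = -1, X w b (linpart w b) = 1 & nn w b = nn w b.+1 + 1].
Proof.
move=> Hb Hn; have H : src w b != b by apply: contraTneq Hn => /nn_step0 ->; rewrite ltxx.
move: Hn; have := nn_step H; have [[->|->] [->|->]] := node_X Hb H; move=> /= -> /=;
 move: (nn w b) => n Hn; try (exfalso; move: Hn; clear; lia).
by split=> //; clear; lia.
Qed.

Lemma interN b e t : b != e -> ~ inter b e t -> ~~ (cyc b e t && cyc b e t.+1).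
Proof. by move=> nbe; rewrite /inter !ccE //; case: cyc => //=; case: cyc => // H; case: H. Qed.

Section SymFill.
Variables (s : nat) (w : affperm (2 * N)) (b d : 'I_(2 * N)).
Hypothesis Hsp : spinX s w.
Hypothesis Hib : forall t, inter b (rev_ord b) t -> full w t.
Hypothesis Hid : forall t, inter (rev_ord b) d t -> full w t.
Hypothesis nbd : b != d.
Hypothesis nrd : rev_ord b != d.
Hypothesis Nd : ~ full w d.
Hypothesis Xbb : X w b b = -1.
Hypothesis Xbf : X w b (linpart w b) = 1.
Hypothesis nbf : linpart w b != rev_ord b.
Hypothesis Xdg : X w d (linpart w d) = 0.
Hypothesis Hpar : (2 %| nn w b.+1 - s%:Z)%Z.
Hypothesis Hm : nn w b.+1 < s%:Z.

Lemma symfill : upmove s w.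
Proof.
set m := nn w b.+1; set f := linpart w b; set g := linpart w d.
have [Hw Hd Hb _ _] := Hsp.
have fb : f != b by apply/eqP => H; move: Xbf; rewrite -/f H Xbb.
have sb : src w b != b by apply: contra fb => /eqP H; rewrite /f -{1}H srcK.
have b1 : (b.+1 <= 2 * N)%N by [].
have rb1 : ((rev_ord b).+1 <= 2 * N)%N by [].
have rbE : (rev_ord b).+1 = (2 * N - b)%N by rewrite /= -subSn.
have nbr : b != rev_ord b by rewrite eq_sym rev_ord_neq.
have srb : src w (rev_ord b) != rev_ord b by rewrite src_rev // (inj_eq rev_ord_inj).
have Hmid k : (k <= 2 * N)%N -> cc b d k = 1 -> cc b (rev_ord b) k = 1 \/ cc (rev_ord b) d k = 1.
  have Hr2 : ~ inter b (rev_ord b) d by move/Hib.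
  move: nbd nrd nbr Hr2; rewrite -!val_eqE /inter /cc /=; have := ltn_ord b; have := ltn_ord d; clear.
  case: (ltnP d b); case: (ltnP (2 * N - b.+1) b); case: (ltnP d (2 * N - b.+1)) => H1 H2 H3; rewrite /=; lia.
have C1 k l : (k <= 2 * N)%N -> cc b (rev_ord b) k = 1 -> X w k l = X w b.+1 l.
  by move=> Hk Hc; apply: (X_const _ nbr Hk Hc) => t /Hib [].
have C2 k l : (k <= 2 * N)%N -> cc (rev_ord b) d k = 1 -> X w k l = X w (rev_ord b).+1 l.
  by move=> Hk Hc; apply: (X_const _ nrd Hk Hc) => t /Hid [].
have Crb l : X w (rev_ord b).+1 l = X w b.+1 l + (l == rev_ord b)%N%:Z - (src w l == rev_ord b)%N%:Z.
  rewrite X_step; congr (_ + _ - _); apply: C1; first by rewrite ltnW.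
  exact: (cc_next nbr).2.
have F1 : X w b.+1 f = 0 by rewrite X_step /f linpartK Xbf eqxx -/f (negbTE fb).
have F2 : X w (rev_ord b).+1 f = 0.
  by rewrite Crb F1 /f linpartK (negbTE nbf) (negbTE nbr).
have R1 : X w (rev_ord b).+1 (rev_ord b) = 1 by rewrite rbE X_dual ?Xbb // ltnW.
have G2 : X w (rev_ord b).+1 g = 0 by rewrite -(C2 d) ?(cc_next nrd).2 // ltnW.
have G1 : X w b.+1 g = 0.
  have ngr : g != rev_ord b by apply/eqP => H; move: G2; rewrite H R1.
  by have := Crb g; rewrite G2 {3}/g linpartK (negbTE ngr) [d == _]eq_sym (negbTE nrd) ?addr0 ?subr0.
have Hr : is_root b d by rewrite /is_root eq_sym nbd eq_sym.
have NN : nn w (rev_ord b).+1 = m + 1.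
  rewrite rbE nn_sym //; [|by rewrite ltnW|by move=> l; apply: Hb; rewrite ltnW].
  rewrite /m (nn_step sb) -/f Xbb Xbf; move: (nn w b) => n; clear; lia.
(* Up to b^* the mirror time is filled as well and [nn] is m; afterwards it is not and [nn] is m +
   1. Either way the result is m + 2, of the parity of s. *)
have Hn k : (k <= 2 * N)%N -> cc b d k = 1 -> nn w k + 1 + cc b d (2 * N - k) = m + 2.
  have Hr2 : ~ inter b (rev_ord b) d by move/Hib.
  have Hr3 : ~ inter (rev_ord b) d (rev_ord d).
    by move/Hid/(full_rev Hw Hd); rewrite rev_ordK.
  have Hr4 : ~ inter b (rev_ord b) (rev_ord d).
    by move/Hib/(full_rev Hw Hd); rewrite rev_ordK.
  move=> Hk Hc; have [c1|c2] := Hmid k Hk Hc.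
    rewrite (nn_const nbr Hk c1) => [|t /Hib [] //]; rewrite -/m.
    suff -> : cc b d (2 * N - k) = 1 by rewrite -addrA.
    move: nbd nrd nbr Hr2 c1; rewrite -!val_eqE /inter /cc /=; have := ltn_ord b; have := ltn_ord d; move: Hk; clear.
    case: (ltnP d b); case: (ltnP (2 * N - b.+1) b); case: (ltnP d (2 * N - b.+1)) => H1 H2 H3; rewrite /=; lia.
  rewrite (nn_const nrd Hk c2) => [|t /Hid [] //]; rewrite NN.
  suff -> : cc b d (2 * N - k) = 0 by rewrite addr0 -addrA.
  rewrite ccE //; rewrite ccE // in c2.
  have V (i j : 'I_(2 * N)) : i != j -> i <> j :> nat by move=> nij; apply/eqP.
  suff /negbTE -> : ~~ cyc b d (2 * N - k) by [].
  have ndr : d != rev_ord d by rewrite eq_sym rev_ord_neq.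
  have c2' : cyc (rev_ord b) d k by case: cyc c2.
  exact: (@cyc_three (2 * N) b d k (ltn_ord b) (ltn_ord d) Hk (V _ _ nbr) (V _ _ ndr)
    (V _ _ nbd) (V _ _ nrd) (interN nbr Hr2) (interN nrd Hr3) (interN nbr Hr4) c2').
apply: (fill_up Hsp Hr) => [k Hk Hc|k Hk Hc|k Hk Hc _]; rewrite ?Hn //.
- by have [c|c] := Hmid k Hk Hc; rewrite -/f -/g ?(C1 _ _ Hk c) ?(C2 _ _ Hk c).
- by move: Hpar Hm; rewrite /m; clear; lia.
by move: Hpar; rewrite /m; clear; lia.
Qed.

End SymFill.

Lemma interP b e t : b != e -> reflect (inter b e t) (cyc b e t && cyc b e t.+1).
Proof.
by move=> nbe; rewrite /inter !ccE //; case: cyc; case: cyc; constructor => //; case.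
Qed.

Lemma inter_two x y l : x != y -> l != x -> l != y -> inter x y l \/ inter y x l.
Proof.
move=> nxy n1 n2; have nyx : y != x by rewrite eq_sym.
have : (cyc x y l && cyc x y l.+1) || (cyc y x l && cyc y x l.+1).
  by move: nxy n1 n2; rewrite -!val_eqE /cyc /=; clear; case: (ltnP y x); case: (ltnP x y); lia.
by case/orP => /interP; auto.
Qed.

Lemma inter_split x y z l : x != y -> y != z -> x != z -> l != y ->
  inter x z l -> inter x y l \/ inter y z l.
Proof.
move=> nxy nyz nxz n1 /interP -/(_ nxz) H.
have : (cyc x y l && cyc x y l.+1) || (cyc y z l && cyc y z l.+1).
  move: nxy nyz nxz n1 H; rewrite -!val_eqE /cyc /=; clear.
  by case: (ltnP y x); case: (ltnP z y); case: (ltnP z x); lia.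
by case/orP => /interP; auto.
Qed.

Lemma inter_rev x y l : x != y -> inter x y l -> inter (rev_ord y) (rev_ord x) (rev_ord l).
Proof.
move=> nxy; rewrite /inter /cc /=; move: nxy; rewrite -val_eqE /=; clear.
by have := ltn_ord x; have := ltn_ord y; have := ltn_ord l; case: (ltnP y x) => H; split; lia.
Qed.

Lemma drop_not_rev s w b : spinX s w -> (forall t, inter b (rev_ord b) t -> full w t) ->
  X w b b = -1 -> ~~ (2 %| nn w b - s%:Z)%Z -> linpart w b != rev_ord b.
Proof.
move=> [Hw Hd _ _ Hp] Hi Xbb Hpar; apply/eqP => H.
have nbr : b != rev_ord b by rewrite eq_sym rev_ord_neq.
have Hb1 : (b <= 2 * N)%N by rewrite ltnW.
have s1 : src w (rev_ord b) = b by rewrite -H linpartK.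
have s2 : src w b = rev_ord b by rewrite -[b in LHS]rev_ordK src_rev // s1.
have rbE : (rev_ord b).+1 = (2 * N - b)%N by rewrite /= -subSn.
have Sd : X w b =1 X w (2 * N - b).
  move=> l; rewrite -rbE X_step (X_const l nbr _ (cc_next nbr).2); [|by rewrite ltnW|by move=> t /Hi []].
  have -> : (src w l == rev_ord b) = (l == b) by rewrite -{1}s2 (inj_eq (@src_inj _ w)).
  rewrite X_step; have -> : (src w l == b) = (l == rev_ord b) by rewrite -{1}s1 (inj_eq (@src_inj _ w)).
  by move: (l == b) (l == rev_ord b) (X w b l) => c1 c2 x; clear; lia.
have Xr : X w b (rev_ord b) = 1 by rewrite X_dual' // -Sd Xbb.
have [l Hl Zl] := Hp b Hb1 Sd Hpar (b < N)%N.
have l1 : l != b by apply/eqP => E; move: Zl; rewrite E Xbb.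
have l2 : l != rev_ord b by apply/eqP => E; move: Zl; rewrite E Xr.
have : inter b (rev_ord b) l.
  move: Hl l1 l2; rewrite -!val_eqE /inter /cc /sideB /=.
  have := ltn_ord b; have := ltn_ord l; clear; case: (ltnP b N) => H1; split; lia.
by move/Hi/(full_X b); rewrite Zl eqxx.
Qed.

Lemma full_iw w t : full (iw w) t <-> full w t.
Proof.
rewrite /full src_iw trM tr_shift2 src_shift2 trV; split=> -[H1 H2].
  by split; [rewrite -{1}H1 linpartK|move: H2; rewrite H1; clear; lia].
have H3 : linpart w t = t by rewrite -{1}H1 srcK.
by rewrite H3; split=> //; move: H2; clear; lia.
Qed.

Lemma symcase s w b d : spinX s w ->
  (forall t, inter b (rev_ord b) t -> full w t) -> (forall t, inter (rev_ord b) d t -> full w t) ->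
  b != d -> rev_ord b != d -> ~ full w d -> X w b b = -1 -> X w b (linpart w b) = 1 ->
  linpart w b != rev_ord b -> (2 %| nn w b.+1 - s%:Z)%Z -> nn w b.+1 < s%:Z ->
  X w d (linpart w d) = 0 \/ X w d d = 0 -> upmove s w.
Proof.
move=> Hsp Hib Hid nbd nrd Nd H1 H2 H3 Hpar Hm [H|H]; first exact: (symfill Hsp Hib Hid).
have [Hw Hd Hb _ _] := Hsp.
have nnE : nn (iw w) b.+1 = nn w b.+1 by rewrite nn_iw // => l; apply: Hb.
apply: iw_upmove => //; apply: (symfill (spinX_iw Hsp) _ _ nbd nrd); rewrite ?nnE //.
- by move=> t /Hib /full_iw.
- by move=> t /Hid /full_iw.
- by move/full_iw.
all: rewrite ?X_iw ?linpart_iw ?srcK ?H1 ?H2 ?H ?opprK ?oppr0 //.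
by apply: contra H3 => /eqP E; apply/eqP/(@src_inj _ w); rewrite linpartK src_rev // E rev_ordK.
Qed.

Lemma drop_up s w b : spinX s w -> (s < N)%N -> nn w b.+1 < nn w b ->
  (forall k, (k <= 2 * N)%N -> nn w b.+1 <= nn w k) -> upmove s w.
Proof.
move=> Hsp sN Hdrop Hmin; have [Hw Hd Hb Hn Hp] := Hsp.
have [sb Xbb Xbf nnb] := drop_X Hb Hdrop.
have [b1 b2] : (b <= 2 * N)%N /\ (b.+1 <= 2 * N)%N by rewrite ltnW.
have Nb : ~ full w b by case=> /eqP H _; rewrite H in sb.
have Nrb : ~ full w (rev_ord b) by move/(full_rev Hw Hd); rewrite rev_ordK.
have nbr : b != rev_ord b by rewrite eq_sym rev_ord_neq.
have Hm : nn w b.+1 < s%:Z by have := Hn b b1; rewrite nnb; clear; lia.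
have nodrop e : ~ full w e -> nn w e = nn w b.+1 -> X w e (linpart w e) = 0 \/ X w e e = 0.
  move=> He E; case: (nonfull_X Hb He) => [|| H]; [by left|by right|].
  by have := Hmin e.+1 (ltn_ord e); rewrite H E; clear; lia.
have [e [nbe He Hi]] := next_nonfull Nrb.
have Hi1 t : inter b e t -> src w t = t by case/Hi.
have nne : nn w e = nn w b.+1 by apply: (nn_const nbe _ (cc_next nbe).2 Hi1); rewrite ltnW.
have [Ee|nre] := eqVneq e (rev_ord b); last first.
  exact: (nonsym Hsp nbe nre Hi Xbb Xbf Hm (nodrop e He nne)).
rewrite {nbe nne Hi1 He}Ee in Hi.
have Hi1 t : inter b (rev_ord b) t -> src w t = t by case/Hi.
(* The interval (b, b^*] contains N if b < N, and 0 otherwise. *)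
have Hpar : (2 %| nn w b.+1 - s%:Z)%Z.
  have [k0 [Hk0 Hk1 Hk2]] : exists k, [/\ (k <= 2 * N)%N, k = 0 \/ k = N & cc b (rev_ord b) k = 1].
    have [H|H] := ltnP b N; [exists N|exists 0%N]; rewrite /cc /=; have := ltn_ord b; move: H; clear => *;
     split; try lia; by auto.
  by rewrite -(nn_const nbr Hk0 Hk2 Hi1); apply: parity_pole.
have nbf : linpart w b != rev_ord b.
  by apply: (drop_not_rev Hsp Hi Xbb); rewrite nnb; move: Hpar; clear; lia.
have Hm3 : nn w b.+1 + 2 < N%:Z by move: Hpar Hm sN; clear; lia.
have Hb1 l : -1 <= X w b.+1 l <= 1 by apply: Hb.
have nrr : ~ full w (rev_ord (rev_ord b)) by rewrite rev_ordK.
have [d [nrd Nd Hid]] := next_nonfull nrr.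
have nbd : b != d.
  apply/eqP => Ed; have [l [Zl l1 l2 _ _]] := zero_outside b b Hw Hd Hb1 Hm3.
  have : full w l by case: (inter_two nbr l1 l2) => [/Hi|]; rewrite ?{2}Ed; [|move/Hid].
  by move/(full_X b.+1); rewrite Zl eqxx.
have Hx : X w d (linpart w d) = 0 \/ X w d d = 0 -> upmove s w.
  exact: (symcase Hsp Hi Hid nbd nrd Nd Xbb Xbf nbf Hpar Hm).
case: (nonfull_X Hb Nd) => [H|H|Hdd]; [by apply: Hx; left|by apply: Hx; right|].
(* After b^* the value is m + 1, so d is another drop to the minimum, and the nonsymmetric case is
   tried from d. *)
have [sd' Xdd Xdf nnd] := @drop_X w d Hb ltac:(rewrite Hdd; clear; lia).
have nnd1 : nn w d.+1 = nn w b.+1.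
  have : nn w d = nn w (rev_ord b).+1.
    by apply: (nn_const nrd _ (cc_next nrd).2) => [|t /Hid []//]; rewrite ltnW.
  have -> : (rev_ord b).+1 = (2 * N - b)%N by rewrite /= -subSn.
  rewrite nn_sym // => [|l]; last exact: Hb.
  by rewrite Hdd nnb => ->; rewrite addrK.
have Nrd : ~ full w (rev_ord d) by move/(full_rev Hw Hd); rewrite rev_ordK.
have [e2 [nde He2 Hie]] := next_nonfull Nrd.
have nne2 : nn w e2 = nn w b.+1.
  by rewrite -nnd1; apply: (nn_const nde _ (cc_next nde).2) => [|t /Hie []//]; rewrite ltnW.
have Hmd : nn w d.+1 < s%:Z by rewrite nnd1.
have [Ee2|nre] := eqVneq e2 (rev_ord d); last first.
  exact: (nonsym Hsp nde nre Hie Xdd Xdf Hmd (nodrop e2 He2 nne2)).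
rewrite {nde nne2 He2}Ee2 in Hie.
(* Now every time other than b, d and their mirror images is full, which a zero entry at another
   index contradicts. *)
have [l [Zl l1 l2 l3 l4]] := zero_outside b d Hw Hd Hb1 Hm3.
have nbrd : b != rev_ord d by apply: contra nrd => /eqP ->; rewrite rev_ordK.
suff : full w l by move/(full_X b.+1); rewrite Zl eqxx.
case: (inter_two nbd l1 l3) => [H|H].
  by case: (inter_split nbr nrd nbd l2 H) => [/Hi|/Hid].
have ndr : d != rev_ord d by rewrite eq_sym rev_ord_neq.
rewrite eq_sym in nbd; rewrite eq_sym in nbrd.
case: (inter_split ndr nbrd nbd l4 H) => [/Hie //|/(inter_rev nbrd)]; rewrite rev_ordK => /Hid.
by move/(full_rev Hw Hd); rewrite rev_ordK.
Qed.

End Up.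

(** * Constant n_k and existence of an upward move *)

Section Const.
Variable N : nat.
Implicit Types (w u : affperm (2 * N)) (b d e f g i j l q t : 'I_(2 * N)) (k : nat).

Lemma cyc_total e p g : e != p -> e != g ->
  (forall k, cc e p k = 1 -> cc e g k = 1) \/ (forall k, cc e p k = 0 -> cc e g k = 0).
Proof.
rewrite -!val_eqE /cc /=; clear; case: (ltnP p e) => H1; case: (ltnP g e) => H2; case: (leqP p g) => H3 n1 n2;
  first [by left=> k; lia | by right=> k; lia].
Qed.

(** The intervals (e, p] and (e, g] are nested. Exchange over (e, p] if it is the smaller one, and
    over its complement, which then avoids both, otherwise. *)
Lemma exchange_const s w e : spinX s w -> (forall k, (k <= 2 * N)%N -> (2 %| nn w k - s%:Z)%Z) ->
  src w e != e -> X w e e = -1 -> X w e (linpart w e) = 0 -> upmove s w.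
Proof.
move=> Hsp Hpar see Xee Xeg; have [Hw Hd Hb _ _] := Hsp.
pose p := src w e; pose g := linpart w e.
have Lp : linpart w p = e by rewrite srcK.
have sg : src w g = e by rewrite /g linpartK.
have nge : g != e by apply: contra see => /eqP H; rewrite -{1}H /g linpartK.
have nep : e != p by rewrite eq_sym.
have npe : p != e by [].
have neg : e != g by rewrite eq_sym.
have Xe (k : nat) : (k <= 2 * N)%N -> X w k e = cc e p k - 1 by move=> Hk; apply: X_neg.
have Xg (k : nat) : (k <= 2 * N)%N -> X w k g = - cc e g k by move=> Hk; apply: X_null.
have Hrp : is_root e p.
  rewrite /is_root npe /=; apply/eqP => Hp.
  have Eg : g = rev_ord e by apply: (@src_inj _ w); rewrite sg src_rev // -/p Hp rev_ordK.
  have := Xg (2 * N - e)%N (leq_subr _ _); rewrite {1}Eg X_dual ?(ltnW (ltn_ord e)) // Xee.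
  by case: (cc01 (2 * N - e) neg) => ->.
have Hpr : is_root p e.
  by case/andP: (Hrp) => _ H; rewrite /is_root nep; apply: contra H => /eqP ->; rewrite rev_ordK.
have ccC (k : nat) : cc p e k = 1 - cc e p k.
  by move: nep; rewrite -val_eqE /cc /=; clear; lia.
have [H|H] := cyc_total nep neg.
  apply: (@exchange_up _ s w e p Hsp Hrp e); rewrite ?Lp -/g.
  - by rewrite ltnW.
  - by rewrite Xeg Xee /cc ltnn addr0 subrr.
  - by move=> k Hk Hc; rewrite Xe // Xg // H // Hc.
  by move=> k Hk _ _; rewrite Hpar.
have H0 : cc e g e.+1 = 1 by case: (cc_next neg).
have H1 : cc e p e.+1 = 1 by case: (cc_next nep).
apply: (@exchange_up _ s w p e Hsp Hpr e.+1); rewrite ?Lp -/g //.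
- by rewrite Xe // Xg // ccC H0 H1.
- move=> k Hk; rewrite ccC => Hc; have c0 : cc e p k = 0 by move: Hc; clear; lia.
  by rewrite Xe // Xg // c0 H.
by move=> k Hk _ _; rewrite Hpar.
Qed.

Lemma const_up s w : spinX s w -> (s < N)%N -> (forall k, (k <= 2 * N)%N -> nn w k = nn w 0) ->
  (forall t, src w t = t) /\ nn w 0 = s%:Z \/ upmove s w.
Proof.
move=> Hsp sN Hc; have [Hw Hd Hb Hn Hp] := Hsp.
have Hpar k : (k <= 2 * N)%N -> (2 %| nn w k - s%:Z)%Z.
  by move=> Hk; rewrite Hc //; apply: parity_pole => //; left.
have Hst e : nn w e.+1 = nn w e by rewrite !Hc // ltnW.
have Hnode e : src w e != e -> ~ upmove s w -> X w e e = 0 /\ X w e (linpart w e) = 1.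
  move=> He Hno; have := nn_step He; rewrite Hst.
  have [[Ee|Ee] [Eg|Eg]] := node_X Hb He; rewrite Ee Eg => /=; move: (nn w e) => n En; try by (exfalso; move: En; clear; lia).
    by case: Hno; apply: (exchange_const Hsp Hpar He).
  by [].
have [Hu|Hno] := classic (upmove s w); first by right.
(* Without exchanges the entry t is 0 at each moved time t. Applied to t^*, duality gives 0 at time
   t + 1, where it has become 1. *)
left; have Hall t : src w t = t.
  apply/eqP/negPn/negP => Ht; have [Xt _] := Hnode t Ht Hno.
  have Ht' : src w (rev_ord t) != rev_ord t by rewrite src_rev // (inj_eq rev_ord_inj).
  have [Xr _] := Hnode _ Ht' Hno; move: Xr.
  rewrite X_dual' ?leq_subr //.
  have -> : (2 * N - rev_ord t)%N = t.+1 by rewrite /= subKn.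
  by rewrite X_step Xt eqxx (negbTE Ht).
split=> //; apply: NNPP => Hs; apply: Hno.
have Hb0 l : -1 <= X w 0 l <= 1 by apply: Hb.
have Hm : nn w 0 + 2 <= s%:Z by have := Hpar 0%N isT; have := Hn 0%N isT; move: Hs; clear; lia.
have Hm3 : nn w 0 + 2 < N%:Z by move: Hm sN; clear; lia.
have H0 : (0 < 2 * N)%N by move: sN; clear; lia.
pose i0 := Ordinal H0.
have [b [Zb _ _ _ _]] := zero_outside i0 i0 Hw Hd Hb0 Hm3.
have [e [Ze e1 e2 _ _]] := zero_outside b b Hw Hd Hb0 Hm3.
have Lt t : linpart w t = t by rewrite -{1}(Hall t) srcK.
have Xk k l : X w k l = X w 0 l by rewrite !X_triv.
have Hr : is_root b e by rewrite /is_root e1 e2.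
apply: (fill_up Hsp Hr) => [k Hk _|k Hk _|k Hk ck Hsd Hpar'].
- by rewrite !Lt !Xk Zb Ze.
- have nbe : b != e by rewrite eq_sym.
  have [->|->] := cc01 (2 * N - k) nbe; rewrite Hc //; move: Hm; clear; lia.
have nbe : b != e by rewrite eq_sym.
exfalso; have [c0|c1] := cc01 (2 * N - k) nbe; last first.
  by move: Hpar' (Hpar k Hk); rewrite c1 -addrA; clear; lia.
have := Hsd b; rewrite (X_pmove Hsp Hr) // (X_pmove Hsp Hr) ?leq_subr //.
by rewrite Lt !eqxx !Xk Zb ck c0.
Qed.

Lemma up_exists s w : spinX s w -> (s < N)%N ->
  (forall t, src w t = t) /\ nn w 0 = s%:Z \/ upmove s w.
Proof.
move=> Hsp sN.
have [Hc|Hc] := classic (forall k, (k <= 2 * N)%N -> nn w k = nn w 0); first exact: const_up.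
right; have [b Hdrop Hmin] : exists2 b : 'I_(2 * N), nn w b.+1 < nn w b &
   forall k, (k <= 2 * N)%N -> nn w b.+1 <= nn w k.
  have nn_per : nn w (2 * N) = nn w 0.
    apply: eq_bigr => l _; congr ((_ == _) : nat)%:Z.
    by rewrite /X !ltn_ord /=; ring.
  pose m := nn w [arg min_(k < ord0 : 'I_(2 * N).+1) `|nn w k|%N].
  have nn0 k : 0 <= nn w k by apply: sumr_ge0.
  have Hmin k : (k <= 2 * N)%N -> m <= nn w k.
    rewrite -ltnS => Hk; rewrite /m; case: arg_minnP => // j _ Hj.
    have := Hj (Ordinal Hk) isT; have := nn0 j; have := nn0 k; rewrite /=; clear; lia.
  have [b Hb1 Hb2] : exists2 b : 'I_(2 * N), nn w b.+1 = m & nn w b <> m.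
    apply: NNPP => Hno; apply: Hc.
    have down k : (k <= 2 * N)%N -> nn w k = m -> nn w 0 = m.
      elim: k => // k IH Hk Ek; apply: IH; first by rewrite ltnW.
      by apply: NNPP => H; apply: Hno; exists (Ordinal Hk).
    have m0 : nn w 0 = m by apply: (down _ _ (erefl : nn w _ = m)); rewrite -ltnS.
    move=> k Hk; rewrite m0.
    have up (j : nat) : (j <= 2 * N)%N -> nn w (2 * N - j) = m.
      elim: j => [|j IH] Hj; first by rewrite subn0 nn_per.
      have Hj' : (2 * N - j.+1 < 2 * N)%N by move: Hj; clear; lia.
      apply: NNPP => H; apply: Hno; exists (Ordinal Hj') => //=.
      by rewrite -subSn // subSS IH // ltnW.
    by rewrite -(subKn Hk) up ?leq_subr.
  exists b; last by move=> k Hk; rewrite Hb1 Hmin.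
  by have := Hmin b (ltnW (ltn_ord b)); rewrite Hb1; move: Hb2; clear; lia.
exact: (drop_up Hsp sN Hdrop Hmin).
Qed.

End Const.

(** * The base alcove and its walls *)

Section Alcove.
Local Open Scope classical_set_scope.
Local Open Scope ring_scope.
Variable N : nat.
Hypothesis N1 : (1 < N)%N.

(** Stated over a general ordered ring to serve both real points and the integer vectors [pt w]. *)
Lemma chain_alcove (T : realDomainType) (x : 'I_(2 * N) -> T) (c M : T) :
  (forall i, x i + x (rev_ord i) = c) ->
  (forall i j : 'I_(2 * N), (i < j <= N)%N -> i != N.-1 :> nat -> x i < x j) ->
  (forall i j : 'I_(2 * N), i = (2 * N).-1 :> nat -> (0 < j <= N)%N -> x i - M < x j) ->
  forall i j : 'I_(2 * N), (i < j)%N -> j != rev_ord i -> 0 < x j - x i < M.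
Proof.
move=> Hc H1 H2.
have pN1 : (N.-1 < 2 * N)%N by lia.
have pN : (N < 2 * N)%N by lia.
have pl : ((2 * N).-1 < 2 * N)%N by lia.
pose a := Ordinal pN1; pose b := Ordinal pN; pose z := Ordinal pl.
have ab : x a + x b = c.
  by rewrite -(Hc a); congr (_ + x _); apply: val_inj => /=; lia.
have pos (i j : 'I_(2 * N)) : (i < j)%N -> j != rev_ord i -> x i < x j.
  rewrite -val_eqE /= => Hij Hr; have Hi := ltn_ord i; have Hj := ltn_ord j.
  case: (leqP j N) => HjN; first by apply: H1; lia.
  case: (leqP N i) => HiN.
    have : x (rev_ord j) < x (rev_ord i) by apply: H1 => /=; lia.
    by have := Hc i; have := Hc j; lra.
  have E1 : x (rev_ord j) < x b by apply: H1 => /=; lia.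
  case: (eqVneq (i : nat) N.-1) => Hi1.
    have -> : i = a by apply: val_inj.
    by have := Hc j; lra.
  have E2 : x i < x a by apply: H1 => /=; lia.
  by have := Hc j; lra.
have up (i : 'I_(2 * N)) : (0 < i)%N -> x z - x i < M.
  move=> i0; have Hi := ltn_ord i; case: (leqP i N) => HiN.
    by have /= := H2 z i (erefl _); rewrite i0 HiN => /(_ isT); lra.
  have : x b < x i by apply: pos => //; rewrite -val_eqE /=; lia.
  by have /= := H2 z b (erefl _); rewrite leqnn andbT => /(_ (ltnW N1)); lra.
move=> i j Hij Hr; apply/andP; split; first by have := pos i j Hij Hr; lra.
have Hi := ltn_ord i; have Hj := ltn_ord j.
case: (posnP i) => i0.
  have zi : rev_ord z = i by apply: val_inj => /=; lia.
  have : x z - x (rev_ord j) < M.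
    apply: up; move: Hr; rewrite -val_eqE /=; lia.
  by have := Hc j; have := Hc z; rewrite zi; lra.
have : x j <= x z.
  have [jz|jz] := eqVneq j z; first by rewrite jz.
  by apply/ltW/pos; rewrite -?val_eqE /=; move: jz; rewrite -val_eqE /=; lia.
by have := up i i0; lra.
Qed.

Variable R : realType.

Lemma alcoveP (x : 'rV[R]_(2 * N)) : alcove R N x <-> in_Xstar x /\
  forall i j : 'I_(2 * N), (i < j)%N -> j != rev_ord i -> 0 < x 0 j - x 0 i < 1.
Proof.
split=> [[Hx H1 H2]|[Hx H]].
  split=> // i j; apply: (@chain_alcove _ (fun i => x 0 i) (x 0 i + x 0 (rev_ord i))) => //.
  by move=> l; apply/eqP; move: Hx => /forallP/(_ l)/forallP/(_ i).
split=> // i j.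
  move=> Hij Hi; have := H i j; rewrite -val_eqE /=.
  have -> : (i < j)%N by case/andP: Hij.
  move=> /(_ isT) H'; have /H'/andP[] : (j : nat) != (2 * N - i.+1)%N by lia.
  lra.
move=> Hi Hj; have := H j i; rewrite -val_eqE /= => H'.
have /H'{H'}H' : (j < i)%N by lia.
have /H'/andP[] : (i : nat) != (2 * N - j.+1)%N by lia.
lra.
Qed.

Definition aR : 'rV[R]_(2 * N) := \row_i ((base i)%:~R / (4 * N)%N%:R).

Lemma M_gt0 : (0 : R) < (4 * N)%N%:R.
Proof. by rewrite ltr0n; lia. Qed.

Lemma act_aR (w : affperm (2 * N)) i :
  Defs.act w aR 0 i = (pt w i)%:~R / (4 * N)%N%:R.
Proof.
rewrite !mxE -!/(tr w i) -!/(src w i) /pt; move: (base _) (tr w i) => b t.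
rewrite intrD intrM mulrDl; congr (_ + _).
have := M_gt0; move: ((4 * N)%N) => m m0.
by rewrite -pmulrn [RHS]mulrAC mulfV ?mul1r // lt0r_neq0.
Qed.

Lemma in_Xstar_act (w : affperm (2 * N)) (x : 'rV[R]_(2 * N)) :
  Wext w -> in_Xstar x -> in_Xstar (Defs.act w x).
Proof.
move=> Hw Hx; have [[c Hc] _ _] := Hw.
apply/forallP => i; apply/forallP => j; apply/eqP; rewrite !mxE -!/(tr w _) -!/(src w _).
rewrite !(src_rev Hw).
have : x 0 (src w i) + x 0 (rev_ord (src w i)) = x 0 (src w j) + x 0 (rev_ord (src w j)).
  by apply/eqP; move: Hx => /forallP/(_ (src w i))/forallP/(_ (src w j)).
have : (tr w i)%:~R + (tr w (rev_ord i))%:~R = (tr w j)%:~R + (tr w (rev_ord j))%:~R :> R.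
  by rewrite -!rmorphD /= !Hc.
lra.
Qed.

Lemma aR_Xstar : in_Xstar aR.
Proof.
apply/forallP => i; apply/forallP => j; apply/eqP; rewrite !mxE !base_rev !rmorphN; lra.
Qed.

Lemma act_aR_alcove (w : affperm (2 * N)) : Wext w ->
  alcove R N (Defs.act w aR) <-> in_alc w.
Proof.
move=> Hw.
have E (i j : 'I_(2 * N)) : (0 < Defs.act w aR 0 j - Defs.act w aR 0 i < 1) =
    (0 < pt w j - pt w i < (4 * N)%N%:Z).
  rewrite !act_aR -mulrBl -rmorphB /= ltr_pdivrMr ?M_gt0 // mul1r.
  by rewrite pmulr_lgt0 ?invr_gt0 ?M_gt0 // ltr0z [((4 * N)%N%:R : R)]pmulrn ltr_int.
split; first by case/alcoveP => _ H i j Hij Hr; rewrite -E; apply: H.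
move=> H; apply/alcoveP; split; first exact: in_Xstar_act aR_Xstar.
by move=> i j Hij Hr; rewrite E; apply: H.
Qed.

Lemma in_alc1 : in_alc (1%g : affperm (2 * N)).
Proof.
move=> i j Hij; rewrite -val_eqE /= !pt1 /base => H.
by have := ltn_ord i; have := ltn_ord j; lia.
Qed.

Lemma aR_alcove : alcove R N aR.
Proof.
have := act_aR_alcove (Wext1 N); have -> : Defs.act 1%g aR = aR.
  by apply/rowP => i; rewrite act_aR pt1 mxE.
by move=> H; apply/H/in_alc1.
Qed.

Lemma alcove_side (x y : 'rV[R]_(2 * N)) i j (d : int) : is_root i j ->
  alcove R N x -> alcove R N y ->
  (0 < x 0 i - x 0 j - d%:~R) = (0 < y 0 i - y 0 j - d%:~R).
Proof.
move=> Hr /alcoveP[_ Hx] /alcoveP[_ Hy].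
have [n1 n2] := andP Hr.
have n3 : i != rev_ord j by rewrite eq_sym (root_eqF Hr).
have D : [\/ (d%:~R <= -1 :> R), d%:~R = 0 :> R | 1 <= d%:~R :> R].
  have [H|[H|H]] : d <= -1 \/ d = 0 \/ 1 <= d by lia.
  - by constructor 1; rewrite -[-1]/((-1)%:~R) ler_int.
  - by constructor 2; rewrite H.
  - by constructor 3; rewrite -[1]/((1)%:~R) ler_int.
case: (ltngtP i j) => [Hij|Hij|/val_inj Hij]; last by rewrite Hij eqxx in n1.
  by have /andP[] := Hx i j Hij n2; have /andP[] := Hy i j Hij n2; case: D; lra.
by have /andP[] := Hx j i Hij n3; have /andP[] := Hy j i Hij n3; case: D; lra.
Qed.

(** On the apartment x_i - x_j = x_{j^*} - x_{i^*}; these are the four triples describing one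
    hyperplane. *)
Definition eqroot (i j : 'I_(2 * N)) (d : int) i' j' d' :=
  [\/ [/\ i' = i, j' = j & d' = d], [/\ i' = j, j' = i & d' = - d],
      [/\ i' = rev_ord j, j' = rev_ord i & d' = d]
   |  [/\ i' = rev_ord i, j' = rev_ord j & d' = - d]].

Lemma eqroot_refl i j d i' j' d' : is_root i j -> eqroot i j d i' j' d' ->
  root_reflection i' j' d' = root_reflection i j d.
Proof.
move=> Hr H.
have Hr' : is_root i' j'.
  have E := root_eqF Hr.
  by case: H => [[-> -> _]|[-> -> _]|[-> -> _]|[-> -> _]]; rewrite /is_root ?rev_ordK !E.
have E := root_eqF Hr.
apply: affperm_eqP => l; [rewrite !tr_refl //|rewrite !src_refl //].
  case: H => [[-> -> ->]|[-> -> ->]|[-> -> ->]|[-> -> ->]] //; rewrite ?rev_ordK ?opprK;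
  case: (l =P i) => [Hl1|_]; rewrite ?Hl1 ?E ?eqxx //;
  case: (l =P j) => [Hl2|_]; rewrite ?Hl2 ?E ?eqxx //;
  case: (l =P rev_ord i) => [Hl3|_]; rewrite ?Hl3 ?E ?eqxx //.
case: H => [[-> -> _]|[-> -> _]|[-> -> _]|[-> -> _]] //; rewrite ?rev_ordK;
  case: (l =P i) => [Hl1|_]; rewrite ?Hl1 ?E ?eqxx //;
  case: (l =P j) => [Hl2|_]; rewrite ?Hl2 ?E ?eqxx //;
  case: (l =P rev_ord i) => [Hl3|_]; rewrite ?Hl3 ?E ?eqxx //.
Qed.

Lemma eqroot_hyp i j d i' j' d' : is_root i j -> eqroot i j d i' j' d' ->
  root_hyperplane R i' j' d' = root_hyperplane R i j d.
Proof.
move=> Hr H.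
have S (x : 'rV[R]_(2 * N)) : in_Xstar x ->
   x 0 i + x 0 (rev_ord i) = x 0 j + x 0 (rev_ord j).
  by move=> /forallP/(_ i)/forallP/(_ j)/eqP.
case: H => [[-> -> ->]|[-> -> ->]|[-> -> ->]|[-> -> ->]] //.
all: apply/seteqP; split => x [Hx Hd]; split => //; have := S x Hx; move: Hd; rewrite ?rmorphN; lra.
Qed.

(** The test points are p0 + y with p0 half the translation part of the reflection, a point of the
    first hyperplane, and y parallel to it: y = e_l - e_{l^*} confines i' and j' to the four
    indices, and y = e_i + e_j - e_{i^*} - e_{j^*} pairs them up. *)
Lemma hyp_eqroot i j d i' j' d' : is_root i j -> is_root i' j' ->
  root_hyperplane R i j d = root_hyperplane R i' j' d' -> eqroot i j d i' j' d'.
Proof.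
move=> Hr Hr' HH; have E := root_eqF Hr; have E' := root_eqF Hr'.
pose p0 : 'rV[R]_(2 * N) := \row_l ((tr (root_reflection i j d) l)%:~R / 2).
have X0 (y : 'I_(2 * N) -> R) : (forall l, y l + y (rev_ord l) = 0) ->
    in_Xstar (\row_l y l).
  by move=> H; apply/forallP => a; apply/forallP => b; rewrite !mxE !H.
have Xd (y : 'I_(2 * N) -> R) : (forall l, y l + y (rev_ord l) = 0) -> y i = y j ->
    y i' - y j' + (p0 0 i' - p0 0 j') = d'%:~R.
  move=> H1 H2.
  suff : root_hyperplane R i j d (\row_l (p0 0 l + y l)).
    by rewrite HH => -[_]; rewrite !mxE; lra.
  split.
    apply: X0 => l; rewrite !mxE addrACA H1 addr0 -mulrDl -rmorphD /=.
    by rewrite (dualsum_refl d Hr) mul0r.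
  by rewrite !mxE !tr_refl // !eqxx !E H2 rmorphN; lra.
have Z : p0 0 i' - p0 0 j' = d'%:~R.
  by have := Xd (fun=> 0); rewrite !addr0 => /(_ (fun=> erefl) erefl); rewrite subrr add0r.
have Y (y : 'I_(2 * N) -> R) : (forall l, y l + y (rev_ord l) = 0) -> y i = y j -> y i' = y j'.
  by move=> H1 H2; have := Xd y H1 H2; rewrite Z; lra.
have L (l : 'I_(2 * N)) : l != i -> l != j -> l != rev_ord i -> l != rev_ord j -> l != i' /\ l != j'.
  move=> l1 l2 l3 l4.
  have H := Y (fun k => (k == l)%:R - (k == rev_ord l)%:R).
  have {}H : (i' == l)%:R - (i' == rev_ord l)%:R = (j' == l)%:R - (j' == rev_ord l)%:R :> R.
    apply: H => [k|].
      rewrite (can2_eq rev_ordK rev_ordK) (inj_eq rev_ord_inj); lra.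
    rewrite eq_sym (negbTE l1) [j == l]eq_sym (negbTE l2).
    by rewrite -[i == _](inj_eq rev_ord_inj) -[j == _](inj_eq rev_ord_inj) rev_ordK ![rev_ord _ == l]eq_sym (negbTE l3) (negbTE l4).
  by split; apply/eqP => HE; move: H; rewrite HE !eqxx !E' ?mulr0n ?mulr1n; lra.
pose y (k : 'I_(2 * N)) : int := (k == i)%N%:Z + (k == j)%N%:Z - (k == rev_ord i)%N%:Z - (k == rev_ord j)%N%:Z.
have H : y i' = y j'.
  apply: (@intr_inj R); apply: (Y (fun k => (y k)%:~R)) => [k|].
    by rewrite -rmorphD /= -[RHS]/(0%:~R); congr intmul; rewrite /y !(can2_eq rev_ordK rev_ordK) !rev_ordK; lia.
  by congr intmul; rewrite /y !eqxx !E.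
have Li k : k = i' \/ k = j' -> [\/ k = i, k = j, k = rev_ord i | k = rev_ord j].
  move=> Hk; apply: contrapT => Hn.
  have [||||H1 H2] := L k; try by apply/eqP => Hk'; apply: Hn; first [by constructor 1|by constructor 2|by constructor 3|by constructor 4].
  by case: Hk => Hk; [move: H1|move: H2]; rewrite Hk eqxx.
have Hi := Li i' (or_introl erefl); have Hj := Li j' (or_intror erefl).
have {}Z : tr (root_reflection i j d) i' - tr (root_reflection i j d) j' = 2 * d'.
  by apply: (@intr_inj R); rewrite rmorphB rmorphM /=; move: Z; rewrite /p0 !mxE; lra.
move: Z H Hr'; rewrite /y /is_root !tr_refl // {y}.
clear HH E' Y Xd X0 L Li p0.
case: Hi => ->; case: Hj => ->; rewrite ?rev_ordK ?eqxx ?E ?andbF // => Hd H' _;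
  try (by exfalso; lia).
- by constructor 1; split=> //; lia.
- by constructor 2; split=> //; lia.
- by constructor 4; split=> //; lia.
- by constructor 3; split=> //; lia.
Qed.

Notation S := (simple_reflection R N).

Lemma actE (w : affperm (2 * N)) (x : 'rV[R]_(2 * N)) l :
  Defs.act w x 0 l = (tr w l)%:~R + x 0 (src w l).
Proof. by rewrite !mxE. Qed.

Lemma act_simple_fix i j d (p : 'rV[R]_(2 * N)) : is_root i j ->
  root_hyperplane R i j d p -> Defs.act (root_reflection i j d) p = p.
Proof.
move=> Hr [Hp Hd]; apply/rowP => l; rewrite actE.
have : p 0 i + p 0 (rev_ord i) = p 0 j + p 0 (rev_ord j).
  by move: Hp => /forallP/(_ i)/forallP/(_ j)/eqP.
rewrite tr_refl // src_refl //.
case: (l =P i) => [->|_]; first lra.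
case: (l =P j) => [->|_]; first by rewrite rmorphN; lra.
case: (l =P rev_ord i) => [->|_]; first by rewrite rmorphN; lra.
case: (l =P rev_ord j) => [->|_]; first lra.
by rewrite add0r.
Qed.

(* The alcove and its image under a simple reflection both have points close to a
   point of the wall lying on no other root hyperplane. *)
Lemma simple_sep s i j d : S s -> is_root i j ->
  (0 < sd 1%g i j d) != (0 < sd s i j d) -> s = root_reflection i j d.
Proof.
case=> i0 [j0 [d0 [Hr0 [p [Hp Hc Hu]] ->]]] Hr Hsep.
have [Hon|Hoff] := pselect (root_hyperplane R i j d p).
  apply/esym; apply: eqroot_refl => //; apply: hyp_eqroot => //.
  by rewrite (Hu _ _ _ Hr Hon).
exfalso; move: Hsep; apply/negP; rewrite negbK; apply/eqP.
set r := root_reflection i0 j0 d0.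
pose f (x : 'rV[R]_(2 * N)) := x 0 i - x 0 j - d%:~R.
have fp : f p != 0.
  apply/eqP => H; apply: Hoff; split; first by case: Hp.
  by move: H; rewrite /f; lra.
pose e := `|f p| / 2.
have e0 : 0 < e by rewrite divr_gt0 // normr_gt0.
have [q [Hq Hb]] : exists q, alcove R N q /\ ball p e q.
  have := Hc (ball p e) (nbhsx_ballx p e e0) => -[q [H1 H2]]; by exists q.
have Hql l : `|p 0 l - q 0 l| < e by case: Hb => _ /(_ 0 l).
have near (x : 'rV[R]_(2 * N)) : (forall l, `|p 0 l - x 0 l| < e) -> (0 < f x) = (0 < f p).
  move=> H; have := H i; have := H j; move: fp; rewrite /e /f => fp.
  rewrite !ltr_norml => /andP[h1 h2] /andP[h3 h4].
  have [h|h|h] := ltrgtP 0 (p 0 i - p 0 j - d%:~R); last by rewrite -h eqxx in fp.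
    by rewrite gtr0_norm // in h1 h2 h3 h4; lra.
  by rewrite ltr0_norm // in h1 h2 h3 h4; lra.
have Hrq l : `|p 0 l - Defs.act r q 0 l| < e.
  rewrite -{1}(act_simple_fix Hr0 Hp) !actE.
  set t := (_)%:~R; set a := p _ _; set b := q _ _.
  by have -> : t + a - (t + b) = a - b by [ring|lra]; exact: Hql.
have sdR (w : affperm (2 * N)) : (0 < sd w i j d) = (0 < f (Defs.act w aR)).
  have Mn : (4 * N)%N%:R != 0 :> R by rewrite lt0r_neq0 ?M_gt0.
  have -> : f (Defs.act w aR) = (sd w i j d)%:~R / (4 * N)%N%:R.
    rewrite /f !act_aR /sd !(intrB, intrM) -pmulrn; field.
    by rewrite pnatr_eq0; lia.
  by rewrite pmulr_lgt0 ?invr_gt0 ?M_gt0 // ltr0z.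
have act1 : Defs.act 1%g aR = aR by apply/rowP => l; rewrite act_aR pt1 mxE.
rewrite !sdR act1 (alcove_side d Hr aR_alcove Hq) -!/(f _) (near _ Hql).
rewrite -(near _ Hrq).
have G (x : 'rV[R]_(2 * N)) : f (Defs.act r x) =
    x 0 (src r i) - x 0 (src r j) - (d - tr r i + tr r j)%:~R.
  by rewrite /f !actE rmorphD rmorphB /=; lra.
rewrite !G; apply: alcove_side => //; last exact: aR_alcove.
by rewrite /is_root -(src_rev (WextR d0 Hr0)) !(inj_eq (@src_inj _ r)).
Qed.

End Alcove.

(** * Simple reflections from points on the walls *)

Section Simple.
Local Open Scope classical_set_scope.
Local Open Scope ring_scope.
Variable N : nat.
Hypothesis N1 : (1 < N)%N.
Variable R : realType.
Notation S := (simple_reflection R N).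

Lemma eqroot_flip (i j : 'I_(2 * N)) d i' j' d' :
  eqroot i j d i' j' d' -> eqroot i j d j' i' (- d').
Proof.
case=> [[-> -> ->]|[-> -> ->]|[-> -> ->]|[-> -> ->]]; rewrite ?opprK.
- by constructor 2.
- by constructor 1.
- by constructor 4.
- by constructor 3.
Qed.

(* The wall point is the midpoint of base and its mirror image. *)
Definition wallpt (i j : 'I_(2 * N)) d l : int := base l + pt (root_reflection i j d) l.

(** The first condition puts the wall point into the closed alcove, the second lets no other root
    hyperplane pass through it. *)
Lemma simple_of (i j : 'I_(2 * N)) d (p2 := wallpt i j d) :
  is_root i j ->
  (forall i' j' : 'I_(2 * N), (i' < j')%N -> j' != rev_ord i' ->
     0 <= p2 j' - p2 i' <= 2 * (4 * N)%N%:Z) ->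
  (forall (i' j' : 'I_(2 * N)) e, (i' < j')%N -> j' != rev_ord i' ->
     p2 j' - p2 i' = 2 * (4 * N)%N%:Z * e -> eqroot i j d j' i' e) ->
  S (root_reflection i j d).
Proof.
move=> Hr H1 H2; have E := root_eqF Hr.
have Mp : (0 : R) < (4 * N)%N%:R by apply: M_gt0.
have Mn : (4 * N)%N%:R != 0 :> R by rewrite lt0r_neq0.
exists i, j, d; split=> //.
pose p : 'rV[R]_(2 * N) := \row_l ((p2 l)%:~R / (2 * (4 * N)%N%:R)).
have pX : in_Xstar p.
  apply/forallP => a; apply/forallP => b; apply/eqP; rewrite !mxE -!mulrDl -!intrD.
  congr (_%:~R / _); rewrite /p2 /wallpt !base_rev /pt !src_refl_rev // !base_rev.
  have := dualsum_refl d Hr a; have := dualsum_refl d Hr b.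
  move: (tr _ a) (tr _ b) (tr _ (rev_ord a)) (tr _ (rev_ord b)) => x y z t h1 h2.
  have -> : z = - x by lia.
  have -> : t = - y by lia.
  by ring.
have pd a b : p 0 a - p 0 b = (p2 a - p2 b)%:~R / (2 * (4 * N)%N%:R).
  by rewrite !mxE -mulrBl -intrB.
have pH : root_hyperplane R i j d p.
  split=> //; rewrite pd.
  have -> : p2 i - p2 j = d * (2 * (4 * N)%N%:Z).
    have P l : pt (root_reflection i j d) l = pt (root_reflection i j d * 1)%g l by rewrite mulg1.
    by rewrite /p2 /wallpt !P !pt_refl // !eqxx !E !pt1; ring.
  by rewrite !intrM -pmulrn mulfK // mulf_neq0 // pnatr_eq0.
clearbody p; exists p; split=> //; last first.
  move=> i' j' d' Hr' [_]; rewrite pd => Hd.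
  have {}Hd : p2 i' - p2 j' = 2 * (4 * N)%N%:Z * d'.
    apply: (@intr_inj R); rewrite !intrM -pmulrn -Hd [RHS]mulrC divfK //.
    by rewrite mulf_neq0 // pnatr_eq0.
  have E' := root_eqF Hr'.
  apply: eqroot_hyp => //.
  case: (ltngtP i' j') => [Hij|Hij|/val_inj Hij]; last by move: Hr'; rewrite /is_root Hij eqxx.
    rewrite -[d']opprK; apply: eqroot_flip; apply: H2 => //; first by rewrite E'.
    by rewrite mulrN -Hd opprB.
  by apply: H2 => //; rewrite E'.
move=> B /nbhs_ballP[e /= e0 HB].
pose K : R := 1 + \sum_l `|aR N R 0 l - p 0 l|.
have K0 : 0 < K by rewrite ltr_pwDl // sumr_ge0.
have Kl l : `|aR N R 0 l - p 0 l| < K.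
  rewrite /K (bigD1 l) //=; have := @sumr_ge0 R _ (index_enum _) (fun i => i != l) (fun l => `|aR N R 0 l - p 0 l|) (fun _ _ => normr_ge0 _).
  lra.
(* The segment from the wall point to the interior point lies in the alcove; K bounds its
   coordinates, so parameter t stays within the ball. *)
pose t := e / (K + e).
clearbody K.
have KE : 0 < K + e by rewrite addr_gt0.
have t0 : 0 < t by rewrite /t divr_gt0.
have t1 : t < 1 by rewrite /t (ltr_pdivrMr _ _ KE) mul1r; lra.
have tK : t * K < e.
  by rewrite /t mulrAC (ltr_pdivrMr _ _ KE) mulrDr ltrDl mulr_gt0.
pose q : 'rV[R]_(2 * N) := \row_l (p 0 l + t * (aR N R 0 l - p 0 l)).
have [aX aA] := (alcoveP N1 _).1 (aR_alcove N1 R).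
exists q; split; last first.
  apply: HB; split=> // x l; rewrite ord1 /ball /= mxE opprD addrA subrr sub0r normrN.
  by rewrite normrM gtr0_norm //; apply: le_lt_trans tK; rewrite ler_pM2l // ltW.
apply/alcoveP => //; split.
  apply/forallP => a; apply/forallP => b; apply/eqP; rewrite ![q 0 _]mxE.
  have : p 0 a + p 0 (rev_ord a) = p 0 b + p 0 (rev_ord b).
    by apply/eqP; move: pX => /forallP/(_ a)/forallP/(_ b).
  have : aR N R 0 a + aR N R 0 (rev_ord a) = aR N R 0 b + aR N R 0 (rev_ord b).
    by apply/eqP; move: aX => /forallP/(_ a)/forallP/(_ b).
  move=> h1 h2.
  transitivity ((1 - t) * (p 0 a + p 0 (rev_ord a)) +
     t * (aR N R 0 a + aR N R 0 (rev_ord a))); first by ring.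
  by rewrite h1 h2; ring.
move=> a b Hab Hr'; have := aA a b Hab Hr'.
have : 0 <= p 0 b - p 0 a <= 1.
  rewrite pd divr_ge0 ?ler0z ?mulr_ge0 //=; last by case/andP: (H1 a b Hab Hr').
  rewrite ler_pdivrMr ?mulr_gt0 // mul1r.
  have -> : 2 * (4 * N)%N%:R = (2 * (4 * N)%N%:Z)%:~R :> R by rewrite intrM -pmulrn.
  rewrite ler_int.
  by case/andP: (H1 a b Hab Hr').
rewrite ![q 0 _]mxE; move: (p 0 a) (p 0 b) (aR N R 0 a) (aR N R 0 b) => x y z u.
move=> /andP[h1 h2] /andP[h3 h4].
have -> : y + t * (u - y) - (x + t * (z - x)) = (y - x) + t * ((u - z) - (y - x)) by ring.
by apply/andP; split; nra.
Qed.

Lemma eq_revE (i l : 'I_(2 * N)) : (l == rev_ord i) = ((l + i).+1 == 2 * N)%N.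
Proof. by rewrite -val_eqE /= -addnS -(eqn_add2r i.+1) subnK. Qed.

Lemma wallpt_cases (i j : 'I_(2 * N)) d (l : 'I_(2 * N)) : is_root i j ->
  [/\ (l : nat) = i & wallpt i j d l = base i + base j + (4 * N)%N%:Z * d] \/
  [/\ (l : nat) = j & wallpt i j d l = base i + base j - (4 * N)%N%:Z * d] \/
  [/\ (l + i).+1 = (2 * N)%N & wallpt i j d l = - base i - base j - (4 * N)%N%:Z * d] \/
  [/\ (l + j).+1 = (2 * N)%N & wallpt i j d l = - base i - base j + (4 * N)%N%:Z * d] \/
  ((l : nat) != i /\ (l : nat) != j /\ (l + i).+1 != (2 * N)%N /\ (l + j).+1 != (2 * N)%N
    /\ wallpt i j d l = 2 * base l).
Proof.
move=> Hr; have E := root_eqF Hr.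
rewrite /wallpt -[root_reflection i j d]mulg1 pt_refl // !pt1 !base_rev.
rewrite !(inj_eq (@ord_inj _)) -!eq_revE.
case: (eqVneq l i) => [->|l1]; first by left; split=> //; ring.
case: (eqVneq l j) => [->|l2]; first by right; left; split=> //; ring.
case: (eqVneq l (rev_ord i)) => [lE|l3].
  by right; right; left; split; [apply/eqP; rewrite -eq_revE lE|rewrite lE base_rev; ring].
case: (eqVneq l (rev_ord j)) => [lE|l4].
  by do 3 right; left; split; [apply/eqP; rewrite -eq_revE lE|rewrite lE base_rev; ring].
do 4 right; do 4 (split=> //); ring.
Qed.

Lemma two_values (x e : int) : 0 <= x <= 2 * (4 * N)%N%:Z -> x = 2 * (4 * N)%N%:Z * e ->
  e = 0 /\ x = 0 \/ e = 1 /\ x = 2 * (4 * N)%N%:Z.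
Proof.
move=> H He; have [e0|[e0|[e0|e0]]] : e = 0 \/ e = 1 \/ e <= -1 \/ 2 <= e by lia.
- by left; rewrite He e0 mulr0.
- by right; rewrite He e0 mulr1.
- suff : 2 * (4 * N)%N%:Z * e <= - (2 * (4 * N)%N%:Z) by lia.
  by nia.
suff : 2 * (4 * N)%N%:Z * e >= 2 * (2 * (4 * N)%N%:Z) by lia.
by nia.
Qed.

(** Only the inequality of the given root may degenerate at the wall point; indices are compared as
    naturals to suit [lia]. *)
Lemma simple_wall (i j : 'I_(2 * N)) d : is_root i j ->
  (forall (i' j' : 'I_(2 * N)) (x := wallpt i j d j' - wallpt i j d i'),
     (i' < j')%N -> ((j' + i').+1 != 2 * N)%N -> ~~ (0 < x < 2 * (4 * N)%N%:Z) ->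
     (d = 0 /\ x = 0 /\ (i' = i :> nat /\ j' = j :> nat \/ (i' + j).+1 = (2 * N)%N /\ (j' + i).+1 = (2 * N)%N)) \/
     (d = 1 /\ x = 2 * (4 * N)%N%:Z /\
      (i' = j :> nat /\ j' = i :> nat \/ (i' + i).+1 = (2 * N)%N /\ (j' + j).+1 = (2 * N)%N))) ->
  S (root_reflection i j d).
Proof.
move=> Hr /= B0.
have B (i' j' : 'I_(2 * N)) (x := wallpt i j d j' - wallpt i j d i') :
     (i' < j')%N -> j' != rev_ord i' -> ~~ (0 < x < 2 * (4 * N)%N%:Z) ->
     (d = 0 /\ x = 0 /\ (i' = i /\ j' = j \/ i' = rev_ord j /\ j' = rev_ord i)) \/
     (d = 1 /\ x = 2 * (4 * N)%N%:Z /\ (i' = j /\ j' = i \/ i' = rev_ord i /\ j' = rev_ord j)).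
  have V (a b : 'I_(2 * N)) : (a + b).+1 = (2 * N)%N -> a = rev_ord b by move/eqP; rewrite -eq_revE => /eqP.
  rewrite eq_revE => h1 h2 h3; have [[d0 [x0 H]]|[d0 [x0 H]]] := B0 i' j' h1 h2 h3; [left|right];
    (do 2 split=> //); case: H => -[H1 H2]; [left|right|left|right];
    by split; first [exact: V|exact: val_inj].
have Bd (i' j' : 'I_(2 * N)) : (i' < j')%N -> j' != rev_ord i' ->
    0 <= wallpt i j d j' - wallpt i j d i' <= 2 * (4 * N)%N%:Z.
  move=> Hij Hne; have [/andP[/ltW -> /ltW -> //]|Hx] := boolP (0 < wallpt i j d j' - wallpt i j d i' < 2 * (4 * N)%N%:Z).
  by case: (B i' j' Hij Hne Hx) => [[_ [-> _]]|[_ [-> _]]]; rewrite lexx ?andbT.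
apply: (simple_of Hr) => // i' j' e Hij Hne He.
have Mp : 0 < 2 * (4 * N)%N%:Z by move: N1; clear; lia.
have Hx : ~~ (0 < wallpt i j d j' - wallpt i j d i' < 2 * (4 * N)%N%:Z).
  by case: (two_values (Bd i' j' Hij Hne) He) => -[_ ->]; rewrite ltxx ?andbF.
have := two_values (Bd i' j' Hij Hne) He.
case: (B i' j' Hij Hne Hx) => [[-> [-> H]]|[-> [-> H]]] [[-> H2]|[-> H2]].
- by case: H => -[-> ->]; [constructor 2|constructor 4]; rewrite ?oppr0.
- by rewrite -H2 ltxx in Mp.
- by rewrite H2 ltxx in Mp.
by case: H => -[-> ->]; [constructor 1|constructor 3].
Qed.

Ltac wall_lia :=
  first [by exfalso; lia | left; split; [done|split; [lia|first [by left; lia | by right; lia]]]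
    | right; split; [done|split; [lia|first [by left; lia | by right; lia]]]].

Lemma simple_chain (i j : 'I_(2 * N)) k : i = k :> nat -> j = k.+1 :> nat -> (k < N.-1)%N ->
  S (root_reflection i j 0).
Proof.
move=> Hi Hj Hk; have Hr : is_root i j by rewrite /is_root -!val_eqE /=; lia.
apply: (simple_wall Hr) => i' j' x h1 h2 h3; rewrite /x {x} in h3 *; have h4 := ltn_ord i';
  have h5 := ltn_ord j'; move: h1 h2 h4 h5;
  move: (wallpt_cases 0 i' Hr) (wallpt_cases 0 j' Hr); rewrite /base /= Hi Hj; move: h3;
  move: (wallpt _ _ _ i') (wallpt _ _ _ j') => a b h3;
  move=> [[p1 p2]|[[p1 p2]|[[p1 p2]|[[p1 p2]|[p1 [p2 [p3 [p4 p5]]]]]]]];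
  move=> [[q1 q2]|[[q1 q2]|[[q1 q2]|[[q1 q2]|[q1 [q2 [q3 [q4 q5]]]]]]]] h1 h2 h4 h5;
  wall_lia.
Qed.

Lemma simple_fork (i j : 'I_(2 * N)) : i = (N - 2)%N :> nat -> j = N :> nat ->
  S (root_reflection i j 0).
Proof.
move=> Hi Hj; have Hr : is_root i j by rewrite /is_root -!val_eqE /=; lia.
apply: (simple_wall Hr) => i' j' x h1 h2 h3; rewrite /x {x} in h3 *; have h4 := ltn_ord i';
  have h5 := ltn_ord j'; move: h1 h2 h4 h5;
  move: (wallpt_cases 0 i' Hr) (wallpt_cases 0 j' Hr); rewrite /base /= Hi Hj; move: h3;
  move: (wallpt _ _ _ i') (wallpt _ _ _ j') => a b h3;
  move=> [[p1 p2]|[[p1 p2]|[[p1 p2]|[[p1 p2]|[p1 [p2 [p3 [p4 p5]]]]]]]];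
  move=> [[q1 q2]|[[q1 q2]|[[q1 q2]|[[q1 q2]|[q1 [q2 [q3 [q4 q5]]]]]]]] h1 h2 h4 h5;
  wall_lia.
Qed.

Lemma simple_affine (i j : 'I_(2 * N)) : i = (2 * N).-1 :> nat -> j = 1%N :> nat ->
  S (root_reflection i j 1).
Proof.
move=> Hi Hj; have Hr : is_root i j by rewrite /is_root -!val_eqE /=; lia.
apply: (simple_wall Hr) => i' j' x h1 h2 h3; rewrite /x {x} in h3 *; have h4 := ltn_ord i';
  have h5 := ltn_ord j'; move: h1 h2 h4 h5;
  move: (wallpt_cases 1 i' Hr) (wallpt_cases 1 j' Hr); rewrite /base /= Hi Hj; move: h3;
  move: (wallpt _ _ _ i') (wallpt _ _ _ j') => a b h3;
  move=> [[p1 p2]|[[p1 p2]|[[p1 p2]|[[p1 p2]|[p1 [p2 [p3 [p4 p5]]]]]]]];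
  move=> [[q1 q2]|[[q1 q2]|[[q1 q2]|[[q1 q2]|[q1 [q2 [q3 [q4 q5]]]]]]]] h1 h2 h4 h5;
  wall_lia.
Qed.

(** For N = 2 the diagram is two copies of affine A_1, with a second affine node. *)
Lemma simple_affine2 (i j : 'I_(2 * N)) : N = 2%N -> i = 3%N :> nat -> j = 2%N :> nat ->
  S (root_reflection i j 1).
Proof.
move=> N2 Hi Hj; have Hr : is_root i j by rewrite /is_root -!val_eqE /=; lia.
apply: (simple_wall Hr) => i' j' x h1 h2 h3; rewrite /x {x} in h3 *; have h4 := ltn_ord i';
  have h5 := ltn_ord j'; move: h1 h2 h4 h5;
  move: (wallpt_cases 1 i' Hr) (wallpt_cases 1 j' Hr); rewrite /base /= Hi Hj; move: h3;
  move: (wallpt _ _ _ i') (wallpt _ _ _ j') => a b h3;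
  move=> [[p1 p2]|[[p1 p2]|[[p1 p2]|[[p1 p2]|[p1 [p2 [p3 [p4 p5]]]]]]]];
  move=> [[q1 q2]|[[q1 q2]|[[q1 q2]|[[q1 q2]|[q1 [q2 [q3 [q4 q5]]]]]]]] h1 h2 h4 h5;
  wall_lia.
Qed.

End Simple.

(** * The Bruhat order and separating hyperplanes *)

Section Coxeter.
Local Open Scope classical_set_scope.
Local Open Scope ring_scope.
Variable N : nat.
Hypothesis N1 : (1 < N)%N.
Variable R : realType.
Notation S := (simple_reflection R N).

Lemma simple_descent (w : affperm (2 * N)) : Wext w ->
  in_alc w \/ exists i j d, [/\ is_root i j, S (root_reflection i j d) &
     (0 < sd 1%g i j d) != (0 < sd w i j d)].
Proof.
move=> Hw; have [|Hn] := pselect (exists i j d, [/\ is_root i j, S (root_reflection i j d) &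
     (0 < sd 1%g i j d) != (0 < sd w i j d)]); [by right|left].
have [[c Hc] _ _] := Hw.
have side i j d : is_root i j -> S (root_reflection i j d) -> (0 < sd 1%g i j d) = (0 < sd w i j d).
  by move=> H1 H2; apply/eqP; apply: contrapT => /negP H3; apply: Hn; exists i, j, d.
have lt_side i j d : is_root i j -> S (root_reflection i j d) -> sd 1%g i j d < 0 -> sd w i j d < 0.
  move=> Hr /side H /ltW H1; have := H Hr; have [n1 _] := andP Hr.
  by have := sd_neq0 w d (i := i) (j := j); rewrite eq_sym n1 => /(_ isT); lia.
have chain (i j : 'I_(2 * N)) : (i < j)%N -> (j < N)%N -> pt w i < pt w j.
  move: i j => [i Hi] [j Hj] /= Hij HjN.
  elim: j Hj Hij HjN => [//|j IH] Hj Hij HjN.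
  have Hj' : (j < 2 * N)%N by lia.
  have : sd w (Ordinal Hj') (Ordinal Hj) 0 < 0.
    apply: lt_side; first by rewrite /is_root -!val_eqE /=; lia.
      by apply: (@simple_chain N N1 R _ _ j) => //=; lia.
    by rewrite /sd !pt1 /base /=; lia.
  rewrite /sd => H; move: Hij; rewrite ltnS leq_eqVlt => /orP[/eqP ij|ij].
    have -> : Ordinal Hi = Ordinal Hj' by apply: val_inj.
    by lia.
  by apply: lt_trans (IH Hj' ij (ltnW HjN)) _; lia.
have fork (i j : 'I_(2 * N)) : (i < N.-1)%N -> j = N :> nat -> pt w i < pt w j.
  move=> Hi Hj; have H2 : (N - 2 < 2 * N)%N by lia.
  have : sd w (Ordinal H2) j 0 < 0.
    apply: lt_side; first by rewrite /is_root -!val_eqE /=; lia.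
      by apply: simple_fork.
    by rewrite /sd !pt1 /base /= Hj; lia.
  rewrite /sd => H; have [ij|ij] := eqVneq (i : nat) (N - 2)%N.
    have -> : i = Ordinal H2 by apply: val_inj.
    by lia.
  have : pt w i < pt w (Ordinal H2) by apply: chain => /=; lia.
  by lia.
have lt_asc (i j : 'I_(2 * N)) : (i < j <= N)%N -> i != N.-1 :> nat -> pt w i < pt w j.
  move=> /andP[Hij HjN] Hi; have [jN|jN] := eqVneq (j : nat) N; first by apply: fork => //; lia.
  by apply: chain => //; lia.
apply: (chain_alcove N1 (c := (4 * N)%N%:Z * c)) => // [i|i j Hi Hj].
  by rewrite -(Hc i) /pt src_rev // base_rev; ring.
have o1 : (1 < 2 * N)%N by lia.
have aff : pt w i - (4 * N)%N%:Z < pt w (Ordinal o1).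
  have : sd w i (Ordinal o1) 1 < 0.
    apply: lt_side; first by rewrite /is_root -!val_eqE /=; lia.
      exact: simple_affine.
    by rewrite /sd !pt1 /base /= Hi; lia.
  by rewrite /sd; lia.
have [j1|j1] := eqVneq (j : nat) 1%N.
  have -> : j = Ordinal o1 by apply: val_inj.
  exact: aff.
(* For N = 2 the indices 1 and 2 are dual and not comparable, hence the extra wall. *)
have [N2|N2] := eqVneq N 2%N.
  have : sd w i j 1 < 0.
    apply: lt_side; first by rewrite /is_root -!val_eqE /=; lia.
      by apply: simple_affine2 => //; lia.
    by rewrite /sd !pt1 /base /=; lia.
  by rewrite /sd; lia.
have : pt w (Ordinal o1) < pt w j by apply: lt_asc => /=; lia.
by lia.
Qed.

Lemma word1 : has_word S 1%g 0.
Proof. by exists [::]; split=> //; rewrite big_nil. Qed.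

Lemma wordM x y k l : has_word S x k -> has_word S y l -> has_word S (x * y)%g (k + l).
Proof.
move=> [a [Ha1 Ha2 ->]] [b [Hb1 Hb2 ->]]; exists (a ++ b); split.
- by rewrite size_cat Ha1 Hb1.
- by move=> u; rewrite mem_cat => /orP[/Ha2|/Hb2].
- by rewrite big_cat.
Qed.

Lemma simple_inv s : S s -> s^-1%g = s.
Proof. by case=> i [j [d [Hr _ ->]]]; rewrite reflV. Qed.

Lemma simple_word s : S s -> has_word S s 1.
Proof. by move=> Hs; exists [:: s]; split=> // [u|]; rewrite ?inE ?big_seq1 // => /eqP ->. Qed.

Lemma wordV x k : has_word S x k -> has_word S x^-1%g k.
Proof.
case=> a [Ha1 Ha2 ->]; elim: a k Ha1 Ha2 => [|s a IH] k Hk Ha.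
  by rewrite big_nil invg1 -Hk; exact: word1.
rewrite big_cons invMg -Hk /= -[(size a).+1]addn1; apply: wordM.
  by apply: IH => // u Hu; apply: Ha; rewrite inE Hu orbT.
have Hs : S s by apply: Ha; rewrite inE eqxx.
by rewrite simple_inv //; apply: simple_word.
Qed.

Lemma simple_Waff s : S s -> in_Waff s.
Proof. by case=> i [j [d [Hr _ ->]]]; apply: WaffR. Qed.

Lemma Waff1 : in_Waff (1%g : affperm (2 * N)).
Proof.
apply/in_WaffP; split; [exact: Wext1|by move=> l; rewrite !tr1|].
by rewrite big1 ?dvdz0 // => l _; rewrite tr1.
Qed.

Lemma word_Waff x k : has_word S x k -> in_Waff x.
Proof.
case=> a [_ Ha ->]; elim: a Ha => [|s a IH] Ha; first by rewrite big_nil Waff1.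
rewrite big_cons; apply: WaffM; first by apply/simple_Waff/Ha; rewrite inE eqxx.
by apply: IH => u Hu; apply: Ha; rewrite inE Hu orbT.
Qed.

Lemma word_Wext x k : has_word S x k -> Wext x.
Proof. by move/word_Waff/Waff_Wext. Qed.

Lemma reduce_alc w : Wext w -> exists u k, has_word S u k /\ in_alc (u * w)%g.
Proof.
have [n] := ubnP `|dist w|%N; elim: n w => // n IH w Hn Hw.
have [Ha|[i [j [d [Hr Hs Hd]]]]] := simple_descent Hw.
  by exists 1%g, 0%N; split; [exact: word1|rewrite mul1g].
have [[c Hc] _ _] := Hw.
have [||u [k [Hu Ha]]] := IH (root_reflection i j d * w)%g.
- have := dist_ge0 w; have := dist_ge0 (root_reflection i j d * w)%g.
  rewrite (dist_refl d Hc (src_rev Hw) Hr) => h1 h2.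
  suff : sd w i j d * sd 1%g i j d < 0 by move: h1 h2 Hn; lia.
  have [n1 _] := andP Hr.
  have := sd_neq0 w d (i := i) (j := j); rewrite eq_sym n1 => /(_ isT).
  have := sd_neq0 1%g d (i := i) (j := j); rewrite eq_sym n1 => /(_ isT).
  by move: Hd; move: (sd _ _ _ _) (sd _ _ _ _) => a b; nia.
- by apply: WextM => //; apply: WextR.
exists (u * root_reflection i j d)%g, (k + 1)%N; split; last by rewrite -mulgA.
by apply: wordM => //; apply: simple_word.
Qed.

Lemma Waff_word x : in_Waff x -> exists k, has_word S x k.
Proof.
move=> Hx; have [u [k [Hu Ha]]] := reduce_alc (Waff_Wext Hx).
exists k; rewrite -[x](mulKg u).
have -> : (u * x = 1)%g by apply: Waff_alc1 => //; apply: WaffM => //; apply: word_Waff Hu.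
by rewrite mulg1; apply: wordV.
Qed.

Lemma word_length x k : has_word S x k -> exists l, has_length S x l.
Proof.
move=> Hk; have ex : exists k, `[< has_word S x k >] by exists k; apply/asboolP.
case: (ex_minnP ex) => l /asboolP Hl Hmin; exists l; split=> // k' Hk'.
by apply: Hmin; apply/asboolP.
Qed.

(** Strong exchange: the prefixes of a word form a gallery, and a hyperplane separating its ends is
    crossed at some letter. The induction strips the first letter and transports the hyperplane by
    it. *)
Lemma gallery (l : seq (affperm (2 * N))) i j d : (forall u, u \in l -> S u) -> is_root i j ->
  (0 < sd 1%g i j d) != (0 < sd (\prod_(u <- l) u)%g i j d) ->
  exists l1 s l2, l = l1 ++ s :: l2 /\
    root_reflection i j d = ((\prod_(u <- l1) u) * s * (\prod_(u <- l1) u)^-1)%g.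
Proof.
elim: l i j d => [|s l IH] i j d Hl Hr; first by rewrite big_nil eqxx.
rewrite big_cons => Hd.
have Hs : S s by apply: Hl; rewrite inE eqxx.
have [He|He] := boolP ((0 < sd 1%g i j d) == (0 < sd s i j d)); last first.
  exists [::], s, l; split=> //; rewrite big_nil mul1g invg1 mulg1.
  apply/esym; apply: (simple_sep N1 Hs Hr He).
have Ws : Wext s by apply/Waff_Wext/simple_Waff.
have Hr' : is_root (src s i) (src s j).
  by rewrite /is_root -(src_rev Ws) !(inj_eq (@src_inj _ s)).
have [|||l1 [s' [l2 [El Et]]]] := IH (src s i) (src s j) (d - tr s i + tr s j).
- by move=> u Hu; apply: Hl; rewrite inE Hu orbT.
- exact: Hr'.
- by rewrite -!sdM mulg1 -(eqP He).
exists (s :: l1), s', l2; split; first by rewrite El.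
rewrite big_cons invMg -!mulgA; apply: (mulIg s); rewrite -!mulgA mulVg mulg1.
apply: (mulgI s^-1%g); rewrite mulKg -!mulgA in Et *; rewrite -Et.
rewrite mulgA -[X in (_ * X)%g]invgK refl_conj ?WextV //.
congr root_reflection; rewrite ?linpartV ?trV //.
by rewrite !srcK; ring.
exact: WextV.
Qed.

Lemma separated_delete (x : affperm (2 * N)) k i j d : has_word S x k -> is_root i j ->
  (0 < sd 1%g i j d) != (0 < sd x i j d) ->
  exists2 k', has_word S (root_reflection i j d * x)%g k' & (k' < k)%N.
Proof.
case=> l [Hk Hl ->] Hr /(gallery Hl Hr)[l1 [s [l2 [El ->]]]].
have Hs : S s by apply: Hl; rewrite El mem_cat inE eqxx orbT.
exists (size (l1 ++ l2)); last by rewrite -Hk El !size_cat /=; lia.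
exists (l1 ++ l2); split=> // [u|].
  by rewrite mem_cat => Hu; apply: Hl; rewrite El mem_cat inE orbCA Hu orbT.
rewrite El !big_cat big_cons -!mulgA mulKg; congr mulg.
by rewrite mulgA -[X in (X * s)%g]simple_inv // mulVg mul1g.
Qed.

(** Apply [gallery] to a word of the reflection itself, whose alcove is separated from that of 1 by
    its own hyperplane. *)
Lemma refl_cox i j d : is_root i j -> cox_reflection S (root_reflection i j d).
Proof.
move=> Hr; have [k [l [Hk Hl El]]] := Waff_word (WaffR d Hr).
have [|l1 [s [l2 [E Et]]]] := @gallery l i j d Hl Hr.
  rewrite -El -[root_reflection i j d]mulg1 sd_refl //.
  by apply: oppr_side; apply: sd_neq0; have [n1 _] := andP Hr; rewrite eq_sym.
exists (\prod_(u <- l1) u)%g, s; split=> //.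
  exists (size l1), l1; split=> // u Hu; apply: Hl; by rewrite E mem_cat Hu.
by apply: Hl; rewrite E mem_cat inE eqxx orbT.
Qed.

Lemma cox_refl t : cox_reflection S t -> exists i j d, is_root i j /\ t = root_reflection i j d.
Proof.
case=> u [s [[k Hu] [i [j [d [Hr _ ->]]]] ->]].
have Wu := word_Wext Hu.
rewrite refl_conj //; do 3 eexists; split; last by [].
by have [_ _ Hl] := Wu; rewrite /is_root -Hl !(inj_eq perm_inj).
Qed.

(** If the hyperplane did not separate 1 from y, it would separate 1 from x, and deleting a letter
    would make y shorter than x. *)
Lemma bruhat_step_separated x y : bruhat_step S x y ->
  exists i j d, [/\ is_root i j, x = (root_reflection i j d * y)%g &
    (0 < sd 1%g i j d) != (0 < sd y i j d)].
Proof.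
case=> t /cox_refl[i [j [d [Hr Et]]]] [Hy [k [l [[Hx Hxm] [Hyw Hym] Hkl]]]].
have Wx := word_Wext Hx.
have Hr' := is_root_linpart Wx Hr.
have Ht := refl_conj d Wx Hr.
set i' := linpart x i in Hr' Ht; set j' := linpart x j in Hr' Ht.
set d' := d + _ - _ in Ht.
have Exy : y = (root_reflection i' j' d' * x)%g by rewrite -Ht mulgKV Hy Et.
have Eyx : x = (root_reflection i' j' d' * y)%g by rewrite Exy mulgA reflK // mul1g.
exists i', j', d'; split=> //; apply/negP => /eqP Hs.
have [|k' Hk' Hk'k] := @separated_delete x k i' j' d' Hx Hr'.
  rewrite Hs Exy sd_refl //.
  by rewrite eq_sym; apply: oppr_side; apply: sd_neq0; have [n1 _] := andP Hr'; rewrite eq_sym.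
by have := Hym k'; rewrite Exy => /(_ Hk'); lia.
Qed.

Lemma separated_bruhat_step x i j d : in_Waff x -> is_root i j ->
  (0 < sd 1%g i j d) = (0 < sd x i j d) ->
  bruhat_step S x (root_reflection i j d * x)%g.
Proof.
move=> Hx Hr Hs; have [k0 Hk0] := Waff_word Hx.
have [k Hk] := word_length Hk0.
have Wx := Waff_Wext Hx.
have Hrx : in_Waff (root_reflection i j d * x)%g by apply: WaffM => //; apply: WaffR.
have [l0 Hl0] := Waff_word Hrx.
have [l Hl] := word_length Hl0.
exists (x^-1 * root_reflection i j d * x)%g.
  have := refl_conj d (WextV Wx) Hr; rewrite invgK => ->.
  by apply: refl_cox; apply: is_root_linpart => //; apply: WextV.
split; first by rewrite !mulgA mulgV mul1g.
exists k, l; split=> //.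
have [|k' Hk' Hk'k] := @separated_delete _ l i j d Hl.1 Hr.
  rewrite Hs sd_refl //.
  by apply: oppr_side; apply: sd_neq0; have [n1 _] := andP Hr; rewrite eq_sym.
by apply: leq_ltn_trans Hk'k; apply: Hk.2; move: Hk'; rewrite mulgA reflK // mul1g.
Qed.

Lemma in_alc_side (w v : affperm (2 * N)) i j d : in_alc w -> in_alc v -> is_root i j ->
  (0 < sd w i j d) = (0 < sd v i j d).
Proof.
move=> Hw Hv Hr; have [n1 n2] := andP Hr.
have n3 : i != rev_ord j by rewrite eq_sym (root_eqF Hr).
have [d0|[d0|d0]] : d <= -1 \/ d = 0 \/ 1 <= d by lia.
all: rewrite /sd.
all: case: (ltngtP i j) => [Hij|Hij|/val_inj Hij]; last by rewrite Hij eqxx in n1.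
all: try (have := Hw i j Hij n2; have := Hv i j Hij n2).
all: try (have := Hw j i Hij n3; have := Hv j i Hij n3).
all: try (rewrite d0; lia).
- have : (4 * N)%N%:Z * d <= - (4 * N)%N%:Z by nia.
  lia.
- have : (4 * N)%N%:Z * d <= - (4 * N)%N%:Z by nia.
  lia.
- have : (4 * N)%N%:Z * d >= (4 * N)%N%:Z by nia.
  lia.
have : (4 * N)%N%:Z * d >= (4 * N)%N%:Z by nia.
lia.
Qed.

(** The elements x t and x have the same alcove, so the component in Omega can be ignored in
    questions of sides. *)
Lemma sd_alc (x t : affperm (2 * N)) i j d : Wext x -> in_alc t -> is_root i j ->
  (0 < sd (x * t)%g i j d) = (0 < sd x i j d).
Proof.
move=> Hx Ht Hr; rewrite -[x in RHS]mulg1 !sdM; apply: in_alc_side => //.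
  exact: in_alc1.
by rewrite /is_root -(src_rev Hx) !(inj_eq (@src_inj _ x)).
Qed.

Lemma in_alcV (t : affperm (2 * N)) : Wext t -> in_alc t -> in_alc t^-1%g.
Proof.
move=> Ht Hal.
have sV i j d : is_root i j -> (0 < sd 1%g i j d) = (0 < sd t^-1%g i j d).
  by move=> Hr; rewrite -(sd_alc d (WextV Ht) Hal Hr) mulVg.
move=> i j Hij Hr.
have Hr1 : is_root i j by rewrite /is_root Hr andbT -val_eqE /=; lia.
have Hr2 : is_root j i.
  by rewrite /is_root -[i == rev_ord j](inj_eq rev_ord_inj) rev_ordK [rev_ord i == j]eq_sym Hr
    andbT -val_eqE /=; lia.
have := sV j i 0 Hr2; have := sV i j (-1) Hr1; rewrite /sd !pt1 /base.
have := ltn_ord i; have := ltn_ord j; move: (pt t^-1%g i) (pt t^-1%g j) => a b.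
by lia.
Qed.

Lemma in_alc_act (t : affperm (2 * N)) (x : 'rV[R]_(2 * N)) : Wext t -> in_alc t ->
  alcove R N x -> alcove R N (Defs.act t x).
Proof.
move=> Ht Hal Hx; have [HX _] := (alcoveP N1 x).1 Hx.
apply/(alcoveP N1); split; first exact: in_Xstar_act.
have /(alcoveP N1)[_ Ht'] := (act_aR_alcove N1 R Ht).2 Hal.
move=> i j Hij Hr; have := Ht' i j Hij Hr; rewrite !actE.
have Hr1 : is_root (src t j) (src t i).
  by rewrite /is_root -(src_rev Ht) !(inj_eq (@src_inj _ t)) -[i == rev_ord j](inj_eq rev_ord_inj)
    rev_ordK [rev_ord i == j]eq_sym Hr andbT -val_eqE /=; lia.
have Hr2 : is_root (src t i) (src t j).
  by rewrite /is_root -(src_rev Ht) !(inj_eq (@src_inj _ t)) Hr andbT -val_eqE /=; lia.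
have := alcove_side N1 (- (tr t j - tr t i)) Hr1 Hx (aR_alcove N1 R).
have := alcove_side N1 (tr t j - tr t i - 1) Hr2 Hx (aR_alcove N1 R).
rewrite rmorphN /= !rmorphB /= rmorph1.
move: (x 0 (src t i)) (x 0 (src t j)) (aR N R 0 (src t i)) (aR N R 0 (src t j)) ((tr t j)%:~R) ((tr t i)%:~R) => a b c e f g.
move=> h1 h2 /andP[h3 h4].
have {}h1 : 0 < a - b - (f - g - 1) by rewrite h1; lra.
have {}h2 : 0 < b - a - (- (f - g)) by rewrite h2; lra.
by apply/andP; split; lra.
Qed.

Lemma in_OmegaP (t : affperm (2 * N)) : in_Omega R t <-> Wext t /\ in_alc t.
Proof.
split=> [[/in_WextP Ht Hal]|[Ht Hal]].
  split=> //; apply/(act_aR_alcove N1 R Ht); rewrite -Hal.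
  by exists (aR N R) => //; apply: aR_alcove.
split; first exact/in_WextP.
apply/seteqP; split=> [y [x Hx <-]|y Hy]; first exact: in_alc_act.
exists (Defs.act t^-1%g y); first by apply: in_alc_act => //; [apply: WextV|apply: in_alcV].
by rewrite -Defs.actM mulgV; apply/rowP => l; rewrite actE tr1 src1 add0r.
Qed.

Lemma alc_decompose (w : affperm (2 * N)) : Wext w ->
  exists x t, [/\ in_Waff x, in_Omega R t & w = (x * t)%g].
Proof.
move=> Hw; have [u [k [Hu Ha]]] := reduce_alc Hw.
exists u^-1%g, (u * w)%g; split; last by rewrite mulKg.
  exact: word_Waff (wordV Hu).
by apply/in_OmegaP; split=> //; apply: WextM => //; apply: word_Wext Hu.
Qed.

End Coxeter.

(** * The two implications *)

Section Main.
Variable N : nat.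
Implicit Types (w u x t : affperm (2 * N)) (i j l q : 'I_(2 * N)) (k s : nat).

Lemma sdN w i j d : sd w j i (- d) = - sd w i j d.
Proof. by rewrite /sd; ring. Qed.

Lemma spinX_down s w i j d : is_root i j -> (0 < sd 1%g i j d) != (0 < sd w i j d) ->
  spinX s w -> spinX s (root_reflection i j d * w)%g.
Proof.
move=> Hr Hs Hsp; have nij : i != j by case/andP: Hr; rewrite eq_sym.
have main a b c : is_root a b -> 0 < sd w a b c -> sd 1%g a b c < 0 ->
    spinX s (root_reflection a b c * w)%g.
  move=> Hab H1 H2; apply: (spinX_down_pos Hab) => // k; first exact: ud_ge0.
  by rewrite vdE; exact: (ud_le0 k H2).
have [H|H] := ltrP 0 (sd w i j d).
  apply: main => //; rewrite lt_neqAle sd_neq0 // leNgt.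
  by move: Hs; rewrite H; case: (0 < sd _ _ _ _).
have Er : eqroot i j d j i (- d) by constructor 2.
rewrite -(eqroot_refl Hr Er); apply: main; rewrite ?sdN ?oppr_gt0 ?oppr_lt0 //.
- by case/andP: Hr => _ H3; rewrite /is_root nij; apply: contra H3 => /eqP ->; rewrite rev_ordK.
- by rewrite lt_neqAle sd_neq0.
by move: Hs; rewrite [0 < sd w _ _ _]ltNge H; case: (0 < sd _ _ _ _).
Qed.

Lemma in_W0P (sg : 'S_(2 * N)) :
  reflect (~~ odd_perm sg /\ forall i, sg (rev_ord i) = rev_ord (sg i)) (in_W0 sg).
Proof.
apply: (iffP andP) => -[H1 H2]; split=> //; first by move=> i; apply/eqP/(forallP H2).
by apply/forallP=> i; apply/eqP.
Qed.

Lemma in_W0M (a b : 'S_(2 * N)) : in_W0 a -> in_W0 b -> in_W0 (a * b)%g.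
Proof.
move=> /in_W0P[/negbTE a1 a2] /in_W0P[b1 b2]; apply/in_W0P; split; first by rewrite odd_permM a1.
by move=> i; rewrite !permM a2 b2.
Qed.

Lemma in_W0_linpart w : Wext w -> in_W0 (linpart w).
Proof. by case=> _ H1 H2; apply/in_W0P. Qed.

Lemma in_W0_rev (a : 'S_(2 * N)) i : in_W0 a -> a^-1%g (rev_ord i) = rev_ord (a^-1%g i).
Proof. by move=> /in_W0P[_ H]; apply: (@perm_inj _ a); rewrite H !permKV. Qed.

Definition tmu (s : nat) (a : 'S_(2 * N)) : affperm (2 * N) := AffPerm (permv a (mu_D N s)) 1%g.

Lemma tr_tmu s a l : tr (tmu s a) l = mu_D N s 0 (a^-1%g l).
Proof. by rewrite /tr /= mxE. Qed.

Lemma src_tmu s a l : src (tmu s a) l = l.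
Proof. by rewrite /src /= invg1 perm1. Qed.

Lemma spinX_tmu s a : (s <= N)%N -> in_W0 a -> spinX s (tmu s a).
Proof.
move=> Hs Ha.
have Hd : dualsum (tmu s a) 2.
  move=> l; rewrite !tr_tmu in_W0_rev // !mu_DE //=.
  by move: (a^-1%g l) => q; have := ltn_ord q; move: Hs; clear; lia.
have Xt k l : X (tmu s a) k l = mu_D N s 0 (a^-1%g l) - 1 by rewrite X_triv ?src_tmu // tr_tmu.
have Hn k : nn (tmu s a) k = s%:Z.
  rewrite /nn (reindex_inj (@perm_inj _ a)) /=.
  rewrite (eq_bigr (fun l : 'I_(2 * N) => ((l < s)%N : nat)%:Z)) => [|l _].
    by rewrite sum_lt_ord; congr _%:Z; apply/minn_idPr; move: Hs; clear; lia.
  rewrite Xt permK mu_DE //; congr (_ : nat)%:Z.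
  by have := ltn_ord l; move: Hs; clear; lia.
split=> //.
- split; [by exists 2|by rewrite /= odd_perm1|by move=> l; rewrite /= !perm1].
- move=> k l _; rewrite Xt mu_DE //; clear; lia.
- by move=> k _; rewrite Hn.
by move=> k _ _; rewrite Hn subrr dvdz0.
Qed.

(** A single reflection does it unless l2 is dual to l1, which is no root; then the middle dual pair
    is swapped too, to keep the permutation even. It lies beyond s because s < N. *)
Lemma W0_swap s l1 l2 : (s < N)%N -> (l1 < s)%N -> (s <= l2)%N ->
  exists2 a : 'S_(2 * N), in_W0 a & a l1 = l2 /\
    forall l, (l < s)%N -> l != l1 -> l != rev_ord l2 -> a l = l.
Proof.
move=> sN H1 H2; have n12 : l2 != l1 by apply/eqP => E; move: H2; rewrite E leqNgt H1.
have [E|nr] := eqVneq l2 (rev_ord l1); last first.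
  have Hr : is_root l1 l2 by rewrite /is_root n12.
  exists (linpart (root_reflection l1 l2 0)); first by apply/in_W0_linpart/WextR.
  split; first by rewrite linpart_refl // src_refl // eqxx.
  move=> l l_s l_1 l_2; rewrite linpart_refl // src_refl // (negbTE l_1) (negbTE l_2).
  have -> : (l == l2) = false by apply/eqP => E; move: H2; rewrite -E leqNgt l_s.
  have -> // : (l == rev_ord l1) = false.
  by rewrite -val_eqE /=; move: H1 l_s sN; clear; lia.
have Hq : (N.-1 < 2 * N)%N by move: sN; clear; lia.
pose q : 'I_(2 * N) := Ordinal Hq.
have R1 : is_root l1 q by rewrite /is_root -!val_eqE /=; move: H1 sN; clear; lia.
have R2 : is_root l1 (rev_ord q) by rewrite /is_root -!val_eqE /=; move: H1 sN; clear; lia.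
exists (linpart (root_reflection l1 q 0) * linpart (root_reflection l1 (rev_ord q) 0))%g.
  by apply: in_W0M; apply/in_W0_linpart/WextR.
have F1 := root_eqF R1; have F2 := root_eqF R2.
split; first by rewrite permM !linpart_refl // !src_refl // eqxx ?rev_ordK ?F1 ?F2 ?eqxx E.
move=> l l_s l_1 l_2; have l_3 : l != rev_ord l1 by rewrite -val_eqE /=; move: H1 l_s sN; clear; lia.
have l_4 : l != q by rewrite -val_eqE /=; move: l_s sN; clear; lia.
have l_5 : l != rev_ord q by rewrite -val_eqE /=; move: l_s sN; clear; lia.
rewrite permM !linpart_refl // !src_refl // (negbTE l_1) (negbTE l_3) (negbTE l_4) (negbTE l_5).
by rewrite (negbTE l_1) (negbTE l_3) ?rev_ordK (negbTE l_4) (negbTE l_5).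
Qed.

(** Among the elements of W0 take one bringing the most twos to the first s positions; if one is
    missing there, [W0_swap] improves it. *)
Lemma maximal_tmu s t : (s < N)%N -> spinX s t -> (forall l, src t l = l) -> nn t 0 = s%:Z ->
  exists2 a, in_W0 a & t = tmu s a.
Proof.
move=> sN [Hw Hd Hb _ _] Hsrc Hn.
have Hv l : 0 <= tr t l <= 2 by have := Hb 0%N l (leq0n _); rewrite X_triv //; clear; lia.
have Hcount (a : 'S_(2 * N)) : \sum_l ((tr t (a l) == 2) : nat)%:Z = s%:Z.
  rewrite -Hn /nn [RHS](reindex_inj (@perm_inj _ a)) /=; apply: eq_bigr => l _.
  by rewrite X_triv //; congr (_ : nat)%:Z; rewrite subr_eq.
have Hs : \sum_(l < 2 * N) ((l < s)%N : nat)%:Z = s%:Z.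
  by rewrite sum_lt_ord; congr _%:Z; apply/minn_idPr; move: sN; clear; lia.
have W1 : in_W0 (1%g : 'S_(2 * N)).
  by apply/in_W0P; split; [rewrite odd_perm1|move=> i; rewrite !perm1].
pose A (a : 'S_(2 * N)) := [set l : 'I_(2 * N) | (l < s)%N && (tr t (a l) == 2)].
case: (arg_maxnP (fun a => #|A a|) W1) => a Wa Hmax.
have [Wa1 Wa2] := in_W0P _ Wa.
have [Hall|/forallPn[l1]] := boolP [forall l : 'I_(2 * N), (l < s)%N ==> (tr t (a l) == 2)].
  have H2 l : (l < s)%N -> tr t (a l) = 2 by move=> Hl; apply/eqP; move/forallP/(_ l)/implyP: Hall; apply.
  have H2' l : tr t (a l) = 2 -> (l < s)%N.
    move=> Hl; have := @psumr_eq0P _ _ xpredT (fun l : 'I_(2 * N) =>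
       ((tr t (a l) == 2) : nat)%:Z - ((l < s)%N : nat)%:Z).
    move=> /(_ _ _ l isT); rewrite Hl eqxx; case: (l < s)%N => // H.
    suff : (1 : int) = 0 by [].
    apply: H => [j _|]; last by rewrite sumrB Hcount Hs subrr.
    by rewrite subr_ge0; case: ltnP => // /H2 ->.
  exists a => //; apply: affperm_eqP => l; last by rewrite Hsrc src_tmu.
  rewrite tr_tmu -{1}(permKV a l); move: (a^-1%g l) => q {l}.
  rewrite mu_DE; last by rewrite ltnW.
  have [q1|q1] := ltnP q s; first by rewrite H2 //; move: q1 sN; clear; lia.
  have T2 : tr t (a q) != 2 by apply/eqP => /H2'; rewrite ltnNge q1.
  have := Hd (a q); rewrite -Wa2 => Hdq.
  have [q2|q2] := leqP (2 * N - s) q.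
    have rq : (rev_ord q < s)%N by rewrite /=; have := ltn_ord q; move: q2 sN; clear; lia.
    by move: Hdq; rewrite (H2 _ rq); clear; lia.
  have T0 : tr t (a (rev_ord q)) <> 2 by move=> /H2'; rewrite /=; have := ltn_ord q; move: q2 sN; clear; lia.
  by have := Hv (a q); move: T2 T0 Hdq; clear; lia.
rewrite negb_imply => /andP[l1s Hl1].
have [l2 l2s Hl2] : exists2 l2 : 'I_(2 * N), (s <= l2)%N & tr t (a l2) = 2.
  apply: NNPP => Hno; have := @psumr_eq0P _ _ xpredT (fun l : 'I_(2 * N) =>
       ((l < s)%N : nat)%:Z - ((tr t (a l) == 2) : nat)%:Z).
  move=> /(_ _ _ l1 isT); rewrite l1s (negbTE Hl1) => H; suff : (1 : int) = 0 by [].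
  apply: H => [j _|]; last by rewrite sumrB Hcount Hs subrr.
  rewrite subr_ge0; case: ltnP => Hj; first by case: eqP.
  by case: eqP => // Hj2; case: Hno; exists j.
have [c Wc [c1 c2]] := W0_swap sN l1s l2s.
have := Hmax (c * a)%g (in_W0M Wc Wa); rewrite /= leqNgt => /negP[].
apply: proper_card; apply/properP; split.
  apply/subsetP => l; rewrite !inE => /andP[Hl /eqP Hl'].
  rewrite Hl permM c2 ?Hl' //; first by apply/eqP => E; move: Hl1; rewrite -E Hl'.
  apply/eqP => E; move: Hl'; rewrite E Wa2; have := Hd (a l2); rewrite Hl2; clear; lia.
by exists l1; rewrite !inE l1s ?permM ?c1 ?Hl2 //= (negbTE Hl1).
Qed.

Hypothesis N1 : (1 < N)%N.
Variable R : realType.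
Notation S := (simple_reflection R N).

Lemma spinX_bruhat s x x' t : in_alc t -> bruhat_le S x x' -> spinX s (x' * t)%g -> spinX s (x * t)%g.
Proof.
move=> Ht; elim=> {x x'} [x y Hxy Hs|//|x y z _ IH1 _ IH2 Hs]; last by apply: IH1; apply: IH2.
have Hy : Wext y by case: Hxy => r _ [_ [k [k' [_ [Hw _] _]]]]; exact: word_Wext Hw.
have [i [j [d [Hr -> Hsd]]]] := bruhat_step_separated N1 Hxy.
by rewrite -mulgA; apply: spinX_down => //; rewrite (sd_alc N1).
Qed.

Lemma dist_bound s w : spinX s w -> dist w <= (2 * N)%N%:Z * (12 * N)%N%:Z ^+ 2.
Proof.
move=> [_ _ Hb _ _]; rewrite /dist.
apply: (@le_trans _ _ (\sum_(l < 2 * N) (12 * N)%N%:Z ^+ 2)); last first.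
  by rewrite sumr_const card_ord -mulr_natl natz.
apply: ler_sum => l _; have := Hb 0%N l (leq0n _); rewrite /X !ltn0 addr0 subr0 => Ht.
(* The translation entry is between 0 and 2, contributing at most 8 N, and two entries of [base]
   differ by less than 4 N. *)
have : - (12 * N)%N%:Z <= pt w l - base l <= (12 * N)%N%:Z.
  by rewrite /pt /base; have := ltn_ord l; have := ltn_ord (src w l); move: Ht; clear; nia.
by move: (pt w l - base l) => y /andP[y1 y2]; rewrite -subr_ge0 subr_sqr; apply: mulr_ge0; move: y1 y2; clear; lia.
Qed.

Lemma climb s t : (s < N)%N -> Wext t -> in_alc t -> forall x, in_Waff x -> spinX s (x * t)%g ->
  exists x' a, [/\ in_Waff x', in_W0 a, bruhat_le S x x' & (x' * t)%g = tmu s a].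
Proof.
move=> sN Wt At x; pose B : int := (2 * N)%N%:Z * (12 * N)%N%:Z ^+ 2.
have [n] := ubnP `|B - dist (x * t)%g|%N; elim: n x => // n IH x Hn Wx Hsp.
have [[H1 H2]|[i [j [d [Hr Hsd Hsp']]]]] := up_exists Hsp sN.
  by have [a Wa E] := maximal_tmu sN Hsp H1 H2; exists x, a; split=> //; exact: rt_refl.
have Hx := Waff_Wext Wx; have nij : i != j by case/andP: Hr; rewrite eq_sym.
have Wx' : in_Waff (root_reflection i j d * x)%g by apply: WaffM => //; apply: WaffR.
have Hst : bruhat_step S x (root_reflection i j d * x)%g.
  by apply: separated_bruhat_step => //; rewrite Hsd (sd_alc N1).
have [[c Hc] _ Hl] : Wext (x * t)%g by apply: WextM.
have Hxt : Wext (x * t)%g by apply: WextM.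
rewrite mulgA in Hsp'.
have Hdist : dist (x * t)%g < dist (root_reflection i j d * x * t)%g.
  rewrite -mulgA (@dist_refl _ _ i j d c) // => [|l]; last exact: src_rev.
  rewrite ltrDl pmulr_rgt0 //.
  have := sd_neq0 (x * t)%g d nij; have := sd_neq0 1%g d nij; move: Hsd.
  case: ltrgtP => // H1; case: ltrgtP => // H2 _ _ _; [exact: mulr_gt0|by rewrite nmulr_rgt0].
have [|x' [a [W' Wa Hb E]]] := IH _ _ Wx' Hsp'; last first.
  by exists x', a; split=> //; apply: rt_trans Hb; exact: rt_step.
have := dist_bound Hsp'; have := dist_bound Hsp; rewrite -/B; move: Hn Hdist.
by move: (dist _) (dist _) => y z; clear; lia.
Qed.

End Main.

Theorem theorem1p5 (R : realType) (m s : nat) (hm : (1 <= m)%N) (hs : (s <= m)%N)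
    (w : affperm (2 * m.+1)) (hw : in_Wext w) :
  admissible R (mu_D m.+1 s) w <-> spin_permissible s w.
Proof.
have N1 : (1 < m.+1)%N by [].
have sN : (s < m.+1)%N by [].
have Hw := in_WextP _ hw.
rewrite spinP ?(ltnW sN) //; split=> [[a Wa [x [x' [t [Wx Wx' Ht [Ew Et] Hb]]]]]|Hsp].
  have [_ At] := (in_OmegaP N1 R t).1 Ht.
  rewrite Ew; apply: (spinX_bruhat N1 At Hb); rewrite -Et.
  by apply: spinX_tmu => //; rewrite ltnW.
have [x [t [Wx Ht Ew]]] := alc_decompose N1 R Hw.
have [Wt At] := (in_OmegaP N1 R t).1 Ht.
rewrite Ew in Hsp; have [x' [a [Wx' Wa Hb E]]] := climb N1 R sN Wt At Wx Hsp.
by exists a => //; exists x, x', t; split.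
Qed.
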